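(* Let $\Lambda$ be a block and let $D=\underline\lambda(\mathbf a)\overline\mu$ be a stacked circle diagram for $\Lambda$. Assume the stacked circle diagrams $E_1=\underline\lambda(\mathbf b^{(1)})\overline\mu$ and $E_2=\underline\lambda(\mathbf b^{(2)})\overline\mu$ are each obtained from $D$ by a surgery, and that the stacked circle diagram $F=\underline\lambda(\mathbf c)\overline\mu$ is obtained from both $E_1$ and $E_2$ by a surgery. Then $$\mathrm{surg}_{E_1,F}\circ\mathrm{surg}_{D,E_1}=\mathrm{surg}_{E_2,F}\circ\mathrm{surg}_{D,E_2}.$$
   Context: **Weights and blocks.** A weight labels each vertex $i\in\mathbb Z_{>0}$ by one of $\times,\circ,\vee,\wedge$, almost all labels being $\circ$. A block $\Lambda$ is given by a block diagram $\Theta$ (a labelling of $\mathbb Z_{>0}$ by $\times,\circ,\diamond$, almost all $\circ$) and a parity: $\Lambda$ is the set of weights having $\times$, $\circ$ exactly where $\Theta$ has them, $\vee$ or $\wedge$ at the $\diamond$-positions, and number of $\wedge$'s of the given parity. $P$ is the set of $\diamond$-positions and $\mathrm p(i)=\#\{j\in P: j\le i\}$. **Cup diagrams.** A cup diagram $c$ (for $\Theta$) is a non-crossing collection of arcs drawn below the number line such that each point of $P$ lies on exactly one arc; an arc is a cup (joining two points of $P$) or a ray (going vertically down to infinity from a point of $P$). Each arc is dotted or undotted, where no dotted cup is nested inside another cup and no dotted cup or dotted ray lies to the right of a ray. Reflecting $c$ in the number line gives a cap diagram $c^*$. For $\lambda\in\Lambda$ the cup diagram $\underline\lambda$ is obtained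 so: connect successively neighbouring $\vee\wedge$ (ignoring already connected vertices and vertices not in $P$) by undotted cups as long as possible; attach undotted rays to the remaining $\vee$'s; connect the remaining $\wedge$'s in neighbouring pairs from left to right by dotted cups; if one $\wedge$ remains attach a dotted ray to it. Put $\overline\lambda=(\underline\lambda)^*$. **Stacked circle diagrams.** A stacked circle diagram of height $h\ge0$ for $\Lambda$ is $D=\underline\lambda(\mathbf a)\overline\mu$ with $\lambda,\mu\in\Lambda$ and $\mathbf a=(a_1,\dots,a_h)$ cup diagrams for $\Theta$. With $a_0=\underline\lambda$, $a_{h+1}^*=\overline\mu$, it is drawn by stacking the circle diagrams $a_la_{l+1}^*$, $0\le l\le h$, from bottom to top, the vertices of the $l$-th one being $(i,l)$, $i\in P$, and gluing the rays of $a_l$ with their mirror images in $a_l^*$ for $1\le l\le h$. An orientation is a sequence $\boldsymbol\nu=(\nu_0,\dots,\nu_h)\in\Lambda^{h+1}$ such that, with respect to $\nu_l$, each cup or cap of $a_la_{l+1}^*$ has end points labelled (left, right) $\vee\wedge$ or $\wedge\vee$ if undotted and $\wedge\wedge$ or $\vee\vee$ if dotted; undotted (resp. dotted) rays of $\underline\lambda$ and of $\overline\mu$ are labelled $\vee$ (resp. $\wedge$); and for each ray of $a_l$ ($1\le l\le h$) at $i$ the labels of $\nu_{l-1},\nu_l$ at $i$ agree. ${}_\lambda(\mathbb D^{\mathbf a}_\Lambda)_\mu$ is the complex vector space with basis the orientations $\underline\lambda(\mathbf a,\boldsymbol\nu)\overline\mu$ of $D$. Connected components are circles or lines; a line is propagating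 if one end is at the top and one at the bottom. An oriented circle is clockwise if the label at a vertex of it with maximal first coordinate is $\vee$ and anticlockwise if it is $\wedge$ (independent of the chosen such vertex); lines have only one orientation, called anticlockwise. For a vertex $v$ on a circle $C$ of an orientable $D$, $\mathrm{sign}_D(v)=(-1)^u$, $u$ the number of undotted cups and caps on a path of arcs in $C$ from $v$ to a vertex of $C$ with maximal first coordinate (independent of choices). **Surgery.** $D'=\underline\lambda(\mathbf b)\overline\mu$ is obtained from $D=\underline\lambda(\mathbf a)\overline\mu$ by a surgery at $i<j$ on level $l$ if $b_m=a_m$ for $m\ne l$ and the cup diagram $b_l$ is obtained from $a_l$ by replacing exactly one cup, joining $i$ and $j$, by two undotted rays. The map $\mathrm{surg}_{D,D'}:{}_\lambda(\mathbb D^{\mathbf a}_\Lambda)_\mu\to{}_\lambda(\mathbb D^{\mathbf b}_\Lambda)_\mu$ is $0$ if $D'$ is not orientable, and otherwise on basis vectors (components not involved keep their orientation): - Merge (the components $C_{l-1}\ni(i,l-1)$ and $C_l\ni(i,l)$ become one component $C$): both anticlockwise $\mapsto$ $C$ anticlockwise; exactly one, $C_r$ with $r\in\{l-1,l\}$, clockwise $\mapsto$ $\mathrm{sign}_D(i,r)\mathrm{sign}_{D'}(i,r)$ times $C$ clockwise ($0$ if $C$ is a line); both clockwise $\mapsto0$. - Split (one component $C$ becomes $C_i\ni(i,l)$ and $C_j\ni(j,l)$): $C$ anticlockwise $\mapsto(-1)^{\mathrm p(i)}\big(\mathrm{sign}_{D'}(j,l)[C_j\text{ clockwise},C_i\text{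 anticlockwise}]+\epsilon\,\mathrm{sign}_{D'}(i,l)[C_i\text{ clockwise},C_j\text{ anticlockwise}]\big)$ with $\epsilon=1$ if the removed cup was dotted and $-1$ otherwise, terms with a clockwise line being $0$; $C$ clockwise $\mapsto(-1)^{\mathrm p(i)}\mathrm{sign}_D(i,l)\mathrm{sign}_{D'}(i,l)\mathrm{sign}_{D'}(j,l)[C_i,C_j\text{ clockwise}]$. - Reconnect (two lines become two lines): the same $\boldsymbol\nu$ if it is an orientation of $D'$ and both lines in $D$ were propagating, and $0$ otherwise. *)

(* Defs.v *)
From HB Require Import structures.
From mathcomp Require Import all_boot all_order all_algebra.
From mathcomp Require Import reals.
From mathcomp.real_closed Require Import complex.

Set Implicit Arguments.
Unset Strict Implicit.
Unset Printing Implicit Defensive.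

Import GRing.Theory.
Local Open Scope ring_scope.

Variant wlabel := Cross | Circ | Vee | Wedge.
Variant blabel := BCross | BCirc | Diamond.

Definition wlabel_code (x : wlabel) : bool * bool :=
  match x with
  | Cross => (false, false) | Circ => (false, true)
  | Vee => (true, false) | Wedge => (true, true)
  end.
Definition wlabel_decode (c : bool * bool) : wlabel :=
  match c with
  | (false, false) => Cross | (false, true) => Circ
  | (true, false) => Vee | (true, true) => Wedge
  end.
Lemma wlabel_codeK : cancel wlabel_code wlabel_decode.
Proof. by case. Qed.
HB.instance Definition _ := Finite.copy wlabel (can_type wlabel_codeK).

(* A labelling of the positive integers, almost all labels being o, is given by
   its restriction to {1, ..., N} for some N beyond which all labels are o.  The
   ordinal k : 'I_N stands for the positive integer k + 1. *)
Record block := Block {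
  bsize : nat;
  bdiag : {ffun 'I_bsize -> blabel};
  bodd : bool  (* true: the number of Wedges is odd *)
}.

Definition pos (B : block) := 'I_(bsize B).

Definition inP (B : block) (i : pos B) : bool :=
  if bdiag B i is Diamond then true else false.

Definition pcount (B : block) (i : pos B) : nat :=
  #|[set j : pos B | inP j & (j <= i)%N]|.

Definition in_block (B : block) (w : {ffun pos B -> wlabel}) : bool :=
  [forall i, match bdiag B i with
             | BCross => w i == Cross
             | BCirc => w i == Circ
             | Diamond => (w i == Vee) || (w i == Wedge)
             end]
  && (odd #|[set i | w i == Wedge]| == bodd B).

Definition weight (B : block) := {w : {ffun pos B -> wlabel} | in_block w}.

(* A finite set of cups (left end, right end, dotted?) and a finite set of
   rays (position, dotted?). *)
Definition arcs (B : block) :=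
  ({set pos B * pos B * bool} * {set pos B * bool})%type.
Definition cups (B : block) (a : arcs B) : {set pos B * pos B * bool} := a.1.
Definition rays (B : block) (a : arcs B) : {set pos B * bool} := a.2.

Definition is_cup_diagram (B : block) (a : arcs B) : bool :=
  [&& [forall x in cups a, (x.1.1 < x.1.2)%N],
      (* each point of P is on exactly one arc, other points are on none *)
      [forall k : pos B,
         (#|[set x in cups a | (x.1.1 == k) || (x.1.2 == k)]|
          + #|[set r in rays a | r.1 == k]|)%N == inP k :> nat],
      [forall x in cups a, forall y in cups a,
         ~~ [&& x.1.1 < y.1.1, y.1.1 < x.1.2 & x.1.2 < y.1.2]%N],
      [forall x in cups a, forall r in rays a,
         ~~ ((x.1.1 < r.1)%N && (r.1 < x.1.2)%N)],
      (* no dotted cup is nested inside a cup *)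
      [forall x in cups a, forall y in cups a,
         x.2 ==> ~~ ((y.1.1 < x.1.1)%N && (x.1.2 < y.1.2)%N)],
      (* no dotted cup and no dotted ray is to the right of a ray *)
      [forall x in cups a, forall r in rays a, x.2 ==> ~~ (r.1 < x.1.1)%N]
    & [forall x in rays a, forall r in rays a, x.2 ==> ~~ (r.1 < x.1)%N]].

Definition cup_diagram (B : block) := {a : arcs B | is_cup_diagram a}.

Section CupDiagramOfWeight.
Variables (B : block) (w : weight B).

(* The leftmost neighbouring pair Vee Wedge in a list of positions, together
   with the list of the other positions. *)
Fixpoint extract (s : seq (pos B)) : option (pos B * pos B * seq (pos B)) :=
  if s is x :: t then
    if t is y :: t' then
      if (val w x == Vee) && (val w y == Wedge) then Some (x, y, t')
      else if extract t is Some (c, r) then Some (c, x :: r) else None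
    else None
  else None.

(* The cups obtained from at most n extractions, and the positions left. *)
Fixpoint connect_VW (n : nat) (s : seq (pos B)) :
    seq (pos B * pos B) * seq (pos B) :=
  if n is n'.+1 then
    if extract s is Some (c, r) then
      let p := connect_VW n' r in (c :: p.1, p.2)
    else ([::], s)
  else ([::], s).

Fixpoint pair_up (s : seq (pos B)) : seq (pos B * pos B) * seq (pos B) :=
  match s with
  | x :: y :: t => let p := pair_up t in ((x, y) :: p.1, p.2)
  | _ => ([::], s)
  end.

Definition underline : arcs B :=
  let s := [seq i <- enum (pos B) | inP i] in
  let p := connect_VW (size s) s in
  let q := pair_up [seq i <- p.2 | val w i == Wedge] in
  ([set x | (~~ x.2 && (x.1 \in p.1)) || (x.2 && (x.1 \in q.1))],
   [set x | (~~ x.2 && (x.1 \in [seq i <- p.2 | val w i == Vee]))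
            || (x.2 && (x.1 \in q.2))]).

End CupDiagramOfWeight.

Record stacked (B : block) (h : nat) := Stacked {
  lower : weight B;
  middle : h.-tuple (cup_diagram B);
  upper : weight B
}.

Section Stacked.
Variables (B : block) (h : nat).
Implicit Types (D : stacked B h).

(* layer D m is a_m for 0 <= m <= h + 1; a_m occurs in D as cup diagram below
   the vertices of level m (m <= h) and, reflected, above those of level m - 1
   (m >= 1). *)
Definition layer D (m : nat) : arcs B :=
  nth (set0, set0)
    (underline (lower D) :: rcons (map val (middle D)) (underline (upper D))) m.

(* Vertices (i, l); only those with i in P belong to the diagram, the others
   are not on any arc. *)
Definition vertex := (pos B * 'I_h.+1)%type.
Implicit Types (v w : vertex).

Definition joins (a : arcs B) (d : bool) (i j : pos B) : bool :=
  ((i, j, d) \in cups a) || ((j, i, d) \in cups a).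

Definition has_ray (a : arcs B) (i : pos B) : bool :=
  ((i, false) \in rays a) || ((i, true) \in rays a).

(* v and w are the two ends of a cup or a cap, dotted if d and undotted
   otherwise. *)
Definition cup_adj D (d : bool) v w : bool :=
  (v.2 == w.2)
  && (joins (layer D v.2) d v.1 w.1 || joins (layer D v.2.+1) d v.1 w.1).

(* v and w are the two ends of an arc glued from two rays. *)
Definition ray_adj D v w : bool :=
  (v.1 == w.1)
  && (((w.2 == v.2.+1 :> nat) && has_ray (layer D w.2) v.1)
      || ((v.2 == w.2.+1 :> nat) && has_ray (layer D v.2) v.1)).

Definition adj D v w : bool :=
  [|| cup_adj D false v w, cup_adj D true v w | ray_adj D v w].

Definition same_comp D v w : bool := connect (adj D) v w.

Definition bottom_end D v : bool :=
  (v.2 == 0%N :> nat) && has_ray (layer D 0) v.1.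

Definition top_end D v : bool :=
  (v.2 == h :> nat) && has_ray (layer D h.+1) v.1.

Definition on_line D v : bool :=
  [exists w, same_comp D v w && (bottom_end D w || top_end D w)].

Definition on_propagating_line D v : bool :=
  [exists w, same_comp D v w && bottom_end D w]
  && [exists w, same_comp D v w && top_end D w].

Definition rightmost D v w : bool :=
  same_comp D v w && [forall x, same_comp D v x ==> (x.1 <= w.1)%N].

(* Walks recording the parity of the number of undotted cups and caps. *)
Definition parity_step D (x y : vertex * bool) : bool :=
  if x.2 == y.2 then cup_adj D true x.1 y.1 || ray_adj D x.1 y.1
  else cup_adj D false x.1 y.1.

(* In an orientable diagram the parity is that of every walk from v to a
   rightmost vertex of its circle, so that asking for one odd walk is enough. *)
Definition sign_odd D v : bool :=
  [exists w, rightmost D v w && connect (parity_step D) (v, false) (w, true)].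

Definition label (nu : h.+1.-tuple (weight B)) v : wlabel :=
  val (tnth nu v.2) v.1.

Definition cups_oriented (a : arcs B) (w : weight B) : bool :=
  [forall x in cups a,
     (val w x.1.1, val w x.1.2) \in
       (if x.2 then [:: (Wedge, Wedge); (Vee, Vee)]
               else [:: (Vee, Wedge); (Wedge, Vee)])].

Definition end_rays_oriented (a : arcs B) (w : weight B) : bool :=
  [forall r in rays a, val w r.1 == if r.2 then Wedge else Vee].

Definition is_orientation D (nu : h.+1.-tuple (weight B)) : bool :=
  [&& [forall l : 'I_h.+1, cups_oriented (layer D l) (tnth nu l)
                           && cups_oriented (layer D l.+1) (tnth nu l)],
      end_rays_oriented (layer D 0) (tnth nu ord0),
      end_rays_oriented (layer D h.+1) (tnth nu ord_max)
    & [forall v, forall w, ray_adj D v w ==> (label nu v == label nu w)]].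

Definition orientation D :=
  {nu : h.+1.-tuple (weight B) | is_orientation D nu}.

(* The component of D containing v is oriented clockwise; otherwise it is
   oriented anticlockwise, in particular when it is a line. *)
Definition clockwise D (nu : orientation D) v : bool :=
  ~~ on_line D v && [exists w, rightmost D v w && (label (val nu) w == Vee)].

(* (l, i, j, d): a cup joining i < j, dotted if d, at level l + 1. *)
Definition surgery_site := ('I_h * pos B * pos B * bool)%type.

Definition surgery_at D D' (s : surgery_site) : bool :=
  let: (l, i, j, d) := s in
  let a := val (tnth (middle D) l) in
  let b := val (tnth (middle D') l) in
  [&& lower D' == lower D, upper D' == upper D,
      [forall m, (m != l) ==> (tnth (middle D') m == tnth (middle D) m)],
      (i, j, d) \in cups a,
      cups b == cups a :\ (i, j, d)
    & rays b == (i, false) |: ((j, false) |: rays a)].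

Definition surgery D D' : bool := [exists s, surgery_at D D' s].

(* The two levels l - 1 and l next to the middle cup diagram a_l, which has
   index l - 1 : 'I_h in the tuple. *)
Definition level_below (l : 'I_h) : 'I_h.+1 := widen_ord (leqnSn h) l.
Definition level_above (l : 'I_h) : 'I_h.+1 := lift ord0 l.

Section Surgery.
Variables (R : realType) (D D' : stacked B h).
Local Notation C := R[i].

Definition sign (E : stacked B h) v : C := (-1) ^+ sign_odd E v.

(* The coefficient of nu' in the image of nu.  A sum of basis vectors described
   by the orientations of the components of D' is encoded by testing which
   description nu' satisfies: no nu' satisfies one with a clockwise line, and
   there is no nu' at all when D' is not orientable. *)
Section Coefficient.
Variables (s : surgery_site) (nu : orientation D) (nu' : orientation D').
Local Notation l := s.1.1.1.
Local Notation i := s.1.1.2.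
Local Notation j := s.1.2.
Local Notation dotted := s.2.

Definition ilo : vertex := (i, level_below l).
Definition ihi : vertex := (i, level_above l).
Definition jhi : vertex := (j, level_above l).

Definition keeps_others : bool :=
  [forall v, [|| same_comp D ilo v, same_comp D ihi v
               | label (val nu') v == label (val nu) v]].

Definition is_merge : bool := ~~ same_comp D ilo ihi && same_comp D' ihi jhi.
Definition is_split : bool := same_comp D ilo ihi && ~~ same_comp D' ihi jhi.
Definition is_reconnect : bool :=
  [&& ~~ same_comp D ilo ihi, ~~ same_comp D' ihi jhi,
      on_line D ilo, on_line D ihi, on_line D' ihi & on_line D' jhi].

Definition merge_coef : C :=
  match clockwise nu ilo, clockwise nu ihi with
  | false, false => (~~ clockwise nu' ihi)%:R
  | true, false => sign D ilo * sign D' ilo * (clockwise nu' ihi)%:R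
  | false, true => sign D ihi * sign D' ihi * (clockwise nu' ihi)%:R
  | true, true => 0
  end.

Definition split_coef : C :=
  let cwi := clockwise nu' ihi in
  let cwj := clockwise nu' jhi in
  let eps : C := if dotted then 1 else -1 in
  (-1) ^+ pcount i *
  (if clockwise nu ihi
   then sign D ihi * sign D' ihi * sign D' jhi * (cwi && cwj)%:R
   else sign D' jhi * (cwj && ~~ cwi)%:R
        + eps * sign D' ihi * (cwi && ~~ cwj)%:R).

Definition reconnect_coef : C :=
  ([&& val nu' == val nu,
       on_propagating_line D ilo & on_propagating_line D ihi])%:R.

Definition surg_coef_at : C :=
  if is_merge then keeps_others%:R * merge_coef
  else if is_split then keeps_others%:R * split_coef
  else if is_reconnect then reconnect_coef
  else 0.

End Coefficient.

(* The site of a surgery is determined by D and D'. *)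
Definition surg_coef (nu : orientation D) (nu' : orientation D') : C :=
  if [pick s | surgery_at D D' s] is Some s then surg_coef_at s nu nu' else 0.

End Surgery.

(* The complex vector space with basis the orientations of D, an element being
   the family of its coordinates. *)
Definition Dspace (R : realType) D := {ffun orientation D -> R[i]^o}.

Definition surg (R : realType) D D' (x : Dspace R D) : Dspace R D' :=
  [ffun nu' => \sum_(nu : orientation D) x nu * surg_coef R nu nu'].

End Stacked.

Arguments surg {B h} R D D' x : rename.

(* Main.v *)
Require Import Defs.
From mathcomp Require Import all_boot all_order all_algebra.
From mathcomp Require Import reals.
From mathcomp.real_closed Require Import complex.
From mathcomp Require Import ring zify.

(** The space attached to a diagram has its orientations as a basis, and an
orientation is determined by the set of its clockwise circles: labels on lines
are forced, and circles can be reversed independently.  The proof replaces the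
basis by words.  For a sequence [w] of vertices, [word R D w] is the basis
vector whose clockwise circles are the circles through the letters of [w],
multiplied by the labels of the letters (1 for a Vee, -1 for a Wedge); it is 0
if two letters lie on one component or a letter lies on a line.  Moving a letter
along its circle multiplies a word by a ratio of labels, which is the same in
all orientations ([vee_ratio]), and the signs in the definition of the surgery
maps are such ratios.  So the maps become simple on words: a merge sends
[word D w] to [word D' w] ([surg_merge]), a reconnection multiplies by 0 or 1
([surg_reconnect]), and a split at [i < j] adds a letter at [j] or at [i]
([surg_split]).  As words span ([word_span]), both composites are known as soon
as the types of the four surgeries are.

The numbers of components of D and F restrict these types ([ncomp_surgery]).  In
the remaining cases, either both sides agree letter by letter, or one has to
compare the words added by two different splits, or to compare which lines
propagate.

Words added by splits at the sites s and t are compared by means of an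
orientation [y] common to all four diagrams; it exists unless one of the four is
not orientable ([common_orientation_side]), and then both sides vanish
([square_word_half_oriented]).  Call the sum of the label of a vertex and of the
parity of p its hue; it is constant along undotted arcs and rays and changes
along dotted cups.  Up to a sign given by the hue of [y] at the right end of the
removed cup, the words added by a split only depend on the components that it
creates ([split_word_signed]).  Hence the right ends of the two cups have to have
the same hue.

This follows from an invariant, [right_val].  Let S be a set of vertices that
contains both or none of the ends of each undotted arc.  The parity of the
number of elements of S to the right of a vertex v on the level of v, increased
by 1 + p(v) if v is in S, is constant along components ([right_val_comp]).  Its
values at two corners of a surgery on [i < j] differ by an amount that only
depends on p(i) and on which of the two are in S ([right_val_cups],
[right_val_rays]); taking for S the vertices of a given hue on one component
shows that the hues agree.

The same invariant replaces planarity.  It shows that the part of the diagram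
outside the removed cup and cap never joins opposite corners ([not_a_d],
[not_b_c]), whence the trichotomy of merges, splits and reconnections
([surgery_not_both]), the fact that each merge or split involves a circle
([merge_no_end], [split_no_end]), and the fact that two propagating lines are
reconnected to two lines that do not propagate ([reconnect_not_prop]). *)

Set Implicit Arguments.
Unset Strict Implicit.
Unset Printing Implicit Defensive.

(** * Parities in a cup diagram *)
Reserved Notation "\xor_ ( i | P ) F"
  (at level 41, F at level 41, i, P at level 50, format "\xor_ ( i  |  P )  F").
Notation "\xor_ ( i | P ) F" := (\big[addb/false]_(i | P) F).

Lemma odd_sum (I : finType) (P : pred I) (F : I -> nat) :
  odd (\sum_(i | P i) F i) = \xor_(i | P i) odd (F i).
Proof. by rewrite (big_morph odd oddD (erefl _)). Qed.

Lemma odd_card_xor (I : finType) (A P : pred I) :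
  odd #|[set i in A | P i]| = \xor_(i | i \in A) P i.
Proof.
rewrite -sum1_card odd_sum big_mkcond [RHS]big_mkcond; apply: eq_bigr => i _.
by rewrite inE; case: (i \in A); case: (P i).
Qed.

Lemma xor0 (I : finType) (P : pred I) (F : I -> bool) :
  (forall i, P i -> F i = false) -> \xor_(i | P i) F i = false.
Proof. exact: big1. Qed.

Lemma xor_split (I : finType) (P : pred I) (F G : I -> bool) :
  \xor_(i | P i) (F i (+) G i) = \xor_(i | P i) F i (+) \xor_(i | P i) G i.
Proof. exact: big_split. Qed.

(** Linear arithmetic on positions, whose values are abstracted to natural
numbers. *)
Ltac pos_lia :=
  repeat match goal with
  | H : is_true ?b |- _ => match b with context [nat_of_ord _] => revert H end
  end;
  repeat match goal with
  | |- context [@nat_of_ord ?m ?x] =>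
      let n := fresh "n" in set n := (@nat_of_ord m x); clearbody n; revert n
  end; clear; lia.

Section CupDiagram.
Variables (B : block) (a : arcs B).
Local Notation pos := (pos B).
Implicit Types (x y z : pos * pos * bool) (r : pos * bool) (k : pos).

Definition touches k x := (x.1.1 == k) || (x.1.2 == k).

Hypothesis Ha : is_cup_diagram a.

Lemma cup_lt x : x \in cups a -> x.1.1 < x.1.2.
Proof. by case/and5P: Ha => /forall_inP H _ _ _ _ /H. Qed.

Lemma cup_neq x : x \in cups a -> x.1.1 != x.1.2.
Proof. by move/cup_lt; rewrite neq_ltn => ->. Qed.

Lemma arc_count k :
  #|[set x in cups a | touches k x]| + #|[set r in rays a | r.1 == k]|
  = inP k :> nat.
Proof. by case/and5P: Ha => _ /forallP /(_ k) /eqP. Qed.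

Lemma cup_noncross x y : x \in cups a -> y \in cups a ->
  x.1.1 < y.1.1 -> y.1.1 < x.1.2 -> y.1.2 <= x.1.2.
Proof.
case/and5P: Ha => _ _ /forall_inP H _ _ /H /forall_inP {}H /H {H}.
by move=> H h1 h2; rewrite leqNgt; apply: contra H => ->; rewrite h1 h2.
Qed.

Lemma ray_notin_cup x r : x \in cups a -> r \in rays a ->
  x.1.1 < r.1 -> x.1.2 <= r.1.
Proof.
case/and5P: Ha => _ _ _ /forall_inP H _ /H /forall_inP {}H /H {}H h.
by move: H; rewrite h /= -leqNgt.
Qed.

Lemma dotted_not_nested x y : x \in cups a -> y \in cups a -> x.2 ->
  y.1.1 < x.1.1 -> y.1.2 <= x.1.2.
Proof.
case/and5P: Ha => _ _ _ _ /and3P [/forall_inP H _ _] /H /forall_inP {}H /H {}H.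
by move=> hx h; move: H; rewrite hx h /= -leqNgt.
Qed.

Lemma dotted_cup_ray x r : x \in cups a -> r \in rays a -> x.2 ->
  x.1.1 <= r.1.
Proof.
case/and5P: Ha => _ _ _ _ /and3P [_ /forall_inP H _] /H /forall_inP {}H /H {}H.
by move=> hx; move: H; rewrite hx /= -leqNgt.
Qed.

Lemma touches_unique k x y : x \in cups a -> y \in cups a ->
  touches k x -> touches k y -> x = y.
Proof.
move=> hx hy kx ky; apply/eqP; apply/negPn/negP => nxy.
have := arc_count k; have := leq_b1 (inP k).
suff : 1 < #|[set z in cups a | touches k z]| by lia.
rewrite (cardsD1 x) inE hx kx (cardsD1 y) !inE hy ky eq_sym nxy /=; lia.
Qed.

Lemma touches_ray k x r : x \in cups a -> r \in rays a ->
  touches k x -> r.1 == k -> False.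
Proof.
move=> hx hr kx kr.
have := arc_count k; have := leq_b1 (inP k).
rewrite (cardsD1 x) inE hx kx (cardsD1 r) !inE hr kr /=; lia.
Qed.

Lemma cup_inP x k : x \in cups a -> touches k x -> inP k.
Proof.
move=> hx kx; have := arc_count k.
by rewrite (cardsD1 x) inE hx kx; case: (inP k).
Qed.

Lemma cup_inP1 x : x \in cups a -> inP x.1.1.
Proof. by move/cup_inP; apply; rewrite /touches eqxx. Qed.

Lemma cup_inP2 x : x \in cups a -> inP x.1.2.
Proof. by move/cup_inP; apply; rewrite /touches eqxx orbT. Qed.

Lemma ray_inP r : r \in rays a -> inP r.1.
Proof.
move=> hr; have := arc_count r.1.
by rewrite (cardsD1 r) inE hr eqxx addnC; case: (inP r.1).
Qed.

(** Each point of P lies on exactly one arc, so a sum over points is a sum over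
the ends of arcs. *)
Lemma xor_points (S : pred pos) : {subset S <= @inP B} ->
  \xor_(k | true) S k
  = \xor_(x | x \in cups a) (S x.1.1 (+) S x.1.2) (+) \xor_(r | r \in rays a) S r.1.
Proof.
move=> SP.
have -> : \xor_(k | true) S k =
  \xor_(k | true) (\xor_(x | x \in cups a) (touches k x && S k) (+)
                   \xor_(r | r \in rays a) ((r.1 == k) && S k)).
  apply: eq_bigr => k _; case Sk: (S k); last first.
    by rewrite !xor0 // => i _; rewrite andbF.
  have kP : inP k := SP k Sk.
  transitivity (odd (inP k)); first by rewrite kP.
  rewrite -(arc_count k) oddD !odd_card_xor.
  by congr (_ (+) _); apply: eq_bigr => x _; rewrite andbT.
rewrite xor_split exchange_big /= [X in _ (+) X = _]exchange_big /=.
congr (_ (+) _).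
  apply: eq_bigr => x hx; rewrite (bigD1 x.1.1) //= (bigD1 x.1.2) /=; last first.
    by rewrite eq_sym cup_neq.
  rewrite /touches !eqxx orbT xor0 ?addbF // => k /andP [h1 h2].
  by rewrite eq_sym (negPf h1) eq_sym (negPf h2).
apply: eq_bigr => r hr; rewrite (bigD1 r.1) //= eqxx xor0 ?addbF // => k h1.
by rewrite eq_sym (negPf h1).
Qed.

Definition right_parity (S : pred pos) k := \big[addb/false]_(k' : pos | k < k') S k'.

(** No ray and no dotted cup lies under a cup, so the points strictly under it
are joined in pairs by undotted cups and cancel; only the right end of the cup
remains. *)
Lemma right_parity_cup (S : pred pos) x : {subset S <= @inP B} -> x \in cups a ->
  (forall z, z \in cups a -> z.2 = false -> x.1.1 < z.1.1 -> z.1.2 < x.1.2 ->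
     S z.1.1 = S z.1.2) ->
  right_parity S x.1.1 = right_parity S x.1.2 (+) S x.1.2.
Proof.
move=> SP hx Hin.
have lx := cup_lt hx.
rewrite {1}/right_parity (bigID (fun k : pos => x.1.2 < k)) /=.
have -> : \big[addb/false]_(k : pos | (x.1.1 < k) && (x.1.2 < k)) S k = right_parity S x.1.2.
  by apply: eq_bigl => k; lia.
congr (_ (+) _).
rewrite (bigD1 x.1.2) /=; last by rewrite ltnn lx.
rewrite -[RHS]addbF; congr (_ (+) _).
pose S' : pred pos := fun k => (x.1.1 < k < x.1.2) && S k.
have -> : \big[addb/false]_(k : pos | (x.1.1 < k) && ~~ (x.1.2 < k) && (k != x.1.2)) S k = \xor_(k | true) S' k.
  rewrite big_mkcond; apply: eq_bigr => k _; rewrite /S'.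
  have -> : (x.1.1 < k) && ~~ (x.1.2 < k) && (k != x.1.2) = (x.1.1 < k < x.1.2).
    rewrite -leqNgt -andbA; congr (_ && _).
    by rewrite andbC -val_eqE /= -ltn_neqAle.
  by case: ifP.
rewrite xor_points; last by move=> k /andP [_ /SP].
rewrite !xor0 // => [r hr|z hz]; rewrite /S'.
  by case: (ltnP x.1.1 r.1) => //= h; rewrite ltnNge (ray_notin_cup hx hr h).
case: (eqVneq z x) => [->|nzx]; first by rewrite !ltnn andbF.
have lz := cup_lt hz.
have d1 : (z.1.1 : nat) != x.1.1.
  apply/eqP => /val_inj e; case/eqP: nzx; apply: (touches_unique (k := x.1.1)) => //;
  by rewrite /touches ?e eqxx.
have d2 : (z.1.2 : nat) != x.1.1.
  apply/eqP => /val_inj e; case/eqP: nzx; apply: (touches_unique (k := x.1.1)) => //;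
  by rewrite /touches ?e eqxx ?orbT.
have d3 : (z.1.1 : nat) != x.1.2.
  apply/eqP => /val_inj e; case/eqP: nzx; apply: (touches_unique (k := x.1.2)) => //;
  by rewrite /touches ?e eqxx ?orbT.
have d4 : (z.1.2 : nat) != x.1.2.
  apply/eqP => /val_inj e; case/eqP: nzx; apply: (touches_unique (k := x.1.2)) => //;
  by rewrite /touches ?e eqxx ?orbT.
move: (cup_noncross hx hz) (cup_noncross hz hx) => c1 c2.
have {}c1 : [&& x.1.1 < z.1.1 & z.1.1 < x.1.2] ==> (z.1.2 <= x.1.2).
  by apply/implyP => /andP [] /c1.
have {}c2 : [&& z.1.1 < x.1.1 & x.1.1 < z.1.2] ==> (x.1.2 <= z.1.2).
  by apply/implyP => /andP [] /c2.
have [h1|h1] := boolP (x.1.1 < z.1.1 < x.1.2); last first.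
  have -> : (x.1.1 < z.1.2 < x.1.2) = false by pos_lia.
  by [].
have h2 : x.1.1 < z.1.2 < x.1.2 by pos_lia.
rewrite h2 /= Hin ?addbb //; [|pos_lia|pos_lia].
apply/negP => dz.
have {}h1 : x.1.1 < z.1.1 by pos_lia.
have := dotted_not_nested hz hx dz h1; pos_lia.
Qed.

(** To the right of a ray there are only whole arcs, so the count there is a sum
over arcs.  Applied to the points of one set on two levels, this compares the
counts above and below a glued ray. *)
Lemma right_parity_ray (S1 S2 : pred pos) r :
  {subset S1 <= @inP B} -> {subset S2 <= @inP B} -> r \in rays a ->
  (forall z, z \in cups a -> r.1 < z.1.1 ->
     S1 z.1.1 (+) S1 z.1.2 = S2 z.1.1 (+) S2 z.1.2) ->
  (forall r', r' \in rays a -> r.1 < r'.1 -> S1 r'.1 = S2 r'.1) ->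
  right_parity S1 r.1 = right_parity S2 r.1.
Proof.
move=> SP1 SP2 hr Hcup Hray.
pose S1' : pred pos := fun k => (r.1 < k) && S1 k.
pose S2' : pred pos := fun k => (r.1 < k) && S2 k.
have e1 : right_parity S1 r.1 = \xor_(k | true) S1' k by exact: big_mkcond.
have e2 : right_parity S2 r.1 = \xor_(k | true) S2' k by exact: big_mkcond.
rewrite e1 e2 !xor_points; [|by move=> k /andP [_ /SP2]|by move=> k /andP [_ /SP1]].
congr (_ (+) _); apply: eq_bigr => z hz; rewrite /S1' /S2'.
  have lz := cup_lt hz; case: (ltnP r.1 z.1.1) => h.
    by rewrite (ltn_trans h lz) /= Hcup.
  have {}h : z.1.1 < r.1.
    rewrite ltn_neqAle h andbT; apply/eqP => /val_inj e.
    by apply: (@touches_ray z.1.1 z r) => //; rewrite /touches ?e eqxx.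
  by rewrite [r.1 < z.1.2]ltnNge (ray_notin_cup hz hr h).
by case: (ltnP r.1 z.1) => //= h; rewrite Hray.
Qed.

Lemma odd_pcountE k : odd (pcount k) = \xor_(k' | true) @inP B k' (+) right_parity (@inP B) k.
Proof.
rewrite /pcount odd_card_xor.
rewrite [in RHS](bigID (fun k' : pos => k' <= k)) /= -/(right_parity _ _).
have -> : \big[addb/false]_(k' : pos | inP k') (k' <= k) = \big[addb/false]_(k' : pos | k' <= k) inP k'.
  rewrite big_mkcond [RHS]big_mkcond; apply: eq_bigr => k' _.
  by case: (inP k'); case: (k' <= k).
have -> : \big[addb/false]_(k' : pos | ~~ (k' <= k)) inP k' = right_parity (@inP B) k.
  by apply: eq_bigl => k'; rewrite ltnNge.
by rewrite -addbA addbb addbF.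
Qed.

(** The points of P strictly under a cup are joined in pairs. *)
Lemma pcount_cup x : x \in cups a -> odd (pcount x.1.2) = ~~ odd (pcount x.1.1).
Proof.
move=> hx; rewrite !odd_pcountE (right_parity_cup (S := @inP B) _ hx) //; last first.
  by move=> z hz _ _ _; rewrite (cup_inP1 hz) (cup_inP2 hz).
by rewrite (cup_inP2 hx) addbT addbN negbK.
Qed.

(** To the left of a dotted cup there are no rays, and no cup leads out of this
region, as it would contain the dotted cup: the points there are joined in
pairs. *)
Lemma left_dotted (S : pred pos) x : {subset S <= @inP B} -> x \in cups a -> x.2 ->
  (forall z, z \in cups a -> S z.1.1 = S z.1.2) ->
  \big[addb/false]_(k : pos | k < x.1.1) S k = false.
Proof.
move=> SP hx dx Sc; have lx := cup_lt hx.
pose S' : pred pos := fun k => (k < x.1.1) && S k.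
have -> : \big[addb/false]_(k : pos | k < x.1.1) S k = \xor_(k | true) S' k.
  exact: big_mkcond.
rewrite xor_points; last by move=> k /andP [_ /SP].
rewrite !xor0 // => [r hr|z hz]; rewrite /S'.
  by rewrite [r.1 < _]ltnNge (dotted_cup_ray hx hr dx).
have lz := cup_lt hz.
case: (ltnP z.1.1 x.1.1) => h1; last first.
  by rewrite ltnNge (leq_trans h1 (ltnW lz)).
case: (ltnP z.1.2 x.1.1) => h2; first by rewrite /= Sc // addbb.
have h3 := dotted_not_nested hx hz dx h1.
have nzx : z <> x by move=> e; rewrite e ltnn in h1.
case: (eqVneq z.1.2 x.1.1) => e.
  case: nzx; apply: (touches_unique (k := x.1.1)) => //; rewrite /touches ?eqxx //.
  by rewrite e eqxx orbT.
have h4 : x.1.1 < z.1.2 by rewrite ltn_neqAle h2 andbT eq_sym val_eqE.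
have h5 := cup_noncross hz hx h1 h4.
have {}e : z.1.2 = x.1.2 by apply/val_inj/eqP; rewrite eqn_leq h3 h5.
case: nzx; apply: (touches_unique (k := x.1.2)) => //; rewrite /touches ?eqxx ?orbT //.
by rewrite e eqxx orbT.
Qed.

(** By [left_dotted], applied to all points of P. *)
Lemma pcount_dotted x : x \in cups a -> x.2 -> odd (pcount x.1.1).
Proof.
move=> hx dx.
rewrite odd_pcountE (bigID (fun k : pos => k < x.1.1)) /= (left_dotted (S := @inP B)) //; last first.
  by move=> z hz; rewrite (cup_inP1 hz) (cup_inP2 hz).
rewrite (bigD1 x.1.1) /= ?ltnn // (cup_inP1 hx) /=.
suff -> : \big[addb/false]_(k : pos | ~~ (k < x.1.1) && (k != x.1.1)) inP k = right_parity (@inP B) x.1.1.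
  by rewrite addNb addbb.
by apply: eq_bigl => k; rewrite -leqNgt andbC eq_sym -val_eqE -ltn_neqAle.
Qed.

Lemma xor_closed (S : pred pos) : {subset S <= @inP B} ->
  (forall z, z \in cups a -> S z.1.1 = S z.1.2) ->
  \xor_(k | true) S k = \xor_(r | r \in rays a) S r.1.
Proof.
move=> SP H; rewrite xor_points // xor0 //= => z hz.
by rewrite (H z hz) addbb.
Qed.
End CupDiagram.

(** * The cup diagram of a weight *)
Section Underline.
Variables (B : block) (w : weight B).
Local Notation pos := (pos B).
Implicit Types (s r : seq pos) (c d : pos * pos) (k x y z : pos).

Definition lt_pos x y := x < y.
Definition endpoints (cs : seq (pos * pos)) : seq pos :=
  flatten [seq [:: c.1; c.2] | c <- cs].

Lemma lt_pos_trans : transitive lt_pos.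
Proof. by move=> x y z; exact: ltn_trans. Qed.

Definition not_vw x y := ~~ ((val w x == Vee) && (val w y == Wedge)).

Lemma extractP s :
  match extract w s with
  | Some (c, r) => exists s1 s2, s = s1 ++ c.1 :: c.2 :: s2 /\ r = s1 ++ s2
  | None => sorted not_vw s
  end.
Proof.
have extractE x y t : extract w (x :: y :: t) =
    if (val w x == Vee) && (val w y == Wedge) then Some (x, y, t)
    else if extract w (y :: t) is Some (c, r) then Some (c, x :: r) else None.
  by [].
elim: s => [//|x [//|y t] IH]; rewrite extractE.
case: ifP => [_|nxy]; first by exists [::], t.
case: (extract w (y :: t)) IH => [[c r]|] IH; last by rewrite /= {1}/not_vw nxy.
by case: IH => s1 [s2 [-> ->]]; exists (x :: s1), s2.
Qed.

Lemma endpoints_sub (cs : seq (pos * pos)) c : c \in cs ->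
  (c.1 \in endpoints cs) /\ (c.2 \in endpoints cs).
Proof.
by move=> cc; split; apply/flattenP; exists [:: c.1; c.2];
  rewrite ?inE ?eqxx ?orbT //; apply: map_f.
Qed.

(** A cup is drawn when its ends are neighbours among the points that remain, so
no later point and no end of a later cup lies between them. *)
Lemma connect_VWP n s : sorted lt_pos s ->
  let p := connect_VW w n s in
  [/\ perm_eq s (endpoints p.1 ++ p.2) /\ subseq p.2 s,
      {in p.1, forall c, c.1 < c.2},
      {in p.1 & p.2, forall c z, ~~ (c.1 < z < c.2)},
      {in p.1 &, forall c d, ~~ [&& c.1 < d.1, d.1 < c.2 & c.2 < d.2]}
    & size s <= n -> sorted not_vw p.2].
Proof.
elim: n s => [|n IH] s ss /=; first by case: s ss.
have := extractP s; case: (extract w s) => [[[x y] r]|] /=; last by [].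
move=> [s1 [s2 [es er]]].
have sr : subseq r s.
  rewrite es er; apply: cat_subseq => //.
  exact: (suffix_subseq [:: x; y] s2).
have pws : pairwise lt_pos s by rewrite -sorted_pairwise //; exact: lt_pos_trans.
have lxy : x < y.
  by move: pws; rewrite es pairwise_cat /= => /and3P [_ _ /andP [/andP [h _] _]].
have out z : z \in r -> ~~ (x < z < y).
  move: pws; rewrite es er pairwise_cat /= => /and3P [/allrelP h1 _ /andP [_ /andP [/allP h3 _]]].
  rewrite mem_cat => /orP [zs1|zs2]; last first.
    by have := h3 z zs2; rewrite /lt_pos; pos_lia.
  by rewrite ltnNge (ltnW (h1 z x zs1 _)) // inE eqxx.
have [[pr subr] H1 H2 H3 H4] := IH r (subseq_sorted lt_pos_trans sr ss).
set p := connect_VW w n r in pr subr H1 H2 H3 H4 *.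
have inr c : c \in p.1 -> c.1 \in r /\ c.2 \in r.
  by move=> /endpoints_sub [h1 h2]; rewrite !(perm_mem pr) !mem_cat h1 h2.
split.
- split; last exact: subseq_trans sr.
  change (perm_eq s ([:: x; y] ++ (endpoints p.1 ++ p.2))).
  rewrite es -[x :: y :: s2]/([:: x; y] ++ s2) perm_catCA perm_cat2l.
  by rewrite -er.
- by move=> c; rewrite inE => /predU1P [->|/H1].
- move=> c z; rewrite inE => /predU1P [->|hc] hz; last exact: H2.
  by apply: out; apply: (mem_subseq subr).
- move=> c d; rewrite !inE => /predU1P [->|hc] /predU1P [->|hd] /=.
  + by rewrite ltnn.
  + by have := out _ (inr _ hd).1; rewrite negb_and => /orP [/negPf ->|/negPf ->] //; rewrite andbF.
  + have := out _ (inr _ hc).2; rewrite negb_and => /orP [/negPf ->|/negPf ->]; by rewrite ?andbF.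
  + exact: H3.
- move=> sz; apply: H4; move: sz; rewrite es er !size_cat /= !addnS ltnS; exact: ltnW.
Qed.

Lemma pair_upP s : sorted lt_pos s ->
  let p := pair_up s in
  [/\ perm_eq s (endpoints p.1 ++ p.2),
      {in p.1, forall c, c.1 < c.2},
      {in p.1 & p.2, forall c z, c.2 < z},
      {in p.1 &, forall c d, [|| c == d, c.2 < d.1 | d.2 < c.1]}
    & size p.2 <= 1].
Proof.
have [n] := ubnP (size s); elim: n s => // n IH [|x [|y t]] //= sz.
rewrite -/(sorted lt_pos (x :: y :: t)) => ss.
have pws : pairwise lt_pos (x :: y :: t) by rewrite -sorted_pairwise //; exact: lt_pos_trans.
move: (pws) => /= /andP [/andP [lxy /allP hx] /andP [/allP hy pwt]].
have st : sorted lt_pos t by rewrite sorted_pairwise //; exact: lt_pos_trans.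
have [||pr H1 H2 H3 H4] := IH t; rewrite ?st //; first exact: (ltnW sz).
set p := pair_up t in pr H1 H2 H3 H4 *.
have inr c : c \in p.1 -> c.1 \in t /\ c.2 \in t.
  by move=> /endpoints_sub [h1 h2]; rewrite !(perm_mem pr) !mem_cat h1 h2.
split => //.
- by rewrite /endpoints /= !perm_cons.
- by move=> c; rewrite inE => /predU1P [->|/H1].
- move=> c z; rewrite inE => /predU1P [->|hc] hz; last exact: H2.
  by apply: hy; rewrite (perm_mem pr) mem_cat hz orbT.
- move=> c d; rewrite !inE => /predU1P [->|hc] /predU1P [->|hd] /=.
  + by rewrite eqxx.
  + by have h : y < d.1 := hy _ (inr _ hd).1; rewrite h orbT.
  + by have h : y < c.1 := hy _ (inr _ hc).1; rewrite h !orbT.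
  + exact: H3.
Qed.

Lemma count_endpoints (cs : seq (pos * pos)) k :
  {in cs, forall c, c.1 < c.2} ->
  count_mem k (endpoints cs) = count (fun c => (c.1 == k) || (c.2 == k)) cs.
Proof.
elim: cs => //= c cs IH H; rewrite IH; last by move=> d dc; apply: H; rewrite inE dc orbT.
have : c.1 != c.2 by rewrite -val_eqE neq_ltn H // mem_head.
case: (eqVneq c.1 k) => [e1|_]; case: (eqVneq c.2 k) => [e2|_] //=.
by rewrite e1 e2 eqxx.
Qed.

Lemma endpoints_uniq (cs : seq (pos * pos)) : uniq (endpoints cs) -> uniq cs.
Proof.
elim: cs => //= c cs IH /and3P [h1 h2 /IH ->]; rewrite andbT.
apply/negP => /endpoints_sub [hc _]; move: h1; rewrite inE negb_or.
by rewrite hc andbF.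
Qed.

Lemma weight_label k : inP k -> val w k = Vee \/ val w k = Wedge.
Proof.
rewrite /inP; case/andP: (valP w) => /forallP /(_ k) H _.
by case: (bdiag B k) H => // /orP [] /eqP; [left|right].
Qed.

Let s := [seq i <- enum pos | inP i].
Let p := connect_VW w (size s) s.
Let q := pair_up [seq i <- p.2 | val w i == Wedge].
Let vees := [seq i <- p.2 | val w i == Vee].

Lemma sorted_points : sorted lt_pos s.
Proof.
apply: sorted_filter; first exact: lt_pos_trans.
have := iota_ltn_sorted 0 (bsize B); rewrite -val_enum_ord sorted_map.
by apply: sub_sorted.
Qed.

(** Among the points that remain, a Vee is only followed by Vees, since no
neighbouring Vee Wedge is left. *)
Lemma wedge_before_vee x y : x \in p.2 -> y \in p.2 ->
  val w x = Vee -> val w y = Wedge -> y < x.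
Proof.
have [[pr subr] _ _ _ H] := connect_VWP (size s) sorted_points.
have subP k : k \in p.2 -> inP k.
  by move=> /(mem_subseq subr); rewrite mem_filter => /andP [].
have := subseq_sorted lt_pos_trans subr sorted_points.
have {}H := H (leqnn _).
rewrite -/p in H *.
elim: (p.2) subP H => //= z r IH subP Hz lz.
have sr : sorted not_vw r by case: (r) Hz => //= ? ? /andP [].
have lr : sorted lt_pos r by case: (r) lz => //= ? ? /andP [].
have zr : all (lt_pos z) r by apply: order_path_min => //; exact: lt_pos_trans.
have subr' k : k \in r -> inP k by move=> kr; apply: subP; rewrite inE kr orbT.
have zv : val w z = Vee -> {in r, forall k, val w k = Vee}.
  move=> ez; elim: (r) z ez Hz {IH sr lr zr lz} subr' {subP} => //= u r' IH z ez.
  move=> /andP [nzu pu] subr' k.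
  have wu : val w u = Vee.
    case: (@weight_label u) => //; first by apply: subr'; rewrite inE eqxx.
    by move=> e; move: nzu; rewrite /not_vw ez e.
  rewrite inE => /predU1P [->//|kr]; apply: (IH u) => // k' k'r; apply: subr'.
  by rewrite inE k'r orbT.
rewrite !inE => /predU1P [->|xr] /predU1P [->|yr] wx wy.
- by rewrite wx in wy.
- by rewrite (zv wx y yr) in wy.
- exact: (allP zr).
- exact: IH.
Qed.

(** The ends of the dotted arcs are remaining Wedges.  These lie under no
undotted cup, and they precede the remaining Vees, where the undotted rays are;
this gives the conditions on dotted arcs.  Each point of P is used once because
the points are permuted, not duplicated, by the construction. *)
Lemma underline_cup_diagram : is_cup_diagram (underline w).
Proof.
have [[pr subr] P1 P2 P3 _] := connect_VWP (size s) sorted_points.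
rewrite -/p in pr subr P1 P2 P3.
have sq : sorted lt_pos [seq i <- p.2 | val w i == Wedge].
  apply: sorted_filter; first exact: lt_pos_trans.
  exact: (subseq_sorted lt_pos_trans subr sorted_points).
have [qr Q1 Q2 Q3 Q4] := pair_upP sq; rewrite -/q in qr Q1 Q2 Q3 Q4.
have inw z : z \in endpoints q.1 ++ q.2 -> z \in p.2 /\ val w z = Wedge.
  by rewrite -(perm_mem qr) mem_filter => /andP [/eqP -> ->].
have q1w c : c \in q.1 -> [/\ c.1 \in p.2, c.2 \in p.2, val w c.1 = Wedge & val w c.2 = Wedge].
  move=> /endpoints_sub [h1 h2].
  by have [] := inw c.1; have [] := inw c.2; rewrite ?mem_cat ?h1 ?h2.
have q2w z : z \in q.2 -> z \in p.2 /\ val w z = Wedge.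
  by move=> h; apply: inw; rewrite mem_cat h orbT.
have veesw z : z \in vees -> z \in p.2 /\ val w z = Vee.
  by rewrite mem_filter => /andP [/eqP -> ->].
have p2P z : z \in p.2 -> inP z.
  by move=> /(mem_subseq subr); rewrite mem_filter => /andP [].
have full : perm_eq s (endpoints p.1 ++ endpoints q.1 ++ (vees ++ q.2)).
  apply: (perm_trans pr); rewrite perm_cat2l.
  rewrite perm_sym perm_catCA perm_sym.
  apply: (@perm_trans _ (vees ++ [seq i <- p.2 | val w i == Wedge])); last first.
    by rewrite perm_cat2l.
  rewrite perm_sym; apply: perm_trans (permEl (perm_filterC (fun i => val w i == Vee) p.2)).
  rewrite perm_cat2l.
  suff -> : [seq i <- p.2 | val w i == Wedge] = [seq i <- p.2 | predC (fun i => val w i == Vee) i] by [].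
  apply: eq_in_filter => z /p2P /weight_label [] /= -> //.
have us : uniq s by rewrite filter_uniq ?enum_uniq.
have up2 : uniq p.2 := subseq_uniq subr us.
have {}us : uniq (endpoints p.1 ++ endpoints q.1 ++ (vees ++ q.2)).
  by rewrite -(perm_uniq full).
move: (us); rewrite !cat_uniq => /and3P [u1 _ /and3P [u2 _ /and3P [u3 _ u4]]].
have incups (x : pos * pos * bool) : (x \in cups (underline w)) = ((x.1 \in p.1) && ~~ x.2) || ((x.1 \in q.1) && x.2).
  by rewrite /cups /underline /= inE -/s -/p -/q andbC [x.2 && _]andbC.
have inrays (r : pos * bool) : (r \in rays (underline w)) = ((r.1 \in vees) && ~~ r.2) || ((r.1 \in q.2) && r.2).
  by rewrite /rays /underline /= inE -/s -/p -/q andbC [r.2 && _]andbC.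
have p1lt k c : c \in p.1 -> k \in p.2 -> c.1 < k -> c.2 <= k.
  by move=> hc hk h; have := P2 c k hc hk; rewrite h /= -leqNgt.
have vq z y : z \in p.2 -> val w z = Wedge -> y \in vees -> z < y.
  by move=> h1 h2 /veesw [h3 h4]; apply: wedge_before_vee.
apply/and5P; split; [| | | |apply/and3P; split].
- by apply/forall_inP => x; rewrite incups => /orP [/andP [/P1]|/andP [/Q1]].
- apply/forallP => k; apply/eqP.
  set A := [set x in cups _ | _]; set A' := [set r in rays _ | _].
  have -> : inP k = count_mem k s :> nat.
    rewrite count_uniq_mem /s; last by rewrite filter_uniq ?enum_uniq.
    by rewrite mem_filter mem_enum andbT.
  rewrite (permP full) !count_cat !count_endpoints // addnA; congr (_ + _).
    pose L := [seq (c, false) | c <- p.1 & (c.1 == k) || (c.2 == k)]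
           ++ [seq (c, true) | c <- q.1 & (c.1 == k) || (c.2 == k)].
    have uL : uniq L.
      rewrite cat_uniq !map_inj_uniq ?filter_uniq ?endpoints_uniq //=; try by move=> ? ? [].
      by rewrite andbT; apply/hasPn => x /mapP [c _ ->]; apply/negP => /mapP [].
    have <- : size L = count (fun c => (c.1 == k) || (c.2 == k)) p.1 + count (fun c => (c.1 == k) || (c.2 == k)) q.1.
      by rewrite size_cat !size_map !size_filter.
    rewrite -(card_uniqP uL); apply: eq_card => -[c d].
    rewrite inE incups mem_cat /=; case: d; rewrite ?andbT ?andbF /= ?orbF.
      have -> : ((c, true) \in [seq (c0, false) | c0 <- p.1 & (c0.1 == k) || (c0.2 == k)]) = false.
        by apply/negP => /mapP [].
      by rewrite mem_map ?mem_filter 1?andbC // => ? ? [].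
    have -> : ((c, false) \in [seq (c0, true) | c0 <- q.1 & (c0.1 == k) || (c0.2 == k)]) = false.
      by apply/negP => /mapP [].
    by rewrite orbF mem_map ?mem_filter 1?andbC // => ? ? [].
  pose L := [seq (z, false) | z <- vees & z == k] ++ [seq (z, true) | z <- q.2 & z == k].
  have uL : uniq L.
    rewrite cat_uniq !map_inj_uniq ?filter_uniq ?up2 //=; try by move=> ? ? [].
    by rewrite andbT; apply/hasPn => x /mapP [c _ ->]; apply/negP => /mapP [].
  transitivity (size L); last by rewrite size_cat !size_map !size_filter.
  rewrite -(card_uniqP uL); apply: eq_card => -[z d].
  rewrite inE inrays mem_cat /=; case: d; rewrite ?andbT ?andbF /= ?orbF.
    have -> : ((z, true) \in [seq (y, false) | y <- vees & y == k]) = false.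
      by apply/negP => /mapP [].
    by rewrite mem_map ?mem_filter 1?andbC // => ? ? [].
  have -> : ((z, false) \in [seq (y, true) | y <- q.2 & y == k]) = false.
    by apply/negP => /mapP [].
  by rewrite orbF mem_map ?mem_filter 1?andbC // => ? ? [].
- apply/forall_inP => x hx; apply/forall_inP => y hy; move: hx hy; rewrite !incups.
  move=> /orP [] /andP [hx _] /orP [] /andP [hy _]; first exact: P3.
  + have [h1 _ _ _] := q1w _ hy.
    apply/negP => /and3P [c1 c2 _]; have := p1lt _ _ hx h1 c1; pos_lia.
  + have [_ h1 _ _] := q1w _ hx.
    apply/negP => /and3P [c1 c2 c3]; have := p1lt _ _ hy h1 c2; pos_lia.
  + have := Q1 _ hx; have := Q1 _ hy.
    have := Q3 _ _ hx hy => /or3P [/eqP ->|h|h] h1 h2; pos_lia.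
- apply/forall_inP => x hx; apply/forall_inP => r hr; move: hx hr; rewrite incups inrays.
  move=> /orP [] /andP [hx _] /orP [] /andP [hr _].
  + by apply: P2 => //; case/veesw: hr.
  + by apply: P2 => //; case/q2w: hr.
  + by have [_ h1 _ h2] := q1w _ hx; have := vq _ _ h1 h2 hr; pos_lia.
  + by have := Q2 _ _ hx hr; pos_lia.
- apply/forall_inP => x hx; apply/forall_inP => y hy; apply/implyP => dx.
  move: hx hy; rewrite !incups dx /= andbF andbT /= => hx.
  have [h1 _ _ _] := q1w _ hx.
  move=> /orP [] /andP [hy _]; apply/negP => /andP [c1 c2].
    by have := p1lt _ _ hy h1 c1; have := Q1 _ hx; pos_lia.
  by have := Q1 _ hx; have := Q3 _ _ hx hy => /or3P [/eqP e|h|h] h2; [rewrite e in c1|..]; pos_lia.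
- apply/forall_inP => x hx; apply/forall_inP => r hr; apply/implyP => dx.
  move: hx hr; rewrite incups inrays dx /= andbF andbT /= => hx.
  have [h1 h2 h3 h4] := q1w _ hx; have h5 := Q1 _ hx.
  move=> /orP [] /andP [hr _].
    by have := vq _ _ h1 h3 hr; pos_lia.
  by have := Q2 _ _ hx hr; pos_lia.
- apply/forall_inP => x hx; apply/forall_inP => r hr; apply/implyP => dx.
  move: hx hr; rewrite !inrays dx /= andbF andbT /= => hx.
  have [h1 h2] := q2w _ hx.
  move=> /orP [] /andP [hr _].
    by have := vq _ _ h1 h2 hr; pos_lia.
  move: (q.2) Q4 hx hr => [|z [|]] // _; rewrite !inE => /eqP -> /eqP ->.
  by rewrite ltnn.
Qed.
End Underline.

(** * Graphs with two kinds of arcs *)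
Section PathEnds.
Variables (T : finType) (e1 e2 : rel T).
Hypothesis e1_fun : forall x y z, e1 x y -> e1 x z -> y = z.
Hypothesis e2_fun : forall x y z, e2 x y -> e2 x z -> y = z.
Local Notation e := (fun x y => e1 x y || e2 x y).
Hypothesis e_sym : symmetric e.

(** The relations [e1] and [e2] are thought of as two matchings whose union is a
graph.  Its components are paths and circles, and the ends of the paths are the
vertices that miss one of the matchings. *)
Definition path_end x := (forall y, ~~ e1 x y) \/ (forall y, ~~ e2 x y).

Lemma path_end_nbr x y z : path_end x -> e x y -> e x z -> y = z.
Proof.
case=> H; rewrite (negPf (H y)) (negPf (H z)) ?orbF /=.
  exact: e2_fun.
exact: e1_fun.
Qed.

Lemma two_nbrs x y z u : y != z -> e x y -> e x z -> e x u -> (u == y) || (u == z).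
Proof.
move=> nyz /orP [h1|h1] /orP [h2|h2] /orP [h3|h3].
- by rewrite (e1_fun h1 h2) eqxx in nyz.
- by rewrite (e1_fun h1 h2) eqxx in nyz.
- by rewrite (e1_fun h3 h1) eqxx.
- by rewrite (e2_fun h3 h2) eqxx orbT.
- by rewrite (e1_fun h3 h2) eqxx orbT.
- by rewrite (e2_fun h3 h1) eqxx.
- by rewrite (e2_fun h1 h2) eqxx in nyz.
- by rewrite (e2_fun h1 h2) eqxx in nyz.
Qed.

(** A simple path between two ends is a whole component, since its inner
vertices have both their neighbours on it; a third end would be an inner vertex,
but these have two neighbours. *)
Lemma path_end_two x y z : path_end x -> path_end y -> path_end z ->
  x != y -> x != z -> y != z -> connect e x y -> connect e x z -> False.
Proof.
move=> ex ey ez nxy nxz nyz /connectP [p0 pth0 ly0] cxz.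
have [p [pth ly up]] : exists p, [/\ path e x p, y = last x p & uniq (x :: p)].
  by move: ly0; case: (shortenP pth0) => p' h1 h2 _ h3; exists p'; split.
have p0' : 0 < size p by case: (p) ly nxy => //= ->; rewrite eqxx.
set s := x :: p in up.
have step i : i < size p -> e (nth x s i) (nth x s i.+1).
  by move=> hi; exact: (pathP x pth).
have stepb i : i < size p -> e (nth x s i.+1) (nth x s i).
  by move=> hi; rewrite e_sym; exact: step.
have s0 : nth x s 0 = x by [].
have sn : nth x s (size p) = y by rewrite ly (last_nth x).
have inner i : 0 < i -> i < size p ->
    [/\ e (nth x s i) (nth x s i.-1), e (nth x s i) (nth x s i.+1)
      & nth x s i.-1 != nth x s i.+1].
  case: i => // i _ hi; split; [apply: stepb; exact: ltnW|exact: step|].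
  by rewrite nth_uniq //= ?ltnS ?(ltnW hi) ?(ltnW (ltnW hi)) // neq_ltn ltnS leqnSn.
have clos u w : u \in s -> e u w -> w \in s.
  move=> /(nthP x) [i hi <-] ew.
  have ins k : k <= size p -> nth x s k \in s by move=> hk; exact: mem_nth.
  case: (posnP i) ew => [->|i0] ew.
    by rewrite s0 in ew; rewrite (path_end_nbr ex ew (step 0 p0')) ins.
  case: (ltngtP i (size p)) => [ilt|igt|ie].
  - have [h1 h2 h3] := inner i i0 ilt.
    case/orP: (two_nbrs h3 h1 h2 ew) => /eqP ->; apply: ins => //; exact: (leq_trans (leq_pred _) (ltnW ilt)).
  - by move: hi; rewrite /s /= ltnS leqNgt igt.
  - have h1 : e y (nth x s (size p).-1).
      by rewrite -sn; have := @stepb (size p).-1; rewrite prednK // => ->.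
    by rewrite ie sn in ew; rewrite (path_end_nbr ey ew h1) ins // leq_pred.
have zs : z \in s.
  have cl : closed e (mem s).
    by move=> u0 w0 uw; apply/idP/idP => h; [exact: (clos _ _ h uw)|apply: (clos _ _ h); rewrite e_sym].
  by rewrite -(closed_connect cl cxz) mem_head.
have [i hi zi] := nthP x zs.
have i0 : 0 < i by case: i hi zi => //= _ zi; rewrite -zi eqxx in nxz.
case: (ltngtP i (size p)) => [ilt|igt|ie].
- have [h1 h2 h3] := inner i i0 ilt; rewrite zi in h1 h2.
  by rewrite (path_end_nbr ez h1 h2) eqxx in h3.
- by move: hi; rewrite /s /= ltnS leqNgt igt.
- by rewrite -zi ie sn eqxx in nyz.
Qed.

Lemma path_end_isolated x y : (forall z, ~~ e1 x z) -> (forall z, ~~ e2 x z) ->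
  connect e x y -> x = y.
Proof.
move=> H1 H2 /connectP [[|z p] /= pth ->] //.
by move: pth; rewrite (negPf (H1 z)) (negPf (H2 z)).
Qed.
End PathEnds.

Definition pair_rel (T : eqType) (a b : T) : rel T :=
  fun x y => (x == a) && (y == b) || (x == b) && (y == a).

(** * Exchanging two arcs of a graph *)
Section TwoArcs.
Variables (T : finType) (g : rel T) (a b c d : T).
Hypothesis g_sym : symmetric g.
Local Notation "x ~ y" := (connect g x y) (at level 70, no associativity).
Hypothesis Had : ~~ (a ~ d).
Hypothesis Hbc : ~~ (b ~ c).

(** A diagram before a surgery and after it has a part [g] in common, to which
two arcs between four corners are added: the cap a - b and the cup c - d before,
the rays a - c and b - d after. *)
Definition two_arcs : rel T :=
  fun x y => [|| g x y, pair_rel a b x y | pair_rel c d x y].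

Let lo u := (u ~ a) || (u ~ b).
Let hi u := (u ~ c) || (u ~ d).
Let lk := (a ~ c) || (b ~ d).

Local Lemma csym : connect_sym g.
Proof. exact: sym_connect_sym. Qed.

Local Lemma ceq u v w : u ~ v -> (u ~ w) = (v ~ w).
Proof. by move=> h; rewrite (same_connect csym h). Qed.

Lemma two_arcs_sym : symmetric two_arcs.
Proof.
by move=> x y; rewrite /two_arcs g_sym /pair_rel; do !case: eqP.
Qed.

(** Since [g] does not join opposite corners, the two added arcs are on one
component only if [g] joins a to c or b to d, which is the condition [lk]. *)
Lemma connect_two_arcs u v : connect two_arcs u v =
  [|| u ~ v, lo u && lo v, hi u && hi v | [&& lk, lo u || hi u & lo v || hi v]].
Proof.
have sub x y : x ~ y -> connect two_arcs x y.
  by apply: connect_sub => ? ? h; apply: connect1; rewrite /two_arcs h.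
have csym2 := sym_connect_sym two_arcs_sym.
have ab : connect two_arcs a b.
  by apply: connect1; rewrite /two_arcs /pair_rel !eqxx orbT.
have cd : connect two_arcs c d.
  by apply: connect1; rewrite /two_arcs /pair_rel !eqxx !orbT.
have loa x : lo x -> connect two_arcs x a.
  by case/orP => /sub // h; apply: connect_trans h _; rewrite csym2.
have hic x : hi x -> connect two_arcs x c.
  by case/orP => /sub // h; apply: connect_trans h _; rewrite csym2.
apply/idP/idP; last first.
  case/or4P => [/sub //|/andP [/loa h1 /loa h2]|/andP [/hic h1 /hic h2]|/and3P [h h1 h2]].
  - by apply: connect_trans h1 _; rewrite csym2.
  - by apply: connect_trans h1 _; rewrite csym2.
  - have ac : connect two_arcs a c.
      case/orP: h => [/sub //|/sub bd]; apply: connect_trans ab _.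
      by apply: connect_trans bd _; rewrite csym2.
    have toa x : lo x || hi x -> connect two_arcs x a.
      case/orP => [/loa //|/hic xc]; apply: connect_trans xc _; by rewrite csym2.
    by apply: connect_trans (toa _ h1) _; rewrite csym2 toa.
case/connectP => p; elim: p u => [|w p IH] u /= => [_ -> |/andP [uw pth] lv].
  by rewrite connect0.
have {}IH := IH w pth lv.
have loab x y : x ~ y -> lo x = lo y by move=> h; rewrite /lo !(ceq _ h).
have hiab x y : x ~ y -> hi x = hi y by move=> h; rewrite /hi !(ceq _ h).
case/or3P: uw => [guw|/orP [] /andP [/eqP -> /eqP ew]|/orP [] /andP [/eqP -> /eqP ew]].
- have h := connect1 guw; by rewrite (loab _ _ h) (hiab _ _ h) (ceq _ h).
- have la : lo a by rewrite /lo connect0.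
  have lb : lo w by rewrite ew /lo connect0 orbT.
  have hlk : hi w -> lk by rewrite ew /hi (negPf Hbc) /lk /= => ->; rewrite orbT.
  move: IH hlk (loab w v); rewrite la lb.
  by case: (w ~ v) => [_ _ <- //|]; case: (lo v); case: (hi v); case: (hi w); case: lk;
    rewrite /= ?orbT ?andbF //= => _ /(_ isT).
- have la : lo b by rewrite /lo connect0 orbT.
  have lb : lo w by rewrite ew /lo connect0.
  have hlk : hi w -> lk by rewrite ew /hi (negPf Had) orbF /lk /= => ->.
  move: IH hlk (loab w v); rewrite la lb.
  by case: (w ~ v) => [_ _ <- //|]; case: (lo v); case: (hi v); case: (hi w); case: lk;
    rewrite /= ?orbT ?andbF //= => _ /(_ isT).
- have la : hi c by rewrite /hi connect0.
  have lb : hi w by rewrite ew /hi connect0 orbT.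
  have hlk : lo w -> lk by rewrite ew /lo csym (negPf Had) /lk /= csym => ->; rewrite orbT.
  move: IH hlk (hiab w v); rewrite la lb.
  by case: (w ~ v) => [_ _ <- //|]; case: (lo v); case: (hi v); case: (lo w); case: lk;
    rewrite /= ?orbT ?andbF //= => _ /(_ isT).
- have la : hi d by rewrite /hi connect0 orbT.
  have lb : hi w by rewrite ew /hi connect0.
  have hlk : lo w -> lk by rewrite ew /lo csym /lk [c ~ b]csym (negPf Hbc) orbF => ->.
  move: IH hlk (hiab w v); rewrite la lb.
  by case: (w ~ v) => [_ _ <- //|]; case: (lo v); case: (hi v); case: (lo w); case: lk;
    rewrite /= ?orbT ?andbF //= => _ /(_ isT).
Qed.
End TwoArcs.

Section Surgery.
Variables (T : finType) (g : rel T) (a b c d : T) (E : pred T).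
Hypothesis g_sym : symmetric g.
Local Notation "x ~ y" := (connect g x y) (at level 70, no associativity).
Let e := two_arcs g a b c d.
Let e' := two_arcs g a c b d.
Definition has_end (r : rel T) u := [exists z, connect r u z && E z].

Hypothesis Had : ~~ (a ~ d).
Hypothesis Hbc : ~~ (b ~ c).

Let cs := sym_connect_sym g_sym.
Let Hcb : ~~ (c ~ b). Proof. by rewrite cs. Qed.

Local Lemma eE u v : connect e u v =
  [|| u ~ v, ((u ~ a) || (u ~ b)) && ((v ~ a) || (v ~ b)),
      ((u ~ c) || (u ~ d)) && ((v ~ c) || (v ~ d))
    | [&& (a ~ c) || (b ~ d), ((u ~ a) || (u ~ b)) || ((u ~ c) || (u ~ d))
       & ((v ~ a) || (v ~ b)) || ((v ~ c) || (v ~ d))]].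
Proof. exact: connect_two_arcs. Qed.

Local Lemma e'E u v : connect e' u v =
  [|| u ~ v, ((u ~ a) || (u ~ c)) && ((v ~ a) || (v ~ c)),
      ((u ~ b) || (u ~ d)) && ((v ~ b) || (v ~ d))
    | [&& (a ~ b) || (c ~ d), ((u ~ a) || (u ~ c)) || ((u ~ b) || (u ~ d))
       & ((v ~ a) || (v ~ c)) || ((v ~ b) || (v ~ d))]].
Proof. exact: connect_two_arcs. Qed.

Let t u := [|| u ~ a, u ~ b, u ~ c | u ~ d].

Lemma e_ac : connect e a c = (a ~ c) || (b ~ d).
Proof.
rewrite eE !connect0 [c ~ a]cs [c ~ b]cs (negPf Had) (negPf Hbc).
by case: (a ~ c); case: (a ~ b); case: (b ~ d); case: (c ~ d).
Qed.

Lemma e'_cd : connect e' c d = (a ~ b) || (c ~ d).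
Proof.
rewrite e'E !connect0 [c ~ a]cs [c ~ b]cs [d ~ a]cs [d ~ b]cs [d ~ c]cs (negPf Had) (negPf Hbc).
by case: (a ~ c); case: (a ~ b); case: (b ~ d); case: (c ~ d).
Qed.

Lemma touch_e u : connect e a u || connect e c u = t u.
Proof.
rewrite !eE !connect0 /= !orbT /= /t ![u ~ _]cs.
by case: (a ~ u); case: (b ~ u); case: (c ~ u); case: (d ~ u); rewrite /= ?orbT ?andbF ?orbF.
Qed.

Lemma touch_e' u : connect e' c u || connect e' d u = t u.
Proof.
rewrite !e'E !connect0 /= !orbT /= /t ![u ~ _]cs.
by case: (a ~ u); case: (b ~ u); case: (c ~ u); case: (d ~ u); rewrite /= ?orbT ?andbF ?orbF.
Qed.

Lemma surgery_touch u :
  connect e a u || connect e c u = connect e' c u || connect e' d u.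
Proof. by rewrite touch_e touch_e'. Qed.

Lemma surgery_untouched u v : ~~ (connect e a u || connect e c u) ->
  connect e u v = connect e' u v.
Proof.
rewrite touch_e /t !negb_or => /and4P [h1 h2 h3 h4].
by rewrite eE e'E (negPf h1) (negPf h2) (negPf h3) (negPf h4) /= !andbF !orbF.
Qed.

(** If both diagrams had the four corners on one component, [g] would join two
corners along a side a - c or b - d and two along a side a - b or c - d, and
hence two opposite ones. *)
Lemma surgery_not_both : connect e a c -> ~~ connect e' c d.
Proof.
rewrite e_ac e'_cd => h; apply/negP => h'; case/orP: h => h; case/orP: h' => h'.
- by case/negP: Hbc; rewrite -(same_connect cs h').
- by case/negP: Had; rewrite (same_connect cs h).
- by case/negP: Had; rewrite (same_connect cs h').
- by case/negP: Hbc; rewrite (same_connect cs h) cs.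
Qed.

Lemma has_end_two_arcs u : ~~ connect e a c ->
  ((u == a) || (u == b)) -> has_end e u = has_end g a || has_end g b.
Proof.
rewrite e_ac => /negPf lk Hu.
have cl z : connect e u z = (a ~ z) || (b ~ z).
  rewrite eE lk andFb orbF ![z ~ _]cs.
  have [/negPf lk1 /negPf lk2] := norP (negbT lk).
  case/orP: Hu => /eqP ->.
    by rewrite connect0 lk1 (negPf Had); case: (a ~ z); case: (b ~ z).
  by rewrite connect0 lk2 (negPf Hbc) orbT; case: (a ~ z); case: (b ~ z).
apply/existsP/idP => [[z /andP [h Ez]]|].
  by move: h; rewrite cl => /orP [] h; apply/orP; [left|right]; apply/existsP; exists z; rewrite h.
by case/orP => /existsP [z /andP [h Ez]]; exists z; rewrite cl h ?orbT.
Qed.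

End Surgery.

Section SurgeryEnds.
Variables (T : finType) (g : rel T) (a b c d : T) (E : pred T).
Hypothesis g_sym : symmetric g.
Local Notation "x ~ y" := (connect g x y) (at level 70, no associativity).
Let e := two_arcs g a b c d.
Let e' := two_arcs g a c b d.
Hypothesis Had : ~~ (a ~ d).
Hypothesis Hbc : ~~ (b ~ c).
Hypothesis paired_no_end : forall x y, x \in [:: a; b; c; d] -> y \in [:: a; b; c; d] ->
  x != y -> x ~ y -> ~~ has_end E g x.
Hypothesis lone_has_end : forall x, x \in [:: a; b; c; d] ->
  (forall y, y \in [:: a; b; c; d] -> y != x -> ~~ (x ~ y)) -> has_end E g x.
Hypothesis abcd_uniq : uniq [:: a; b; c; d].

Let cs := sym_connect_sym g_sym.
Let Hcb : ~~ (c ~ b). Proof. by rewrite cs. Qed.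
Let Hda : ~~ (d ~ a). Proof. by rewrite cs. Qed.

Local Lemma two_arcsC (x y z t : T) : connect (two_arcs g x y z t) =2 connect (two_arcs g z t x y).
Proof. by apply: eq_connect => u v; rewrite /two_arcs [pair_rel _ _ _ _ || _]orbC. Qed.

Local Lemma has_end_eq r r' u : connect r =2 connect r' -> has_end E r u = has_end E r' u.
Proof. by move=> H; apply: eq_existsb => z; rewrite H. Qed.

Local Lemma nab : [&& a != b, a != c, a != d, b != c, b != d & c != d].
Proof.
by move: abcd_uniq; rewrite /= !inE !negb_or !andbT -!andbA => /and5P [-> -> -> -> /andP [-> ->]].
Qed.

(** If the corners become one component, [g] joins a to b or c to d, and this
path of [g] closes up with the removed arc to a component without ends. *)
Lemma merge_no_end : ~~ connect e a c -> connect e' c d ->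
  ~~ has_end E e a || ~~ has_end E e c.
Proof.
move=> H; rewrite (e'_cd g_sym Had Hbc); have /and5P [n1 n2 n3 n4 /andP [n5 n6]] := nab.
case/orP => h; apply/orP; [left|right].
  rewrite (has_end_two_arcs E g_sym Had Hbc H) ?eqxx // negb_or.
  rewrite !(paired_no_end _ _ _ h) ?(@paired_no_end b a) ?inE ?eqxx ?orbT // 1?eq_sym //.
  by rewrite cs.
rewrite /e (has_end_eq _ (two_arcsC a b c d)).
rewrite (has_end_two_arcs E g_sym Hcb Hda) ?eqxx //; last first.
  by rewrite -(two_arcsC a b c d) (sym_connect_sym (two_arcs_sym _ _ _ _ g_sym)).
rewrite negb_or (paired_no_end _ _ _ h) ?(@paired_no_end d c) ?inE ?eqxx ?orbT // 1?eq_sym //.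
by rewrite cs.
Qed.

(** As in [merge_no_end], with the two pairs of arcs exchanged. *)
Lemma split_no_end : connect e a c -> ~~ connect e' c d ->
  ~~ has_end E e' c || ~~ has_end E e' d.
Proof.
move=> H; rewrite (e'_cd g_sym Had Hbc) => H'.
have /and5P [n1 n2 n3 n4 /andP [n5 n6]] := nab.
have H1 : ~~ connect e' a b by rewrite (e_ac g_sym Had Hcb).
move: H; rewrite (e_ac g_sym Had Hbc) => /orP [] h; apply/orP; [left|right].
  rewrite (has_end_two_arcs E g_sym Had Hcb H1) ?eqxx ?orbT // negb_or.
  rewrite (paired_no_end _ _ _ h) ?(@paired_no_end c a) ?inE ?eqxx ?orbT // 1?eq_sym //.
  by rewrite cs.
rewrite /e' (has_end_eq _ (two_arcsC a c b d)).
rewrite (has_end_two_arcs E g_sym Hbc Hda) ?eqxx ?orbT //; last first.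
  by rewrite -(two_arcsC a c b d) (sym_connect_sym (two_arcs_sym _ _ _ _ g_sym)).
rewrite negb_or (paired_no_end _ _ _ h) ?(@paired_no_end d b) ?inE ?eqxx ?orbT // 1?eq_sym //.
by rewrite cs.
Qed.

(** In this case no two corners are joined by [g]. *)
Lemma reconnect_end x : ~~ connect e a c -> ~~ connect e' c d ->
  x \in [:: a; b; c; d] -> has_end E g x.
Proof.
rewrite (e_ac g_sym Had Hbc) (e'_cd g_sym Had Hbc) !negb_or => /andP [h1 h2] /andP [h3 h4] hx.
apply: lone_has_end => // y; move: hx; rewrite !inE.
by case/or4P => /eqP ->; case/or4P => /eqP -> //; rewrite ?eqxx // => _;
  rewrite // cs.
Qed.
End SurgeryEnds.

(** * Components of a stacked diagram and the right count *)
Section ArcRelations.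
Variables (B : block) (a : arcs B).
Hypothesis Ha : is_cup_diagram a.
Implicit Types (i j : pos B).

Definition arc_joins (a : arcs B) i j := joins a false i j || joins a true i j.

Lemma arc_joinsP (b : arcs B) i j :
  reflect (exists2 x, x \in cups b & (x.1.1 == i) && (x.1.2 == j) || (x.1.1 == j) && (x.1.2 == i))
          (arc_joins b i j).
Proof.
apply: (iffP idP) => [|[[[k l] d] /= hx]].
  by case/orP => /orP [] h; eexists; eauto; rewrite /= !eqxx ?orbT.
by rewrite /arc_joins /joins => /orP [] /andP [/eqP <- /eqP <-]; case: d hx => ->; rewrite ?orbT.
Qed.

Lemma has_rayP (b : arcs B) i : reflect (exists2 r, r \in rays b & r.1 = i) (has_ray b i).
Proof.
apply: (iffP orP) => [[] h|[[k d] /= hr <-]]; try by eexists; eauto.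
by case: d hr; [right|left].
Qed.

Lemma arc_joins_sym (b : arcs B) i j : arc_joins b i j = arc_joins b j i.
Proof. by rewrite /arc_joins /joins orbC ![_ || ((i, j, _) \in _)]orbC orbC. Qed.

Lemma arc_joins_fun i j k : arc_joins a i j -> arc_joins a i k -> j = k.
Proof.
move=> /arc_joinsP [x hx ex] /arc_joinsP [y hy ey].
have e : x = y.
  by apply: (touches_unique Ha (k := i)) => //; rewrite /touches;
     [move: ex|move: ey] => /orP [] /andP [/eqP -> /eqP ->]; rewrite eqxx ?orbT.
have := cup_neq Ha hx; move: ey; rewrite -e.
move: ex => /orP [] /andP [/eqP -> /eqP ->] /orP [] /andP [/eqP e1 /eqP e2] n //.
- by rewrite e2 eqxx in n.
- by rewrite e1 eqxx in n.
Qed.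

Lemma arc_joins_ray i j : arc_joins a i j -> has_ray a i -> False.
Proof.
move=> /arc_joinsP [x hx ex] /has_rayP [r hr er].
apply: (touches_ray Ha hx hr (k := i)); last by rewrite er.
by move: ex; rewrite /touches => /orP [] /andP [e1 e2]; rewrite ?e1 ?e2 ?orbT.
Qed.

Lemma arc_joins_inP i j : arc_joins a i j -> inP i.
Proof.
move=> /arc_joinsP [x hx ex]; apply: (cup_inP Ha hx).
by move: ex; rewrite /touches => /orP [] /andP [e1 e2]; rewrite ?e1 ?e2 ?orbT.
Qed.

Lemma has_ray_inP i : has_ray a i -> inP i.
Proof. by move=> /has_rayP [r hr <-]; apply: (ray_inP Ha hr). Qed.

End ArcRelations.

Section Stack.
Variables (B : block) (h : nat) (D : stacked B h).
Local Notation vertex := (vertex B h).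
Implicit Types (v w : vertex) (S : pred vertex) (lv : 'I_h.+1).

Lemma layer_cup_diagram m : m <= h.+1 -> is_cup_diagram (layer D m).
Proof.
rewrite /layer; case: m => [|m] hm; first exact: underline_cup_diagram.
rewrite /= nth_rcons size_map size_tuple.
case: (ltngtP m h) => [hmh|hmh|_]; last exact: underline_cup_diagram.
  rewrite (nth_map (tnth (middle D) (Ordinal hmh))) ?size_tuple //.
  exact: valP.
by move: hm; rewrite ltnS leqNgt hmh.
Qed.

Lemma layer_below lv : is_cup_diagram (layer D lv).
Proof. by apply: layer_cup_diagram; apply: ltnW. Qed.

Lemma layer_above lv : is_cup_diagram (layer D lv.+1).
Proof. exact: layer_cup_diagram. Qed.

(** Every vertex has one arc in the layer below it and one in the layer above
it, so the diagram is a union of two matchings. *)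
Definition low_adj v w :=
  (v.2 == w.2) && arc_joins (layer D v.2) v.1 w.1
  || [&& v.1 == w.1, v.2 == w.2.+1 :> nat & has_ray (layer D v.2) v.1].
Definition up_adj v w :=
  (v.2 == w.2) && arc_joins (layer D v.2.+1) v.1 w.1
  || [&& v.1 == w.1, w.2 == v.2.+1 :> nat & has_ray (layer D w.2) v.1].

Lemma adjE v w : adj D v w = low_adj v w || up_adj v w.
Proof.
rewrite /adj /cup_adj /ray_adj /low_adj /up_adj /arc_joins.
case: (v.2 == w.2) => /=; case: (v.1 == w.1) => /=; rewrite ?orbF //.
- case: (joins (layer D v.2) false _ _) => //=; case: (joins _ true _ _); rewrite ?orbT //=.
  case: (joins (layer D v.2.+1) false _ _); rewrite ?orbT //=.
  case: (joins (layer D v.2.+1) true _ _); rewrite ?orbT ?orbF //=.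
  by rewrite orbC.
- by case: (joins (layer D v.2) false _ _) => //=; case: (joins _ true _ _); rewrite ?orbT //= orbC.
- by rewrite orbC.
Qed.

Lemma low_adj_fun v w w' : low_adj v w -> low_adj v w' -> w = w'.
Proof.
case: v w w' => [i l] [j m] [k n]; rewrite /low_adj /=.
case/orP => [/andP [/eqP e1 h1]|/and3P [/eqP e1 /eqP e2 h1]];
case/orP => [/andP [/eqP e3 h2]|/and3P [/eqP e3 /eqP e4 h2]].
- by rewrite (arc_joins_fun (layer_below l) h1 h2) -e1 -e3.
- by case: (arc_joins_ray (layer_below l) h1 h2).
- by case: (arc_joins_ray (layer_below l) h2 h1).
- by rewrite -e1 -e3; congr (_, _); apply/val_inj; move: e2; rewrite e4 => -[].
Qed.

Lemma up_adj_fun v w w' : up_adj v w -> up_adj v w' -> w = w'.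
Proof.
case: v w w' => [i l] [j m] [k n]; rewrite /up_adj /=.
case/orP => [/andP [/eqP e1 h1]|/and3P [/eqP e1 /eqP e2 h1]];
case/orP => [/andP [/eqP e3 h2]|/and3P [/eqP e3 /eqP e4 h2]].
- by rewrite (arc_joins_fun (layer_above l) h1 h2) -e1 -e3.
- by rewrite e4 in h2; case: (arc_joins_ray (layer_above l) h1 h2).
- by rewrite e2 in h1; case: (arc_joins_ray (layer_above l) h2 h1).
- by rewrite -e1 -e3; congr (_, _); apply/val_inj; rewrite /= e2 e4.
Qed.

Lemma low_up_cup_sym v w : v.2 = w.2 ->
  (low_adj v w = low_adj w v) * (up_adj v w = up_adj w v).
Proof.
move=> e; have nS : (w.2 == w.2.+1 :> nat) = false by rewrite ltn_eqF.
rewrite /low_adj /up_adj e eqxx nS !andbF !orbF /=.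
by rewrite (arc_joins_sym (layer D w.2) v.1) (arc_joins_sym (layer D w.2.+1) v.1).
Qed.

Lemma low_up_ray_sym v w : v.2 != w.2 -> low_adj v w = up_adj w v.
Proof.
move=> e; rewrite /low_adj /up_adj [w.2 == v.2]eq_sym (negPf e) /= eq_sym.
by case: eqP => //= ->.
Qed.

Lemma adj_sym : symmetric (adj D).
Proof.
move=> v w; rewrite !adjE; case: (eqVneq v.2 w.2) => e.
  by rewrite !(low_up_cup_sym e).
by rewrite (low_up_ray_sym e) -(low_up_ray_sym (v := w)) 1?orbC // eq_sym.
Qed.

Lemma adj_inP v w : adj D v w -> inP v.1.
Proof.
rewrite adjE /low_adj /up_adj.
case/orP => /orP [/andP [_ h1]|/and3P [_ /eqP e h1]].
- exact: (arc_joins_inP (layer_below _) h1).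
- exact: (has_ray_inP (layer_below _) h1).
- exact: (arc_joins_inP (layer_above _) h1).
- exact: (has_ray_inP (layer_below _) h1).
Qed.

Lemma same_comp_sym v w : same_comp D v w = same_comp D w v.
Proof. exact: sym_connect_sym adj_sym v w. Qed.

Lemma same_comp_refl v : same_comp D v v.
Proof. exact: connect0. Qed.

Lemma same_comp_trans u v w : same_comp D u v -> same_comp D v w -> same_comp D u w.
Proof. exact: connect_trans. Qed.

Lemma same_comp_eq u v w : same_comp D u v -> same_comp D u w = same_comp D v w.
Proof. by move=> uv; apply: same_connect => //; exact: sym_connect_sym adj_sym. Qed.

Lemma same_comp_inP v w : same_comp D v w -> inP v.1 = inP w.1.
Proof.
move=> vw; apply: (closed_connect (a := fun v => inP v.1)) vw => x y xy.
by rewrite /in_mem /= (adj_inP xy) (@adj_inP y x) // adj_sym.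
Qed.

Definition line_end v := bottom_end D v || top_end D v.

Lemma bottom_end_low v w : bottom_end D v -> ~~ low_adj v w.
Proof.
case/andP => /eqP v0 hr; apply/negP => /orP [/andP [_ h1]|/and3P [_ /eqP e h1]].
  by apply: arc_joins_ray h1 _; [exact: layer_below|rewrite v0].
by rewrite v0 in e.
Qed.

Lemma top_end_up v w : top_end D v -> ~~ up_adj v w.
Proof.
case/andP => /eqP v0 hr; apply/negP => /orP [/andP [_ h1]|/and3P [_ /eqP e h1]].
  by apply: arc_joins_ray h1 _; [exact: layer_above|rewrite v0].
by have := ltn_ord w.2; rewrite e v0 ltnn.
Qed.

Lemma line_end_path_end v : line_end v -> path_end low_adj up_adj v.
Proof.
by case/orP => e; [left|right] => w; [exact: bottom_end_low|exact: top_end_up].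
Qed.

Lemma line_end_inP v : line_end v -> inP v.1.
Proof.
by case/orP => /andP [_ /has_ray_inP]; apply; apply: layer_cup_diagram.
Qed.

Lemma line_two_ends u v w : line_end u -> line_end v -> line_end w ->
  u != v -> u != w -> v != w -> same_comp D u v -> same_comp D u w -> False.
Proof.
move=> eu ev ew n1 n2 n3 uv uw.
have e1 : adj D =2 (fun x y => low_adj x y || up_adj x y) by move=> x y; rewrite adjE.
apply: (@path_end_two _ low_adj up_adj low_adj_fun up_adj_fun _ u v w) => //.
- by move=> x y; rewrite -!adjE adj_sym.
- exact: line_end_path_end.
- exact: line_end_path_end.
- exact: line_end_path_end.
- by rewrite -(eq_connect e1).
- by rewrite -(eq_connect e1).
Qed.

(** The arcs of layer m end at level m, where they are cups, and at level m - 1,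
where they are caps. *)
Definition in_layer (m : nat) lv := (m == lv) || (m == lv.+1).

Lemma layer_adj m lv x : in_layer m lv -> x \in cups (layer D m) ->
  adj D (x.1.1, lv) (x.1.2, lv).
Proof.
move=> hm hx; have hj : arc_joins (layer D m) x.1.1 x.1.2.
  by apply/arc_joinsP; exists x; rewrite // !eqxx.
by rewrite adjE /low_adj /up_adj /= eqxx; case/orP: hm hj => /eqP -> ->; rewrite ?orbT.
Qed.

Lemma layer_cup_adj m lv x : in_layer m lv -> x \in cups (layer D m) ->
  cup_adj D x.2 (x.1.1, lv) (x.1.2, lv).
Proof.
rewrite /cup_adj /= eqxx /joins; case: x => [[i j] d] /= /orP [] /eqP -> -> //.
by rewrite orbT.
Qed.

Lemma layer_ray_adj lv lv' r : lv' = lv.+1 :> nat -> r \in rays (layer D lv') ->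
  ray_adj D (r.1, lv) (r.1, lv').
Proof.
move=> e hr; rewrite /ray_adj /= eqxx e eqxx /=; case: r hr => [i d] /=.
by rewrite e /has_ray => hr; case: d hr => ->; rewrite ?orbT.
Qed.

Variant adj_spec v w : Prop :=
| AdjCup m lv x of in_layer m lv & m <= h.+1 & x \in cups (layer D m)
    & (v = (x.1.1, lv) /\ w = (x.1.2, lv)) \/ (w = (x.1.1, lv) /\ v = (x.1.2, lv))
| AdjRay lv lv' r of lv' = lv.+1 :> nat & r \in rays (layer D lv')
    & (v = (r.1, lv) /\ w = (r.1, lv')) \/ (w = (r.1, lv) /\ v = (r.1, lv')).

Lemma adjP v w : adj D v w -> adj_spec v w.
Proof.
case: v w => [i l] [j m]; rewrite adjE /low_adj /up_adj /=.
case/orP => /orP [/andP [/eqP <- /arc_joinsP [x hx ex]]|/and3P [/eqP <- /eqP e /has_rayP [r hr er]]].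
- apply: (@AdjCup _ _ l l x) => //; first by rewrite /in_layer eqxx.
    exact: ltnW.
  by case/orP: ex => /andP [/eqP -> /eqP ->]; [left|right].
- by apply: (@AdjRay _ _ m l r) => //; right; rewrite er.
- apply: (@AdjCup _ _ l.+1 l x) => //; first by rewrite /in_layer eqxx orbT.
  by case/orP: ex => /andP [/eqP -> /eqP ->]; [left|right].
- by apply: (@AdjRay _ _ l m r) => //; left; rewrite er.
Qed.

(** The correction term makes this constant along components for suitable S, see
[right_val_comp]. *)
Definition right_val S v : bool :=
  right_parity (fun k => S (k, v.2)) v.1 (+) (S v && ~~ odd (pcount v.1)).

(** At an undotted cup with ends in S, the count and the parity of p both
change.  At a dotted cup p is odd at the left end and even at the right end, so
the only correction is that at the right end, and it makes up for the right end
itself. *)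
Lemma right_val_cup S m lv x : (forall v, S v -> inP v.1) -> m <= h.+1 ->
  x \in cups (layer D m) ->
  (forall z, z \in cups (layer D m) -> z.2 = false -> x.1.1 < z.1.1 -> z.1.2 < x.1.2 ->
     S (z.1.1, lv) = S (z.1.2, lv)) ->
  (x.2 = false -> S (x.1.1, lv) = S (x.1.2, lv)) ->
  right_val S (x.1.1, lv) = right_val S (x.1.2, lv).
Proof.
move=> SP hm hx Hin Hx; have Ha := layer_cup_diagram hm.
rewrite /right_val /= (right_parity_cup Ha (S := fun k => S (k, lv)) _ hx) //; last first.
  by move=> k /SP.
rewrite (pcount_cup Ha hx); case dx: (x.2).
  rewrite (pcount_dotted Ha hx dx) /= andbF addbF.
  by rewrite andbT.
rewrite Hx //; by case: (S _) => //=; case: (right_parity _ _) => //=; case: (odd _).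
Qed.

Lemma right_val_ray S lv lv' r : (forall v, S v -> inP v.1) -> lv' = lv.+1 :> nat ->
  r \in rays (layer D lv') ->
  (forall z, z \in cups (layer D lv') -> r.1 < z.1.1 ->
     S (z.1.1, lv) (+) S (z.1.2, lv) = S (z.1.1, lv') (+) S (z.1.2, lv')) ->
  (forall r', r' \in rays (layer D lv') -> r.1 < r'.1 -> S (r'.1, lv) = S (r'.1, lv')) ->
  S (r.1, lv) = S (r.1, lv') ->
  right_val S (r.1, lv) = right_val S (r.1, lv').
Proof.
move=> SP e hr Hc Hr Hrr; rewrite /right_val /= Hrr; congr (_ (+) _).
apply: (right_parity_ray (layer_below lv') (S1 := fun k => S (k, lv)) (S2 := fun k => S (k, lv'))) => //.
  by move=> k /SP.
by move=> k /SP.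
Qed.

(** Nothing is required at dotted cups, since the right count does not change
there. *)
Definition und_closed S :=
  forall v w, cup_adj D false v w || ray_adj D v w -> S v = S w.

(** To the right of a ray there are only rays, which carry the same points of S
on both levels, and undotted cups, whose ends cancel on each level. *)
Lemma right_val_adj S : (forall v, S v -> inP v.1) -> und_closed S ->
  forall v w, adj D v w -> right_val S v = right_val S w.
Proof.
move=> SP Sc v w /adjP [m lv x ml hm hx vw|lv lv' r e hr vw].
  suff H : right_val S (x.1.1, lv) = right_val S (x.1.2, lv) by case: vw => -[-> ->].
  apply: (right_val_cup SP hm hx) => [z hz dz _ _|dx]; apply: Sc.
    by have := layer_cup_adj ml hz; rewrite dz => ->.
  by have := layer_cup_adj ml hx; rewrite dx => ->.
suff H : right_val S (r.1, lv) = right_val S (r.1, lv') by case: vw => -[-> ->].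
apply: (right_val_ray SP e hr) => [z hz lz|r' hr' _|]; last 2 first.
- by apply: Sc; rewrite (layer_ray_adj e hr') orbT.
- by apply: Sc; rewrite (layer_ray_adj e hr) orbT.
have dz : z.2 = false.
  apply/negbTE/negP => dz.
  by have := dotted_cup_ray (layer_below lv') hz hr dz; rewrite leqNgt lz.
have il : in_layer lv' lv by rewrite /in_layer e eqxx orbT.
have il' : in_layer lv' lv' by rewrite /in_layer eqxx.
have -> : S (z.1.1, lv) = S (z.1.2, lv).
  by apply: Sc; have := layer_cup_adj il hz; rewrite dz => ->.
have -> : S (z.1.1, lv') = S (z.1.2, lv').
  by apply: Sc; have := layer_cup_adj il' hz; rewrite dz => ->.
by rewrite !addbb.
Qed.

Lemma right_val_comp S : (forall v, S v -> inP v.1) -> und_closed S ->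
  forall v w, same_comp D v w -> right_val S v = right_val S w.
Proof.
move=> SP Sc v w; apply: (closed_connect (a := right_val S)) => x y xy.
exact: right_val_adj.
Qed.

Definition level_parity S lv := \xor_(k | true) S (k, lv).

(** The rays of the layer between the two levels cancel. *)
Lemma level_parity_step S lv lv' : (forall v, S v -> inP v.1) -> lv' = lv.+1 :> nat ->
  (forall r, r \in rays (layer D lv') -> S (r.1, lv) = S (r.1, lv')) ->
  level_parity S lv (+) level_parity S lv' =
  \xor_(z | z \in cups (layer D lv'))
     (S (z.1.1, lv) (+) S (z.1.2, lv) (+) (S (z.1.1, lv') (+) S (z.1.2, lv'))).
Proof.
move=> SP e Hr.
have sub l : {subset (fun k => S (k, l)) <= @inP B} by move=> k /SP.
rewrite /level_parity (xor_points (layer_below lv') (sub lv)) (xor_points (layer_below lv') (sub lv')).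
rewrite [RHS]xor_split addbACA -[RHS]addbF; congr (_ (+) _).
by rewrite -xor_split xor0 // => r hr; rewrite Hr ?addbb.
Qed.

Lemma level_parity_bottom S : (forall v, S v -> inP v.1) ->
  (forall z, z \in cups (layer D 0) -> S (z.1.1, ord0) = S (z.1.2, ord0)) ->
  (forall v, S v -> ~~ bottom_end D v) -> level_parity S ord0 = false.
Proof.
move=> SP Hc He; rewrite /level_parity (xor_closed (layer_below ord0)) //; last by move=> k /SP.
rewrite xor0 // => r hr; apply: contraTF hr => Sr; apply/negP => hr.
have /negP := He _ Sr; apply; rewrite /bottom_end eqxx /=.
by apply/has_rayP; exists r.
Qed.

Lemma level_parity_top S : (forall v, S v -> inP v.1) ->
  (forall z, z \in cups (layer D h.+1) -> S (z.1.1, ord_max) = S (z.1.2, ord_max)) ->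
  (forall v, S v -> ~~ top_end D v) -> level_parity S ord_max = false.
Proof.
move=> SP Hc He; rewrite /level_parity (xor_closed (layer_above ord_max)) //; last by move=> k /SP.
rewrite xor0 // => r hr; apply: contraTF hr => Sr; apply/negP => hr.
have /negP := He _ Sr; apply; rewrite /top_end eqxx /=.
by apply/has_rayP; exists r.
Qed.
End Stack.

(** * Orientations *)
Section Orientations.
Variables (B : block) (h : nat).
Local Notation vertex := (vertex B h).
Implicit Types (D : stacked B h) (v w : vertex) (S Z : pred vertex) (lv : 'I_h.+1).
Implicit Types (nu mu : h.+1.-tuple (weight B)).

Definition vee nu v := label nu v == Vee.

Lemma labelE nu v : inP v.1 -> label nu v = if vee nu v then Vee else Wedge.
Proof. by rewrite /vee /label => /(weight_label (tnth nu v.2)) [] ->. Qed.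

Lemma label_vee nu mu v w : inP v.1 -> inP w.1 ->
  (label nu v == label mu w) = ~~ (vee nu v (+) vee mu w).
Proof.
by move=> vP wP; rewrite (labelE nu vP) (labelE mu wP); do 2!case: (vee _ _).
Qed.

Lemma cup_oriented_vee nu (v w : vertex) d : inP v.1 -> inP w.1 ->
  ((label nu v, label nu w) \in
     (if d then [:: (Wedge, Wedge); (Vee, Vee)] else [:: (Vee, Wedge); (Wedge, Vee)]))
  = (vee nu v (+) vee nu w == ~~ d).
Proof.
by move=> vP wP; rewrite (labelE nu vP) (labelE nu wP); case: d; do 2!case: (vee _ _).
Qed.

Lemma cup_adj_inP D d v w : cup_adj D d v w -> inP v.1 /\ inP w.1.
Proof.
move=> vw; have a : adj D v w by rewrite /adj; case: d vw => ->; rewrite ?orbT.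
by split; [exact: adj_inP a|rewrite adj_sym in a; exact: adj_inP a].
Qed.

Lemma ray_adj_adj D v w : ray_adj D v w -> adj D v w.
Proof. by rewrite /adj => ->; rewrite !orbT. Qed.

Lemma cup_adj_adj D d v w : cup_adj D d v w -> adj D v w.
Proof. by rewrite /adj; case: d => ->; rewrite ?orbT. Qed.

Lemma cup_adjP D d v w : cup_adj D d v w ->
  exists m lv x, [/\ in_layer m lv, m <= h.+1, x \in cups (layer D m), x.2 = d
    & (v = (x.1.1, lv) /\ w = (x.1.2, lv)) \/ (w = (x.1.1, lv) /\ v = (x.1.2, lv))].
Proof.
case: v w => [i l] [j m]; rewrite /cup_adj /= => /andP [/eqP <-]; rewrite /joins.
have l1 : l <= h.+1 by apply: ltnW.
have l2 : l.+1 <= h.+1 by [].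
have i1 : in_layer l l by rewrite /in_layer eqxx.
have i2 : in_layer l.+1 l by rewrite /in_layer eqxx orbT.
by case/orP => /orP [] hx; [exists l, l|exists l, l|exists l.+1, l|exists l.+1, l];
  eexists; split; eauto.
Qed.

Lemma orientationP D nu : is_orientation D nu <->
  [/\ forall d v w, cup_adj D d v w -> vee nu v (+) vee nu w = ~~ d,
      forall v w, ray_adj D v w -> vee nu v = vee nu w,
      forall r, r \in rays (layer D 0) -> vee nu (r.1, ord0) = ~~ r.2
    & forall r, r \in rays (layer D h.+1) -> vee nu (r.1, ord_max) = ~~ r.2].
Proof.
have endE (r : pos B * bool) lv : inP r.1 ->
    (val (tnth nu lv) r.1 == (if r.2 then Wedge else Vee)) = (vee nu (r.1, lv) == ~~ r.2).
  move=> rP; have := @labelE nu (r.1, lv) rP; rewrite {1}/label /= => ->.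
  by case: (vee _ _); case: (r.2).
split.
- case/and4P => /forallP H1 /forall_inP H2 /forall_inP H3 /forallP H4; split.
  + move=> d v w vw; have [vP wP] := cup_adj_inP vw; apply/eqP.
    case: (cup_adjP vw) => m [lv [x [ml hm hx dx e]]].
    have := H1 lv => /andP [/forall_inP Hb /forall_inP Ha].
    have {Ha Hb} : (label nu (x.1.1, lv), label nu (x.1.2, lv)) \in
         (if x.2 then [:: (Wedge, Wedge); (Vee, Vee)] else [:: (Vee, Wedge); (Wedge, Vee)]).
      by case/orP: ml hx => /eqP ->; [move/Hb|move/Ha].
    rewrite dx; case: e vP wP => -[-> ->] vP wP; rewrite cup_oriented_vee //.
    by rewrite addbC.
  + move=> v w vw; have a := ray_adj_adj vw.
    have := H4 v => /forallP /(_ w); rewrite vw label_vee ?(adj_inP a) //=.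
      by case: (vee _ _); case: (vee _ _).
    by rewrite adj_sym in a; exact: adj_inP a.
  + move=> r hr; have rP := ray_inP (layer_below D ord0) hr.
    by have := H2 r hr; rewrite (endE r ord0 rP) => /eqP.
  + move=> r hr; have rP := ray_inP (layer_above D ord_max) hr.
    by have := H3 r hr; rewrite (endE r ord_max rP) => /eqP.
case=> H1 H2 H3 H4; apply/and4P; split.
- have H m lv x : in_layer m lv -> m <= h.+1 -> x \in cups (layer D m) ->
     (val (tnth nu lv) x.1.1, val (tnth nu lv) x.1.2) \in
         (if x.2 then [:: (Wedge, Wedge); (Vee, Vee)] else [:: (Vee, Wedge); (Wedge, Vee)]).
    move=> ml hm hx; have vw := layer_cup_adj ml hx; have [vP wP] := cup_adj_inP vw.
    rewrite -[(_, _)]/(label nu (x.1.1, lv), label nu (x.1.2, lv)) cup_oriented_vee //.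
    by rewrite (H1 _ _ _ vw).
  apply/forallP => lv; apply/andP; split; apply/forall_inP => x hx; apply: H hx => //.
  + by rewrite /in_layer eqxx.
  + exact: ltnW.
  + by rewrite /in_layer eqxx orbT.
- apply/forall_inP => r hr; rewrite endE ?H3 //; exact: (ray_inP (layer_below D ord0) hr).
- apply/forall_inP => r hr; rewrite endE ?H4 //; exact: (ray_inP (layer_above D ord_max) hr).
- apply/forallP => v; apply/forallP => w; apply/implyP => vw.
  have a := ray_adj_adj vw; rewrite label_vee ?(adj_inP a) ?(H2 _ _ vw) ?addbb //.
  by rewrite adj_sym in a; exact: adj_inP a.
Qed.

Lemma orientation_cup D (nu : orientation D) d v w :
  cup_adj D d v w -> vee (val nu) v (+) vee (val nu) w = ~~ d.
Proof. by case/orientationP: (valP nu) => H _ _ _; exact: H. Qed.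

Lemma orientation_ray D (nu : orientation D) v w :
  ray_adj D v w -> vee (val nu) v = vee (val nu) w.
Proof. by case/orientationP: (valP nu) => _ H _ _; exact: H. Qed.

Lemma tuple_ext nu mu : (forall v, inP v.1 -> vee nu v = vee mu v) -> nu = mu.
Proof.
move=> H; apply: eq_from_tnth => l; apply: val_inj; apply/ffunP => i.
case iP: (inP i).
  by have := @labelE nu (i, l) iP; have := @labelE mu (i, l) iP; rewrite (H (i, l)) // => <-.
move: (valP (tnth nu l)) (valP (tnth mu l)) => /andP [/forallP /(_ i) + _] /andP [/forallP /(_ i) + _].
by move: iP; rewrite /inP; case: (bdiag B i) => //= _ /eqP -> /eqP ->.
Qed.

Definition swap (x : wlabel) := match x with Vee => Wedge | Wedge => Vee | y => y end.

Definition flip_fun (u : weight B) (S : pred (pos B)) : {ffun pos B -> wlabel} :=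
  [ffun i => if S i then swap (val u i) else val u i].

(** The number of reversed labels is even, so the parity of the number of Wedges
does not change. *)
Lemma flip_in_block (u : weight B) (S : pred (pos B)) : {subset S <= @inP B} ->
  \xor_(k | true) S k = false -> in_block (flip_fun u S).
Proof.
move=> SP S0; case/andP: (valP u) => /forallP H1 /eqP H2; apply/andP; split.
  apply/forallP => i; rewrite ffunE; have := H1 i; case: ifP => [Si|_ //].
  have : inP i := SP i Si.
  by rewrite /inP; case: (bdiag B i) => // _ /orP [] /eqP ->.
rewrite -H2; apply/eqP.
have E (f : {ffun pos B -> wlabel}) : odd #|[set i | f i == Wedge]| = \xor_(i | true) (f i == Wedge).
  by rewrite -odd_card_xor; congr (odd _); apply: eq_card => i; rewrite !inE.
rewrite !E; transitivity (\xor_(i | true) (val u i == Wedge) (+) \xor_(k | true) S k).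
  rewrite -xor_split; apply: eq_bigr => i _.
  rewrite ffunE; case Si: (S i); last by rewrite addbF.
  by case: (@weight_label _ u i (SP i Si)) => /= ->.
by rewrite S0 addbF.
Qed.

Definition flip_weight (u : weight B) (S : pred (pos B)) : weight B :=
  insubd u (flip_fun u S).

Definition flip nu Z : h.+1.-tuple (weight B) :=
  [tuple flip_weight (tnth nu l) (fun k => Z (k, l)) | l < h.+1].

Lemma flip_vee nu Z : (forall v, Z v -> inP v.1) -> (forall l, level_parity Z l = false) ->
  forall v, inP v.1 -> vee (flip nu Z) v = vee nu v (+) Z v.
Proof.
move=> ZP Z0 [k l] vP; rewrite /vee /label tnth_mktuple /flip_weight.
rewrite insubdK; last first.
  by apply: flip_in_block => [i /ZP //|]; apply: Z0.
by rewrite ffunE; case: (Z (k, l)); case: (@weight_label _ (tnth nu l) k vP) => ->.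
Qed.

(** By induction from the bottom: an arc of the layer below a level either joins
two of its points or is a ray that leads to the previous level. *)
Lemma level_parity_closed D Z : (forall v, Z v -> inP v.1) ->
  (forall v w, adj D v w -> Z v = Z w) -> (forall v, Z v -> ~~ bottom_end D v) ->
  forall l, level_parity Z l = false.
Proof.
move=> ZP Zc Ze [m]; elim: m => [|m IH] hm.
  have -> : Ordinal hm = ord0 by apply/val_inj.
  apply: (level_parity_bottom ZP _ Ze) => z hz.
  by apply: Zc; apply: (layer_adj (m := 0)) => //; rewrite /in_layer eqxx.
have hm' : m < h.+1 := ltnW hm.
have := @level_parity_step _ _ D Z (Ordinal hm') (Ordinal hm) ZP (erefl _).
rewrite IH /= => ->.
  apply: xor0 => z hz.
  rewrite (Zc _ _ (layer_adj (m := m.+1) (lv := Ordinal hm') _ hz)); last first.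
    by rewrite /in_layer eqxx orbT.
  rewrite (Zc _ _ (layer_adj (m := m.+1) (lv := Ordinal hm) _ hz)); last first.
    by rewrite /in_layer eqxx.
  by rewrite !addbb.
move=> r hr; apply: Zc; apply: ray_adj_adj.
exact: (@layer_ray_adj _ _ _ (Ordinal hm') (Ordinal hm)).
Qed.

(** A union of circles meets each level in an even number of points, so its
labels can be reversed within the block. *)
Lemma flip_orientation D (nu : orientation D) Z : (forall v, Z v -> inP v.1) ->
  (forall v w, adj D v w -> Z v = Z w) -> (forall v, Z v -> ~~ line_end D v) ->
  exists mu : orientation D, forall v, inP v.1 ->
    vee (val mu) v = vee (val nu) v (+) Z v.
Proof.
move=> ZP Zc Ze.
have Z0 : forall l, level_parity Z l = false.
  apply: (level_parity_closed ZP Zc) => v /Ze.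
  by apply: contra; rewrite /line_end => ->.
have fv := flip_vee (val nu) ZP Z0.
suff o : is_orientation D (flip (val nu) Z) by exists (exist (is_orientation D) _ o).
have [H1 H2 H3 H4] := (orientationP D (val nu)).1 (valP nu).
apply/orientationP; split.
- move=> d v w vw; have [vP wP] := cup_adj_inP vw.
  rewrite !fv // (Zc _ _ (cup_adj_adj vw)) -(H1 _ _ _ vw).
  by rewrite addbACA addbb addbF.
- move=> v w vw; have a := ray_adj_adj vw.
  rewrite !fv ?(adj_inP a) ?(Zc _ _ a) ?(H2 _ _ vw) //.
  by rewrite adj_sym in a; exact: adj_inP a.
- move=> r hr; have rP : inP r.1 := ray_inP (layer_below D ord0) hr.
  have e : bottom_end D (r.1, ord0) by rewrite /bottom_end eqxx; apply/has_rayP; exists r.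
  rewrite fv // H3 //; case Zr: (Z _); last by rewrite addbF.
  by have := Ze _ Zr; rewrite /line_end e.
- move=> r hr; have rP : inP r.1 := ray_inP (layer_above D ord_max) hr.
  have e : top_end D (r.1, ord_max) by rewrite /top_end eqxx; apply/has_rayP; exists r.
  rewrite fv // H4 //; case Zr: (Z _); last by rewrite addbF.
  by have := Ze _ Zr; rewrite /line_end e orbT.
Qed.

(** Reversal of labels respects the conditions at all arcs, so two orientations
agree everywhere or nowhere on a component. *)
Lemma vee_ratio D (mu nu : orientation D) v w : same_comp D v w ->
  vee (val mu) v (+) vee (val nu) v = vee (val mu) w (+) vee (val nu) w.
Proof.
apply: (closed_connect (a := fun v => vee (val mu) v (+) vee (val nu) v)) => x y.
rewrite /in_mem /= => /or3P [] xy.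
- have := orientation_cup mu xy; have := orientation_cup nu xy.
  by do 4!case: (vee _ _).
- have := orientation_cup mu xy; have := orientation_cup nu xy.
  by do 4!case: (vee _ _).
- by rewrite (orientation_ray mu xy) (orientation_ray nu xy).
Qed.

Lemma vee_end D1 D2 (mu : orientation D1) (nu : orientation D2) v :
  lower D1 = lower D2 -> upper D1 = upper D2 -> line_end D1 v ->
  vee (val mu) v = vee (val nu) v.
Proof.
move=> eL eU; case: v => [i l].
have [_ _ M3 M4] := (orientationP D1 (val mu)).1 (valP mu).
have [_ _ N3 N4] := (orientationP D2 (val nu)).1 (valP nu).
have e0 : layer D1 0 = layer D2 0 by rewrite /layer /= eL.
have e1 : layer D1 h.+1 = layer D2 h.+1.
  by rewrite /layer /= !nth_rcons !size_map !size_tuple ltnn eqxx eU.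
rewrite /line_end /bottom_end /top_end /= => /orP [] /andP [/eqP l0 /has_rayP [r hr <-]].
  have -> : l = ord0 by apply/val_inj.
  by rewrite M3 // N3 // -e0.
have -> : l = ord_max by apply/val_inj.
by rewrite M4 // N4 // -e1.
Qed.

Lemma vee_line D (mu nu : orientation D) v : on_line D v -> vee (val mu) v = vee (val nu) v.
Proof.
case/existsP => w /andP [vw ew]; have := vee_ratio mu nu vw.
by rewrite (vee_end mu nu (erefl _) (erefl _) ew) addbb; do 2!case: (vee _ _).
Qed.

Lemma on_line_comp D v w : same_comp D v w -> on_line D v = on_line D w.
Proof. by move=> vw; apply: eq_existsb => u; rewrite (same_comp_eq _ vw). Qed.

Lemma rightmost_ex D v : exists w, rightmost D v w.
Proof.
have [w vw Hw] := @arg_maxnP _ v (same_comp D v) (fun x : vertex => nat_of_ord x.1) (same_comp_refl D v).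
by exists w; rewrite /rightmost vw; apply/forallP => x; apply/implyP => /Hw.
Qed.

Lemma rightmost_comp D v w : same_comp D v w -> rightmost D v =1 rightmost D w.
Proof.
move=> vw u; rewrite /rightmost (same_comp_eq _ vw); congr (_ && _).
by apply: eq_forallb => x; rewrite (same_comp_eq _ vw).
Qed.

Lemma right_val_rightmost D v w S : (forall x, S x -> same_comp D v x) ->
  rightmost D v w -> right_val S w = S w && ~~ odd (pcount w.1).
Proof.
move=> Sv /andP [vw /forallP Hw]; rewrite /right_val /right_parity xor0 // => k lk.
apply/negbTE/negP => /Sv vk; have /implyP /(_ vk) /= := Hw (k, w.2).
by rewrite leqNgt lk.
Qed.

(** Labels change along undotted cups but not along dotted ones, and the parity
of p changes along all cups. *)
Definition hue nu v := vee nu v (+) odd (pcount v.1).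

Lemma hue_cup D (nu : orientation D) d v w : cup_adj D d v w ->
  hue (val nu) v (+) hue (val nu) w = d.
Proof.
move=> vw; rewrite /hue addbACA (orientation_cup nu vw).
have [m [lv [x [_ hm hx _ e]]]] := cup_adjP vw.
have H := pcount_cup (layer_cup_diagram D hm) hx.
by case: e => -[-> ->] /=; rewrite H; case: (odd _); case: (d).
Qed.

Lemma hue_ray D (nu : orientation D) v w : ray_adj D v w ->
  hue (val nu) v = hue (val nu) w.
Proof.
by move=> vw; rewrite /hue (orientation_ray nu vw); case/andP: vw => /eqP ->.
Qed.

Lemma und_closed_hue D (nu : orientation D) S b : und_closed D S ->
  und_closed D (fun v => S v && (hue (val nu) v == b)).
Proof.
move=> Sc v w vw; rewrite (Sc v w vw); congr (_ && _).
case/orP: vw => vw; last by rewrite (hue_ray nu vw).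
by have := hue_cup nu vw; do 2!case: (hue _ _).
Qed.

Lemma und_closed_comp D v : und_closed D (same_comp D v).
Proof.
move=> u w uw; rewrite ![same_comp D v _]same_comp_sym; apply: same_comp_eq.
by apply: connect1; case/orP: uw => [/cup_adj_adj|/ray_adj_adj].
Qed.

Lemma comp_inP D v : inP v.1 -> forall w, same_comp D v w -> inP w.1.
Proof. by move=> vP w /same_comp_inP <-. Qed.

(** At a rightmost vertex the right count is its correction term.  At the left
end of a dotted cup it follows from the number of vertices of the circle on the
level, which is even, and the number of those to the left of the cup, which is
even by [left_dotted]. *)
Lemma rightmost_dotted D v w m lv x : ~~ on_line D v -> inP v.1 -> rightmost D v w ->
  in_layer m lv -> m <= h.+1 -> x \in cups (layer D m) -> x.2 ->
  same_comp D v (x.1.1, lv) -> ~~ odd (pcount w.1).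
Proof.
move=> nl vP rw ml hm hx dx vx; have Ha := layer_cup_diagram D hm.
have SP := @comp_inP D v vP.
have := right_val_rightmost (S := same_comp D v) (fun x h => h) rw.
have vw : same_comp D v w by case/andP: rw.
rewrite -(right_val_comp SP (@und_closed_comp D v) (v := (x.1.1, lv)) (w := w)); last first.
  by rewrite -(same_comp_eq w vx).
rewrite vw /= => <-.
rewrite /right_val vx (pcount_dotted Ha hx dx) addbF /=.
have Sadj u u' : adj D u u' -> same_comp D v u = same_comp D v u'.
  by move=> uu; rewrite ![same_comp D v _]same_comp_sym; apply: same_comp_eq; exact: connect1.
have := @level_parity_closed D (same_comp D v) SP Sadj.
have ne u : same_comp D v u -> ~~ line_end D u.
  by move=> vu; apply: contra nl => eu; apply/existsP; exists u; rewrite vu.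
move=> /(_ _ lv) H; move: (H (fun u vu => proj1 (norP (ne u vu)))).
rewrite /level_parity (bigID (fun k : pos B => k < x.1.1)) /=.
rewrite (left_dotted Ha (S := fun k => same_comp D v (k, lv))) //; last first.
- by move=> z hz; apply: Sadj; exact: (layer_adj ml).
- by move=> k /SP.
rewrite (bigD1 x.1.1) ?ltnn //= vx.
have -> : \big[addb/false]_(k : pos B | ~~ (k < x.1.1) && (k != x.1.1)) same_comp D v (k, lv)
        = right_parity (fun k => same_comp D v (k, lv)) x.1.1.
  by apply: eq_bigl => k; rewrite -leqNgt andbC eq_sym -val_eqE -ltn_neqAle.
by case: (right_parity _ _).
Qed.

(** If p is odd at the rightmost vertices, the circle has no dotted arc and the
hue is constant on it.  Otherwise the right count for the vertices of one hue
tells at a rightmost vertex whether this vertex has that hue. *)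
Lemma rightmost_vee D (nu : orientation D) v w w' : ~~ on_line D v -> inP v.1 ->
  rightmost D v w -> rightmost D v w' -> vee (val nu) w = vee (val nu) w'.
Proof.
move=> nl vP rw rw'.
have [vw /forallP Hw] := andP rw; have [vw' /forallP Hw'] := andP rw'.
have ww : same_comp D w w' by rewrite -(same_comp_eq _ vw).
have e : w.1 = w'.1.
  apply/val_inj/eqP; rewrite eqn_leq; apply/andP; split.
    exact: (implyP (Hw' w)).
  exact: (implyP (Hw w')).
suff : hue (val nu) w = hue (val nu) w' by rewrite /hue e => /addIb.
case podd: (odd (pcount w.1)).
  have cl : closed (adj D) (fun u => same_comp D v u && (hue (val nu) u == hue (val nu) w)).
    move=> x y xy; rewrite /in_mem /=.
    have -> : same_comp D v x = same_comp D v y.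
      by rewrite ![same_comp D v _]same_comp_sym; apply: same_comp_eq; exact: connect1.
    case vy: (same_comp D v y) => //=.
    have vx : same_comp D v x by apply: (same_comp_trans vy); rewrite same_comp_sym; apply: connect1.
    suff -> : hue (val nu) x = hue (val nu) y by [].
    case/or3P: xy => xy; last by rewrite (hue_ray nu xy).
      by apply/eqP; rewrite -[_ == _]negbK -addNb; have := hue_cup nu xy; do 2!case: (hue _ _).
    have [m [lv [z [ml hm hz dz ez]]]] := cup_adjP xy.
    suff : ~~ odd (pcount w.1) by rewrite podd.
    apply: (rightmost_dotted nl vP rw ml hm hz dz).
    by case: ez vx vy => -[-> ->].
  have := closed_connect cl ww; rewrite /in_mem /= eqxx vw vw' /= => /esym /eqP ->.
  by [].
pose S u := same_comp D v u && (hue (val nu) u == true).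
have Sc : und_closed D S by apply: und_closed_hue; exact: und_closed_comp.
have SP u : S u -> inP u.1 by case/andP => /(comp_inP vP).
have Sv u : S u -> same_comp D v u by case/andP.
have := right_val_comp SP Sc ww.
rewrite !(right_val_rightmost Sv) // -e podd /= !andbT /S vw vw' /= !eqb_id.
by [].
Qed.

Lemma clockwise_rightmost D (nu : orientation D) v w : inP v.1 -> ~~ on_line D v ->
  rightmost D v w -> clockwise nu v = vee (val nu) w.
Proof.
move=> vP nl rw; rewrite /clockwise nl /=; apply/existsP/idP => [[u /andP [ru hu]]|hw].
  by rewrite (rightmost_vee nu nl vP rw ru).
by exists w; rewrite rw.
Qed.

Lemma clockwise_inP D (nu : orientation D) v : clockwise nu v -> inP v.1 /\ ~~ on_line D v.
Proof.
case/andP => nl /existsP [w /andP [/andP [vw _] hw]]; split => //.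
rewrite (same_comp_inP vw) /inP; move: hw; rewrite /label.
case/andP: (valP (tnth (val nu) w.2)) => /forallP /(_ w.1) + _.
by case: (bdiag B w.1) => // /eqP ->.
Qed.

Lemma clockwise_comp D (nu : orientation D) v w : same_comp D v w ->
  clockwise nu v = clockwise nu w.
Proof.
move=> vw; rewrite /clockwise (on_line_comp vw); congr (_ && _).
by apply: eq_existsb => u; rewrite (rightmost_comp vw).
Qed.

Lemma clockwise_diff D (mu nu : orientation D) v : inP v.1 -> ~~ on_line D v ->
  clockwise mu v (+) clockwise nu v = vee (val mu) v (+) vee (val nu) v.
Proof.
move=> vP nl; have [w rw] := rightmost_ex D v.
rewrite !(clockwise_rightmost _ vP nl rw); apply/esym/vee_ratio.
by case/andP: rw.
Qed.

Lemma orientation_eq D (mu nu : orientation D) :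
  (forall v, clockwise mu v = clockwise nu v) -> mu = nu.
Proof.
move=> H; apply/val_inj/tuple_ext => v vP.
case nl: (on_line D v); first exact: vee_line.
have := clockwise_diff mu nu vP (negbT nl); rewrite H addbb.
by do 2!case: (vee _ _).
Qed.

(** Starting from any orientation, exactly the circles that have the wrong
direction are reversed. *)
Lemma orientation_ex D (nu : orientation D) (f : pred vertex) :
  (forall v w, same_comp D v w -> f v = f w) ->
  exists mu : orientation D, forall v, inP v.1 -> ~~ on_line D v -> clockwise mu v = f v.
Proof.
move=> fc; pose Z v := [&& inP v.1, ~~ on_line D v & clockwise nu v (+) f v].
have [|||mu Hmu] := @flip_orientation D nu Z.
- by move=> v /and3P [].
- move=> v w vw; have c := connect1 vw.
  by rewrite /Z (same_comp_inP c) (on_line_comp c) (clockwise_comp nu c) (fc _ _ c).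
- move=> v /and3P [_ + _]; apply: contra => ev; apply/existsP; exists v.
  by rewrite same_comp_refl.
exists mu => v vP nl; have := clockwise_diff mu nu vP nl.
rewrite Hmu // /Z vP nl /=.
by case: (clockwise mu v); case: (clockwise nu v); case: (f v); case: (vee _ _).
Qed.

Lemma parity_walk D (nu : orientation D) x y : connect (parity_step D) x y ->
  vee (val nu) x.1 (+) x.2 = vee (val nu) y.1 (+) y.2.
Proof.
apply: (closed_connect (a := fun x => vee (val nu) x.1 (+) x.2)) => {}x {}y.
rewrite /in_mem /= /parity_step; case: eqP => [-> /orP [] xy|ne xy].
- by have := orientation_cup nu xy; do 2!case: (vee _ _).
- by rewrite (orientation_ray nu xy).
- by have := orientation_cup nu xy; move: ne; case: (x.2); case: (y.2); do 2!case: (vee _ _).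
Qed.

Lemma parity_lift D v w b : same_comp D v w -> exists b', connect (parity_step D) (v, b) (w, b').
Proof.
case/connectP => p; elim: p v b => [|u p IH] v b /= => [_ -> |/andP [vu pth] e].
  by exists b; exact: connect0.
have [b' hb'] : exists b', parity_step D (v, b) (u, b').
  case/or3P: vu => vu; [exists (~~ b)|exists b|exists b]; rewrite /parity_step /=.
  - by rewrite vu; case: b.
  - by rewrite eqxx vu.
  - by rewrite eqxx vu orbT.
have [b2 h2] := IH u b' pth e.
by exists b2; exact: connect_trans (connect1 hb') h2.
Qed.

(** Labels change along a walk exactly at undotted cups and caps, and a walk to
a rightmost vertex of a clockwise circle ends at a Vee. *)
Lemma sign_clockwise D (nu : orientation D) v : clockwise nu v ->
  sign_odd D v = ~~ vee (val nu) v.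
Proof.
move=> cv; have [vP nl] := clockwise_inP cv; apply/existsP/idP => [[w /andP [rw vw]]|nv].
  have := parity_walk nu vw; rewrite /= -(clockwise_rightmost nu vP nl rw) cv /=.
  by case: (vee _ _).
have [w rw] := rightmost_ex D v; exists w; rewrite rw /=.
have [vw _] := andP rw; have [b hb] := parity_lift false vw.
have := parity_walk nu hb; rewrite /= -(clockwise_rightmost nu vP nl rw) cv (negPf nv) /=.
by case: b hb.
Qed.
End Orientations.

(** * Components before and after a surgery *)
Lemma layer_middle (B : block) h (D : stacked B h) (l : 'I_h) :
  layer D l.+1 = val (tnth (middle D) l).
Proof.
rewrite /layer /= nth_rcons size_map size_tuple ltn_ord.
by rewrite (nth_map (tnth (middle D) l)) ?size_tuple // -tnth_nth.
Qed.

Lemma layer_eq (B : block) h (D D' : stacked B h) (m : nat) :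
  lower D' = lower D -> upper D' = upper D ->
  (forall k : 'I_h, k.+1 = m -> tnth (middle D') k = tnth (middle D) k) ->
  m <= h.+1 -> layer D' m = layer D m.
Proof.
move=> eL eU eM; case: m eM => [|m] eM hm; first by rewrite /layer /= eL.
case: (ltngtP m h) => [mh|hm'|->].
- by rewrite !(layer_middle _ (Ordinal mh)) eM.
- by move: hm; rewrite ltnS leqNgt hm'.
- by rewrite /layer /= !nth_rcons !size_map !size_tuple ltnn eqxx eU.
Qed.

Lemma ray_adjP (B : block) h (D : stacked B h) v w : ray_adj D v w ->
  exists (lv lv' : 'I_h.+1) r, [/\ lv' = lv.+1 :> nat, r \in rays (layer D lv')
    & (v = (r.1, lv) /\ w = (r.1, lv')) \/ (w = (r.1, lv) /\ v = (r.1, lv'))].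
Proof.
case: v w => [i l] [j m]; rewrite /ray_adj /= => /andP [/eqP <-].
case/orP => /andP [/eqP e /has_rayP [r hr <-]]; [exists l, m, r|exists m, l, r]; split => //.
  by left.
by right.
Qed.

Section SurgeryAt.
Variables (B : block) (h : nat) (D D' : stacked B h) (s : surgery_site B h).
Hypothesis Hs : surgery_at D D' s.
Local Notation vertex := (vertex B h).
Local Notation l := s.1.1.1.
Local Notation i := s.1.1.2.
Local Notation j := s.1.2.
Local Notation dot := s.2.
Local Notation lo := (level_below l).
Local Notation hi := (level_above l).
Implicit Types (v w : vertex) (S W : pred vertex).

(** The fourth corner of a surgery: [ilo] and [jlo] are the ends of the cap that
is removed, [ihi] and [jhi] those of the cup. *)
Definition jlo : vertex := (j, lo).
Local Notation pa := (ilo s).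
Local Notation pb := jlo.
Local Notation pc := (ihi s).
Local Notation pd := (jhi s).

Definition site_cup : pos B * pos B * bool := (i, j, dot).

Lemma val_lo : lo = l :> nat. Proof. by []. Qed.
Lemma val_hi : hi = l.+1 :> nat. Proof. by []. Qed.

Lemma surgery_lower : lower D' = lower D.
Proof. by move: Hs; rewrite /surgery_at; case: (s) => [[[? ?] ?] ?] /and5P [/eqP]. Qed.

Lemma surgery_upper : upper D' = upper D.
Proof. by move: Hs; rewrite /surgery_at; case: (s) => [[[? ?] ?] ?] /and5P [_ /eqP]. Qed.

Lemma surgery_layer m : m != l.+1 -> m <= h.+1 -> layer D' m = layer D m.
Proof.
move=> hm; apply: layer_eq; [exact: surgery_lower|exact: surgery_upper|].
move=> k ek; move: Hs hm; rewrite /surgery_at; case: (s) => [[[l0 ?] ?] ?] /= .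
case/and5P => _ _ /forallP /(_ k) /implyP H _ _ hm; apply/eqP; apply: H.
by apply: contraNneq hm => <-; rewrite ek.
Qed.

Lemma site_cup_in : site_cup \in cups (layer D l.+1).
Proof.
rewrite layer_middle /site_cup; move: Hs; rewrite /surgery_at.
by case: (s) => [[[? ?] ?] ?] /= /and5P [_ _ _ h4 _].
Qed.

Lemma surgery_cups : cups (layer D' l.+1) = cups (layer D l.+1) :\ site_cup.
Proof.
rewrite !layer_middle /site_cup; move: Hs; rewrite /surgery_at.
by case: (s) => [[[? ?] ?] ?] /= /and5P [_ _ _ _ /andP [/eqP]].
Qed.

Lemma surgery_rays :
  rays (layer D' l.+1) = (i, false) |: ((j, false) |: rays (layer D l.+1)).
Proof.
rewrite !layer_middle; move: Hs; rewrite /surgery_at.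
by case: (s) => [[[? ?] ?] ?] /= /and5P [_ _ _ _ /andP [_ /eqP]].
Qed.

Let La : is_cup_diagram (layer D l.+1) := layer_above D lo.
Let Lb : is_cup_diagram (layer D' l.+1) := layer_above D' lo.

Lemma site_lt : i < j. Proof. exact: (cup_lt La site_cup_in). Qed.
Lemma site_neq : i != j. Proof. exact: (cup_neq La site_cup_in). Qed.
Lemma site_inP1 : inP i. Proof. exact: (cup_inP1 La site_cup_in). Qed.
Lemma site_inP2 : inP j. Proof. exact: (cup_inP2 La site_cup_in). Qed.
Lemma site_pcount : odd (pcount j) = ~~ odd (pcount i).
Proof. exact: (pcount_cup La site_cup_in). Qed.
Lemma site_dotted : dot -> odd (pcount i).
Proof. exact: (pcount_dotted La site_cup_in). Qed.

Lemma lo_neq_hi : lo != hi.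
Proof. by rewrite -val_eqE /= neq_ltn ltnSn. Qed.

Lemma corners_uniq : uniq [:: pa; pb; pc; pd].
Proof.
rewrite /= !inE /ilo /ihi /jhi /jlo !xpair_eqE !eqxx.
by rewrite (negPf lo_neq_hi) (negPf site_neq) ?andbF.
Qed.

(** The arcs below the vertices except the cup that the surgery removes; [gup]
is the same above, and [gadj] is the part that the diagrams before and after the
surgery have in common. *)
Definition glow v w := low_adj D v w && ~~ pair_rel pc pd v w.
Definition gup v w := up_adj D v w && ~~ pair_rel pa pb v w.
Definition gadj v w := glow v w || gup v w.

Lemma pair_sym (T : eqType) (x y u v : T) : pair_rel x y u v = pair_rel x y v u.
Proof. by rewrite /pair_rel orbC; do 4!case: (_ == _). Qed.

Lemma site_joins (x y : pos B) : arc_joins (layer D' l.+1) x y =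
  arc_joins (layer D l.+1) x y && ~~ pair_rel i j x y.
Proof.
have sj : arc_joins (layer D l.+1) i j.
  by apply/arc_joinsP; exists site_cup; rewrite ?site_cup_in // !eqxx.
apply/arc_joinsP/andP => [[x' + ex]|[/arc_joinsP [x' hx' ex] np]].
  rewrite surgery_cups in_setD1 => /andP [nx hx']; split; first by apply/arc_joinsP; exists x'.
  apply: contra nx => np; apply/eqP; apply: (touches_unique La (k := i)) => //.
  - exact: site_cup_in.
  - rewrite /touches; case/orP: np ex => /andP [/eqP -> /eqP ->] /orP [] /andP [h1 h2];
    by rewrite ?h1 ?h2 ?orbT.
  - by rewrite /touches eqxx.
exists x' => //; rewrite surgery_cups in_setD1 hx' andbT; apply: contra np => /eqP e.
by move: ex; rewrite e /pair_rel /= ![i == _]eq_sym ![j == _]eq_sym orbC => /orP [] /andP [-> ->]; rewrite ?orbT.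
Qed.

Lemma site_has_ray (x : pos B) : has_ray (layer D' l.+1) x =
  has_ray (layer D l.+1) x || (x == i) || (x == j).
Proof.
rewrite /has_ray surgery_rays !in_setU1 !xpair_eqE /= !andbF !andbT /=.
by case: (x == i); case: (x == j); rewrite ?orbT ?orbF.
Qed.

Lemma low_surgery v w :
  low_adj D' v w = glow v w || ((v == pc) && (w == pa)) || ((v == pd) && (w == pb)).
Proof.
case: v w => [x m] [y n]; rewrite /glow /low_adj /pair_rel /ilo /ihi /jhi /jlo /= !xpair_eqE.
have [em|nm] := eqVneq m hi; last first.
  rewrite !andbF /= !andbT !orbF surgery_layer //; last exact: ltnW.
rewrite em /= site_joins site_has_ray /pair_rel !andbT.
have -> : (l.+1 == n.+1) = (n == lo) by rewrite eqSS eq_sym -val_eqE.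
have hl : (hi == lo) = false by rewrite eq_sym (negPf lo_neq_hi).
have [->|nn] := eqVneq n hi.
  by rewrite hl !andbF !orbF !andbT.
rewrite !andbF /= !andbT -[bump 0 l]/(l.+1).
case: (n == lo); rewrite ?andbF ?andbT //=.
case: (eqVneq x y) => [->|nxy] /=; last first.
  by apply/esym/negbTE/negP => /orP [] /andP [/eqP e1 /eqP e2]; rewrite e1 e2 eqxx in nxy.
by rewrite !andbb ?orbA.
Qed.

Lemma up_surgery v w :
  up_adj D' v w = gup v w || ((v == pa) && (w == pc)) || ((v == pb) && (w == pd)).
Proof.
case: v w => [x m] [y n]; rewrite /gup /up_adj /pair_rel /ilo /ihi /jhi /jlo /= !xpair_eqE.
have [em|nm] := eqVneq m lo; last first.
  rewrite !andbF /= !andbT !orbF surgery_layer //.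
  case: (eqVneq (n : nat) m.+1) => e; rewrite ?andbF //= surgery_layer //; last exact: ltnW.
  by rewrite e.
rewrite em /= site_joins /pair_rel !andbT.
have -> : (n == l.+1 :> nat) = (n == hi) by rewrite -val_eqE.
have [->|nn] := eqVneq n hi.
  have hl : (hi == lo) = false by rewrite eq_sym (negPf lo_neq_hi).
  rewrite site_has_ray (negPf lo_neq_hi) hl -[nat_of_ord hi]/(l.+1) !andbF !andbT !orFb.
  case: (eqVneq x y) => [->|nxy] /=; last first.
    by apply/esym/negbTE/negP => /orP [] /andP [/eqP e1 /eqP e2]; rewrite e1 e2 eqxx in nxy.
  by rewrite !andbb ?orbA.
by rewrite [n == lo]eq_sym !andbF !orbF; case: (lo == n); rewrite ?andbT ?andbF.
Qed.

Lemma glow_low v w : glow v w -> low_adj D v w. Proof. by case/andP. Qed.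
Lemma gup_up v w : gup v w -> up_adj D v w. Proof. by case/andP. Qed.

Lemma gadj_adj v w : gadj v w -> adj D v w.
Proof. by rewrite adjE => /orP [/glow_low ->|/gup_up ->]; rewrite ?orbT. Qed.

Lemma site_arc : arc_joins (layer D l.+1) i j.
Proof. by apply/arc_joinsP; exists site_cup; rewrite ?site_cup_in // !eqxx. Qed.

Lemma site_low : low_adj D pc pd.
Proof. by rewrite /low_adj eqxx /= site_arc. Qed.
Lemma site_up : up_adj D pa pb.
Proof. by rewrite /up_adj eqxx /= site_arc. Qed.

Lemma adj_before : adj D =2 two_arcs gadj pa pb pc pd.
Proof.
move=> v w; rewrite adjE /two_arcs /gadj /glow /gup.
have Hc : pair_rel pc pd v w -> low_adj D v w.
  case/orP => /andP [/eqP -> /eqP ->]; first exact: site_low.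
  by rewrite (low_up_cup_sym _ (v := pd) (w := pc)) // site_low.
have Ha : pair_rel pa pb v w -> up_adj D v w.
  case/orP => /andP [/eqP -> /eqP ->]; first exact: site_up.
  by rewrite (low_up_cup_sym _ (v := pb) (w := pa)) // site_up.
move: Hc Ha; case: (low_adj D v w); case: (up_adj D v w); case: (pair_rel pa pb v w);
  case: (pair_rel pc pd v w) => //= h1 h2; by [have := h1 isT|have := h2 isT].
Qed.

Lemma adj_after : adj D' =2 two_arcs gadj pa pc pb pd.
Proof.
move=> v w; rewrite adjE /two_arcs /gadj low_surgery up_surgery /pair_rel.
case: (glow v w); case: (gup v w); case: (v == pa); case: (v == pb); case: (v == pc);
  case: (v == pd); case: (w == pa); case: (w == pb); case: (w == pc); case: (w == pd); by [].
Qed.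

Lemma gadj_sym : symmetric gadj.
Proof.
move=> v w; rewrite /gadj /glow /gup ![pair_rel _ _ w v]pair_sym.
case: (eqVneq v.2 w.2) => e; first by rewrite !(low_up_cup_sym D e).
have nc : pair_rel pc pd v w = false.
  by apply/negbTE/negP => /orP [] /andP [/eqP ev /eqP ew]; rewrite ev ew eqxx in e.
have na : pair_rel pa pb v w = false.
  by apply/negbTE/negP => /orP [] /andP [/eqP ev /eqP ew]; rewrite ev ew eqxx in e.
rewrite nc na !andbT (low_up_ray_sym D e) -(low_up_ray_sym D (v := w)) 1?orbC //.
by rewrite eq_sym.
Qed.

Lemma glow_fun v w w' : glow v w -> glow v w' -> w = w'.
Proof. by move=> /glow_low h1 /glow_low; exact: low_adj_fun h1. Qed.
Lemma gup_fun v w w' : gup v w -> gup v w' -> w = w'.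
Proof. by move=> /gup_up h1 /gup_up; exact: up_adj_fun h1. Qed.

Local Notation corners := [:: pa; pb; pc; pd].

Lemma corner_up v w : (v == pa) || (v == pb) -> ~~ gup v w.
Proof.
move=> hv; apply/negP => /andP [h1 /negP]; apply.
case/orP: hv h1 => /eqP -> h1; rewrite /pair_rel !eqxx /=.
  by rewrite (up_adj_fun h1 site_up) eqxx.
rewrite (up_adj_fun (w' := pa) h1) ?eqxx ?orbT //.
by rewrite (low_up_cup_sym D (v := pb) (w := pa)) // site_up.
Qed.

Lemma corner_low v w : (v == pc) || (v == pd) -> ~~ glow v w.
Proof.
move=> hv; apply/negP => /andP [h1 /negP]; apply.
case/orP: hv h1 => /eqP -> h1; rewrite /pair_rel !eqxx /=.
  by rewrite (low_adj_fun h1 site_low) eqxx.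
rewrite (low_adj_fun (w' := pc) h1) ?eqxx ?orbT //.
by rewrite (low_up_cup_sym D (v := pd) (w := pc)) // site_low.
Qed.

Lemma corner_end v : v \in corners -> path_end glow gup v.
Proof.
rewrite !inE orbA => /orP [hv|hv]; [right|left] => w; first exact: corner_up.
exact: corner_low.
Qed.

Lemma line_end_gend v : line_end D v -> path_end glow gup v.
Proof.
case/line_end_path_end => H; [left|right] => w; apply: contra (H w).
  exact: glow_low.
exact: gup_up.
Qed.

Lemma corner_line_end v w : v \in corners -> line_end D v -> connect gadj v w -> v = w.
Proof.
move=> hv ev; apply: path_end_isolated => z; move: hv; rewrite !inE orbA => /orP [] hv.
- case/orP: ev => [bv|tv]; first by apply: contra (bottom_end_low z bv); exact: glow_low.
  case/andP: tv => /eqP e _; have : v.2 = lo by case/orP: hv => /eqP ->.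
  move=> e'; have e2 : nat_of_ord l = h by rewrite -[RHS]e e'.
  by move: (ltn_ord l); rewrite {1}e2 ltnn.
- exact: corner_low.
- exact: corner_up.
- case/orP: ev => [bv|tv]; last by apply: contra (top_end_up z tv); exact: gup_up.
  case/andP: bv => /eqP e _; have : v.2 = hi by case/orP: hv => /eqP ->.
  by move=> e'; rewrite e' in e.
Qed.

Lemma gadj_path_two x y z : path_end glow gup x -> path_end glow gup y -> path_end glow gup z ->
  x != y -> x != z -> y != z -> connect gadj x y -> connect gadj x z -> False.
Proof. exact: (path_end_two glow_fun gup_fun gadj_sym). Qed.

(** A path has only two ends. *)
Lemma paired_no_end x y : x \in corners -> y \in corners -> x != y -> connect gadj x y ->
  ~~ has_end (line_end D) gadj x.
Proof.
move=> hx hy nxy xy; apply/existsP => -[z /andP [xz ez]].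
case: (eqVneq x z) => [e|nxz].
  by rewrite -e in ez; rewrite (corner_line_end hx ez xy) eqxx in nxy.
case: (eqVneq y z) => [e|nyz].
  rewrite -e in ez; move: nxy; rewrite (corner_line_end (w := x) hy ez) ?eqxx //.
  by rewrite (sym_connect_sym gadj_sym).
apply: (gadj_path_two (corner_end hx) (corner_end hy) (line_end_gend ez)) xy xz => //.
Qed.

Lemma layer_gadj m (lv : 'I_h.+1) z : in_layer m lv -> z \in cups (layer D m) ->
  (m = l.+1 -> z != site_cup) -> gadj (z.1.1, lv) (z.1.2, lv).
Proof.
move=> ml hz nz; have hj : arc_joins (layer D m) z.1.1 z.1.2.
  by apply/arc_joinsP; exists z; rewrite // !eqxx.
have np (lv' : 'I_h.+1) : m = l.+1 -> pair_rel (i, lv') (j, lv') (z.1.1, lv) (z.1.2, lv) = false.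
  move=> em; apply/negbTE/negP => hp; case/negP: (nz em); apply/eqP.
  rewrite em in hz; apply: (touches_unique La (k := i)) => //.
  - exact: site_cup_in.
  - rewrite /touches; move: hp; rewrite /pair_rel !xpair_eqE.
    by case/orP => /andP [/andP [h1 _] /andP [h2 _]]; rewrite ?h1 ?h2 ?orbT.
  - by rewrite /touches eqxx.
rewrite /gadj /glow /gup /low_adj /up_adj /= !eqxx.
case/orP: ml => /eqP em; rewrite em in hj.
  rewrite hj /= /ihi /jhi; case: (eqVneq lv hi) => e.
    by rewrite -e np // em e.
  by rewrite /pair_rel !xpair_eqE (negPf e) !andbF.
rewrite hj /= /ilo /jlo orbC; case: (eqVneq lv lo) => e.
  by rewrite -e np // em e.
by rewrite /pair_rel !xpair_eqE (negPf e) !andbF.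
Qed.

Lemma ray_gadj (lv lv' : 'I_h.+1) r : lv' = lv.+1 :> nat -> r \in rays (layer D lv') ->
  gadj (r.1, lv) (r.1, lv').
Proof.
move=> e hr; rewrite /gadj /gup /up_adj /= eqxx e eqxx /=.
have -> : has_ray (layer D lv.+1) r.1 by rewrite -e; apply/has_rayP; exists r.
rewrite orbT /=; apply/orP; right; apply/negP.
have n : lv != lv' by rewrite -val_eqE /= e neq_ltn ltnSn.
rewrite /pair_rel !xpair_eqE.
by case/orP => /andP [/andP [_ /eqP e1] /andP [_ /eqP e2]]; rewrite e1 e2 eqxx in n.
Qed.

Definition gclosed W := forall v w, gadj v w -> W v = W w.

Lemma ray_site1 : (i, false) \in rays (layer D' l.+1).
Proof. by rewrite surgery_rays !inE eqxx. Qed.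
Lemma ray_site2 : (j, false) \in rays (layer D' l.+1).
Proof. by rewrite surgery_rays !inE eqxx orbT. Qed.

(** The new ray at j forbids dotted cups to its right. *)
Lemma cup_right_of_site z : z \in cups (layer D l.+1) -> j < z.1.1 ->
  z \in cups (layer D' l.+1) /\ z.2 = false.
Proof.
move=> hz lz; have hz' : z \in cups (layer D' l.+1).
  rewrite surgery_cups in_setD1 hz andbT; apply: contraTneq lz => ->.
  by rewrite -leqNgt (ltnW site_lt).
split=> //; apply/negbTE/negP => dz.
by have := dotted_cup_ray Lb hz' ray_site2 dz; rewrite leqNgt lz.
Qed.

(** The ray that the surgery creates at j allows to compare the counts to the
right of j on the two levels, without a condition on the corners. *)
Lemma right_parity_site S : (forall v, S v -> inP v.1) ->
  (forall z, z \in cups (layer D l.+1) -> z.2 = false -> j < z.1.1 ->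
     S (z.1.1, lo) = S (z.1.2, lo) /\ S (z.1.1, hi) = S (z.1.2, hi)) ->
  (forall r, r \in rays (layer D l.+1) -> S (r.1, lo) = S (r.1, hi)) ->
  right_parity (fun k => S (k, lo)) j = right_parity (fun k => S (k, hi)) j.
Proof.
move=> SP Hc Hr.
apply: (right_parity_ray Lb (S1 := fun k => S (k, lo)) (S2 := fun k => S (k, hi)) (r := (j, false))).
- by move=> k /SP.
- by move=> k /SP.
- exact: ray_site2.
- move=> z hz lz; have hz' : z \in cups (layer D l.+1).
    by move: hz; rewrite surgery_cups in_setD1 => /andP [].
  have [_ dz] := cup_right_of_site hz' lz.
  by have [-> ->] := Hc z hz' dz lz; rewrite !addbb.
- move=> r; rewrite surgery_rays !in_setU1 => /or3P [/eqP ->|/eqP ->|hr] /=.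
  + by move=> lt; have := ltn_trans lt site_lt; rewrite ltnn.
  + by rewrite ltnn.
  + by move=> _; exact: Hr.
Qed.

Lemma right_parity_site_cup S (lv : 'I_h.+1) : (forall v, S v -> inP v.1) ->
  (forall z, z \in cups (layer D l.+1) -> z \in cups (layer D' l.+1) -> z.2 = false ->
     S (z.1.1, lv) = S (z.1.2, lv)) ->
  right_parity (fun k => S (k, lv)) i = right_parity (fun k => S (k, lv)) j (+) S (j, lv).
Proof.
move=> SP Hc; apply: (right_parity_cup La (S := fun k => S (k, lv)) (x := site_cup)).
- by move=> k /SP.
- exact: site_cup_in.
- move=> z hz dz lz _; apply: Hc => //; rewrite surgery_cups in_setD1 hz andbT.
  by apply: contraTneq lz => ->; rewrite ltnn.
Qed.

Lemma gclosed_cup W z : gclosed W -> z \in cups (layer D l.+1) -> z != site_cup ->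
  W (z.1.1, lo) = W (z.1.2, lo) /\ W (z.1.1, hi) = W (z.1.2, hi).
Proof.
move=> Wc hz nz; split; apply: Wc; apply: (layer_gadj (m := l.+1)) => //.
  by rewrite /in_layer val_lo eqxx orbT.
by rewrite /in_layer val_hi eqxx.
Qed.

Lemma in_surgery_cups z : z \in cups (layer D' l.+1) ->
  z \in cups (layer D l.+1) /\ z != site_cup.
Proof. by rewrite surgery_cups in_setD1 => /andP []. Qed.

Lemma gclosed_ray W r : gclosed W -> r \in rays (layer D l.+1) -> W (r.1, lo) = W (r.1, hi).
Proof. by move=> Wc hr; apply: Wc; exact: (ray_gadj (lv := lo) (lv' := hi)). Qed.

(** Only the common part of the two diagrams is followed.  A ray with the
removed cup to its right sees the four corners, which is why they have to
balance; inside a cup that survives there is no removed cup, as its ends became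
rays. *)
Lemma right_val_gadj W : (forall v, W v -> inP v.1) -> gclosed W ->
  W pa (+) W pb = W pc (+) W pd ->
  forall v w, gadj v w -> right_val W v = right_val W w.
Proof.
move=> WP Wc Wpar v w vw; have Wvw := Wc v w vw.
case: (adjP (gadj_adj vw)) => [m lv x ml hm hx e|lv lv' r e hr e'].
  suff H : right_val W (x.1.1, lv) = right_val W (x.1.2, lv) by case: e => -[-> ->].
  apply: (right_val_cup WP hm hx) => [z hz dz lz zl|_]; last by case: e Wvw => -[-> ->].
  apply: Wc; apply: (layer_gadj ml hz) => em; apply/negP => /eqP ez.
  rewrite em in hx hz; rewrite ez /= in lz zl.
  have hx' : x \in cups (layer D' l.+1).
    rewrite surgery_cups in_setD1 hx andbT; apply: contraTneq lz => ->.
    by rewrite ltnn.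
  have := ray_notin_cup Lb hx' ray_site1 lz; rewrite leqNgt.
  by rewrite (ltn_trans site_lt zl).
suff H : right_val W (r.1, lv) = right_val W (r.1, lv') by case: e' => -[-> ->].
apply: (right_val_ray WP e hr) => [z hz lz|r' hr' _|]; last 2 first.
- by apply: Wc; apply: ray_gadj.
- by apply: Wc; apply: ray_gadj.
case: (eqVneq (lv' : nat) l.+1) => [elv|nlv]; last first.
  have il : in_layer lv' lv by rewrite /in_layer e eqxx orbT.
  have il' : in_layer lv' lv' by rewrite /in_layer eqxx.
  have nz : (lv' : nat) = l.+1 -> z != site_cup by move=> e1; rewrite e1 eqxx in nlv.
  by rewrite (Wc _ _ (layer_gadj il hz nz)) (Wc _ _ (layer_gadj il' hz nz)) !addbb.
have -> : lv' = hi by apply/val_inj.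
have -> : lv = lo by apply/val_inj => /=; move: e; rewrite elv => -[].
rewrite elv in hz.
case: (eqVneq z site_cup) => [->|nz]; first exact: Wpar.
by have [-> ->] := gclosed_cup Wc hz nz; rewrite !addbb.
Qed.

Lemma right_val_gconnect W : (forall v, W v -> inP v.1) -> gclosed W ->
  W pa (+) W pb = W pc (+) W pd ->
  forall v w, connect gadj v w -> right_val W v = right_val W w.
Proof.
move=> WP Wc Wpar v w; apply: (closed_connect (a := right_val W)) => x y.
exact: right_val_gadj.
Qed.

Lemma gcomp_inP v w : inP v.1 -> connect gadj v w -> inP w.1.
Proof.
move=> vP vw; rewrite -(@same_comp_inP _ _ D v w) //.
by apply: connect_sub vw => x y /gadj_adj /connect1.
Qed.

Lemma gclosed_gcomp v : gclosed (connect gadj v).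
Proof.
move=> x y xy; rewrite ![connect gadj v _](sym_connect_sym gadj_sym).
by apply: same_connect (connect1 xy) _; exact: sym_connect_sym gadj_sym.
Qed.

Lemma corner_other x y z : x \in corners -> y \in corners -> z \in corners ->
  x != y -> x != z -> y != z -> connect gadj x y -> connect gadj x z = false.
Proof.
move=> hx hy hz n1 n2 n3 xy; apply/negbTE/negP => xz.
exact: (gadj_path_two (corner_end hx) (corner_end hy) (corner_end hz)) xy xz.
Qed.

Lemma corners_neq : [/\ pa != pb, pa != pc, pa != pd, pb != pc & (pb != pd) && (pc != pd)].
Proof.
have := corners_uniq; rewrite !cons_uniq !in_cons !in_nil !orbF !negb_or.
move=> /and5P [/and3P [n1 n2 n3] /andP [n4 n5] n6 _ _].
by split => //; apply/andP; split.
Qed.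

Lemma corner_in : [/\ pa \in corners, pb \in corners, pc \in corners & pd \in corners].
Proof. by rewrite !inE !eqxx !orbT. Qed.

(** A component of the common part that joins two opposite corners contains no
other corner, so it satisfies the condition of [right_val_gconnect]; but the
right counts at these two corners differ. *)
Lemma not_a_d : ~~ connect gadj pa pd.
Proof.
have [ia ib ic id] := corner_in; have [n1 n2 n3 n4 /andP [n5 n6]] := corners_neq.
apply/negP => ad; pose W := connect gadj pa.
have Wb : W pb = false by apply: (corner_other ia id ib) => //; rewrite eq_sym.
have Wc : W pc = false by apply: (corner_other ia id ic) => //; rewrite eq_sym.
have Wa : W pa by exact: connect0.
have WP v : W v -> inP v.1 by apply: gcomp_inP; exact: site_inP1.
have Wcl : gclosed W by exact: gclosed_gcomp.
have := right_val_gconnect WP Wcl _ ad; rewrite Wa Wb Wc [W pd]ad => /(_ isT).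
rewrite /right_val Wa [W pd]ad /= site_pcount negbK.
rewrite right_parity_site_cup //; last first.
  by move=> z _ /in_surgery_cups [hz nz] _; case: (gclosed_cup Wcl hz nz).
rewrite [W (j, lo)]Wb addbF right_parity_site //.
- by case: (right_parity _ _); case: (odd _).
- move=> z hz dz lz; apply: gclosed_cup => //.
  by have [/in_surgery_cups []] := cup_right_of_site hz lz.
- by move=> r; apply: gclosed_ray.
Qed.

Lemma not_b_c : ~~ connect gadj pb pc.
Proof.
have [ia ib ic id] := corner_in; have [n1 n2 n3 n4 /andP [n5 n6]] := corners_neq.
apply/negP => bc; pose W := connect gadj pb.
have Wa : W pa = false by apply: (corner_other ib ic ia) => //; rewrite eq_sym.
have Wd : W pd = false by apply: (corner_other ib ic id).
have Wb : W pb by exact: connect0.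
have WP v : W v -> inP v.1 by apply: gcomp_inP; exact: site_inP2.
have Wcl : gclosed W by exact: gclosed_gcomp.
have := right_val_gconnect WP Wcl _ bc; rewrite Wa Wb Wd [W pc]bc => /(_ isT).
rewrite /right_val Wb [W pc]bc /= site_pcount negbK.
rewrite [in RHS]right_parity_site_cup //; last first.
  by move=> z _ /in_surgery_cups [hz nz] _; case: (gclosed_cup Wcl hz nz).
rewrite [W (j, hi)]Wd addbF right_parity_site //.
- by case: (right_parity _ _); case: (odd _).
- move=> z hz dz lz; apply: gclosed_cup => //.
  by have [/in_surgery_cups []] := cup_right_of_site hz lz.
- by move=> r; apply: gclosed_ray.
Qed.

(** The levels below the surgery and, starting from the top, those above it meet
such a set in an even number of points.  The layer of the surgery joins the
points of the two adjacent levels in pairs, except at the corners. *)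
Lemma corner_parity W : (forall v, W v -> inP v.1) -> gclosed W ->
  (forall v, W v -> ~~ line_end D v) -> W pa (+) W pb = W pc (+) W pd.
Proof.
move=> WP Wc We.
have ps (lv lv' : 'I_h.+1) : lv' = lv.+1 :> nat ->
    level_parity W lv (+) level_parity W lv' =
    \xor_(z | z \in cups (layer D lv'))
     (W (z.1.1, lv) (+) W (z.1.2, lv) (+) (W (z.1.1, lv') (+) W (z.1.2, lv'))).
  move=> e; apply: (level_parity_step WP e) => r hr.
  by apply: Wc; apply: ray_gadj.
have cl m (lv : 'I_h.+1) z : in_layer m lv -> z \in cups (layer D m) ->
    (m = l.+1 -> z != site_cup) -> W (z.1.1, lv) = W (z.1.2, lv).
  by move=> h1 h2 h3; apply: Wc; exact: layer_gadj h1 h2 h3.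
have step (lv lv' : 'I_h.+1) : lv' = lv.+1 :> nat -> (lv' : nat) != l.+1 ->
    level_parity W lv (+) level_parity W lv' = false.
  move=> e n; rewrite ps //; apply: xor0 => z hz.
  have nz : (lv' : nat) = l.+1 -> z != site_cup by move=> e1; rewrite e1 eqxx in n.
  rewrite (cl lv' lv z) //; last by rewrite /in_layer e eqxx orbT.
  by rewrite (cl lv' lv' z) ?addbb // /in_layer eqxx.
have up m (hm : m < h.+1) : m <= l -> level_parity W (Ordinal hm) = false.
  elim: m hm => [|m IH] hm lm.
    have -> : Ordinal hm = ord0 by apply/val_inj.
    apply: (level_parity_bottom (D := D) WP) => [z hz|v Wv]; last exact: (proj1 (norP (We v Wv))).
    by apply: cl hz _ => //; rewrite /in_layer eqxx.
  have := step (Ordinal (ltnW hm)) (Ordinal hm) (erefl _).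
  rewrite IH /=; last exact: ltnW.
  by apply; rewrite neq_ltn ltnS lm.
have down k m (hm : m < h.+1) : m + k = h -> l < m -> level_parity W (Ordinal hm) = false.
  elim: k m hm => [|k IH] m hm e lm.
    have -> : Ordinal hm = ord_max by apply/val_inj; rewrite /= -e addn0.
    apply: (level_parity_top (D := D) WP) => [z hz|v Wv]; last exact: (proj2 (norP (We v Wv))).
    apply: cl hz _; first by rewrite /in_layer eqxx orbT.
    by case=> e1; move: (ltn_ord l); rewrite -e1 ltnn.
  have hm' : m.+1 < h.+1 by rewrite ltnS -e addnS ltnS leq_addr.
  have := step (Ordinal hm) (Ordinal hm') (erefl _).
  rewrite (IH _ hm') ?addbF; [|by rewrite addSnnS|exact: ltnW].
  by apply; rewrite /= eqSS neq_ltn lm orbT.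
have := ps lo hi (erefl _).
have -> : level_parity W lo = false.
  have hlo : l < h.+1 := ltnW (ltn_ord l).
  have -> : lo = Ordinal hlo by apply/val_inj.
  exact: up.
have -> : level_parity W hi = false.
  have hhi : l.+1 < h.+1 by rewrite ltnS.
  have -> : hi = Ordinal hhi by apply/val_inj.
  by apply: (down (h - l.+1)) => //; rewrite subnKC.
rewrite (bigD1 site_cup) ?site_cup_in //= xor0 ?addbF; last first.
  by move=> z /andP [hz nz]; have [-> ->] := gclosed_cup Wc hz nz; rewrite !addbb.
rewrite -/pa -/pb -/pc -/pd.
by case: (W pa); case: (W pb); case: (W pc); case: (W pd).
Qed.

(** Otherwise the component of the corner would contradict [corner_parity]. *)
Lemma lone_has_end x : x \in corners ->
  (forall y, y \in corners -> y != x -> ~~ connect gadj x y) ->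
  has_end (line_end D) gadj x.
Proof.
move=> hx Hx; apply: contraT => nend; pose W := connect gadj x.
have xP : inP x.1.
  by move: hx; rewrite !inE => /or4P [] /eqP -> //=; rewrite ?site_inP1 ?site_inP2.
have WP v : W v -> inP v.1 by apply: gcomp_inP.
have We v : W v -> ~~ line_end D v.
  move=> xv; apply/negP => ev; case/negP: nend; apply/existsP; exists v.
  by rewrite ev andbT.
have := corner_parity WP (@gclosed_gcomp x) We.
have Wy y : y \in corners -> W y = (y == x).
  move=> hy; case: eqVneq => [->|n]; first exact: connect0.
  exact/negbTE/Hx.
have [ia ib ic id] := corner_in; have [n1 n2 n3 n4 /andP [n5 n6]] := corners_neq.
rewrite !Wy //; move: hx; rewrite !inE => /or4P [] /eqP ->.
- by rewrite eqxx ![_ == pa]eq_sym (negPf n1) (negPf n2) (negPf n3).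
- by rewrite eqxx ![_ == pb]eq_sym [pb == pa]eq_sym (negPf n1) (negPf n4) (negPf n5).
- by rewrite eqxx (negPf n2) (negPf n4) [pd == pc]eq_sym (negPf n6).
- by rewrite eqxx (negPf n3) (negPf n5) (negPf n6).
Qed.

Lemma line_end_surgery : line_end D' =1 line_end D.
Proof.
move=> v; rewrite /line_end /bottom_end /top_end !surgery_layer //.
by rewrite eqSS neq_ltn ltn_ord orbT.
Qed.

Lemma bottom_end_surgery : bottom_end D' =1 bottom_end D.
Proof. by move=> v; rewrite /bottom_end surgery_layer. Qed.

Lemma top_end_surgery : top_end D' =1 top_end D.
Proof.
move=> v; rewrite /top_end surgery_layer //.
by rewrite eqSS neq_ltn ltn_ord orbT.
Qed.

Lemma same_before : same_comp D =2 connect (two_arcs gadj pa pb pc pd).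
Proof. by apply: eq_connect; exact: adj_before. Qed.

Lemma same_after : same_comp D' =2 connect (two_arcs gadj pa pc pb pd).
Proof. by apply: eq_connect; exact: adj_after. Qed.

Definition touched v := same_comp D pa v || same_comp D pc v.

Lemma touched_after v : touched v = same_comp D' pc v || same_comp D' pd v.
Proof.
rewrite /touched !same_before !same_after.
exact: (surgery_touch gadj_sym not_a_d not_b_c).
Qed.

Lemma untouched_same v w : ~~ touched v -> same_comp D v w = same_comp D' v w.
Proof.
rewrite /touched !same_before !same_after.
exact: (surgery_untouched gadj_sym not_a_d not_b_c).
Qed.

Lemma not_same_twice : same_comp D pa pc -> ~~ same_comp D' pc pd.
Proof.
rewrite !same_before !same_after.
exact: (surgery_not_both gadj_sym not_a_d not_b_c).
Qed.

Lemma on_line_before v : on_line D v = has_end (line_end D) (two_arcs gadj pa pb pc pd) v.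
Proof. by apply: eq_existsb => z; rewrite same_before. Qed.

Lemma on_line_after v : on_line D' v = has_end (line_end D) (two_arcs gadj pa pc pb pd) v.
Proof. by apply: eq_existsb => z; rewrite same_after -line_end_surgery. Qed.

Lemma merge_has_circle : ~~ same_comp D pa pc -> same_comp D' pc pd ->
  ~~ on_line D pa || ~~ on_line D pc.
Proof.
rewrite !same_before !same_after !on_line_before.
exact: (merge_no_end gadj_sym not_a_d not_b_c paired_no_end corners_uniq).
Qed.

Lemma split_has_circle : same_comp D pa pc -> ~~ same_comp D' pc pd ->
  ~~ on_line D' pc || ~~ on_line D' pd.
Proof.
rewrite !same_before !same_after !on_line_after.
exact: (split_no_end gadj_sym not_a_d not_b_c paired_no_end corners_uniq).
Qed.

Lemma reconnect_corner_end x : ~~ same_comp D pa pc -> ~~ same_comp D' pc pd ->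
  x \in corners -> has_end (line_end D) gadj x.
Proof.
rewrite !same_before !same_after.
exact: (reconnect_end gadj_sym not_a_d not_b_c lone_has_end).
Qed.

(** The counts to the right of j agree on the two levels by [right_parity_site],
so only the corrections remain. *)
Lemma right_val_cups S : (forall v, S v -> inP v.1) -> und_closed D S ->
  right_val S pb (+) right_val S pd = (S pb (+) S pd) && odd (pcount i).
Proof.
move=> SP Sc; rewrite /right_val /= right_parity_site //.
- rewrite site_pcount negbK; case: (right_parity _ _); case: (odd _);
  by case: (S pb); case: (S pd).
- move=> z hz dz lz; split; apply: Sc.
    have := @layer_cup_adj _ _ D l.+1 lo z; rewrite dz => -> //.
    by rewrite /in_layer val_lo eqxx orbT.
  have := @layer_cup_adj _ _ D l.+1 hi z; rewrite dz => -> //.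
  by rewrite /in_layer val_hi eqxx.
- move=> r hr; apply: Sc; apply/orP; right.
  exact: (@layer_ray_adj _ _ D lo hi r).
Qed.

(** The points between i and j cancel in pairs by [right_parity_site_cup], so
the counts at i and j differ by j itself. *)
Lemma right_val_rays S : (forall v, S v -> inP v.1) -> und_closed D' S ->
  right_val S pc (+) right_val S pd = (S pc (+) S pd) && ~~ odd (pcount i).
Proof.
move=> SP Sc; rewrite /right_val /= right_parity_site_cup //.
- rewrite site_pcount negbK; case: (right_parity _ _); case: (odd _);
  by case: (S pc); case: (S pd).
- move=> z _ hz dz; apply: Sc.
  have := @layer_cup_adj _ _ D' l.+1 hi z; rewrite dz => -> //.
  by rewrite /in_layer val_hi eqxx.
Qed.

Lemma site_cup_adj_lo : cup_adj D dot pa pb.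
Proof.
apply: (@layer_cup_adj _ _ D l.+1 lo site_cup); last exact: site_cup_in.
by rewrite /in_layer val_lo eqxx orbT.
Qed.

Lemma site_cup_adj_hi : cup_adj D dot pc pd.
Proof.
apply: (@layer_cup_adj _ _ D l.+1 hi site_cup); last exact: site_cup_in.
by rewrite /in_layer val_hi eqxx.
Qed.

Lemma site_ray_adj1 : ray_adj D' pa pc.
Proof. exact: (@layer_ray_adj _ _ D' lo hi (i, false)) ray_site1. Qed.

Lemma site_ray_adj2 : ray_adj D' pb pd.
Proof. exact: (@layer_ray_adj _ _ D' lo hi (j, false)) ray_site2. Qed.

Lemma orientation_before nu : is_orientation D' nu ->
  vee nu pa (+) vee nu pb = ~~ dot -> is_orientation D nu.
Proof.
move=> /orientationP [H1 H2 H3 H4] Hab.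
apply/orientationP; split; last 2 first.
- by move=> r hr; apply: H3; rewrite surgery_layer.
- by move=> r hr; apply: H4; rewrite surgery_layer // eqSS neq_ltn ltn_ord orbT.
- move=> d v w /cup_adjP [m [lv [x [ml hm hx dx e]]]].
  suff H : vee nu (x.1.1, lv) (+) vee nu (x.1.2, lv) = ~~ d.
    by case: e => -[-> ->] //; rewrite addbC.
  case: (boolP ((m == l.+1) && (x == site_cup))) => [/andP [/eqP em /eqP ex]|n].
    rewrite -dx ex /=; move: ml; rewrite em /in_layer => /orP [] /eqP e1.
      have -> : lv = hi by apply/val_inj.
      by rewrite -[(i, hi)]/pc -(H2 _ _ site_ray_adj1) -[(j, hi)]/pd -(H2 _ _ site_ray_adj2).
    have -> : lv = lo by apply/val_inj; case: e1.
    exact: Hab.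
  apply: H1; rewrite -dx; apply: (layer_cup_adj ml).
  case: (eqVneq m l.+1) n => [em|nm] n; last by rewrite surgery_layer.
  by rewrite em surgery_cups in_setD1 -em hx andbT.
- move=> v w /ray_adjP [lv [lv' [r [e hr e']]]].
  suff H : vee nu (r.1, lv) = vee nu (r.1, lv') by case: e' => -[-> ->].
  apply: H2; apply: layer_ray_adj => //.
  case: (eqVneq (lv' : nat) l.+1) => [em|nm]; last by rewrite surgery_layer // ltnW.
  by rewrite em surgery_rays !in_setU1 -em hr !orbT.
Qed.

Lemma orientation_after nu : is_orientation D nu ->
  vee nu pa = vee nu pc -> is_orientation D' nu.
Proof.
move=> /orientationP [H1 H2 H3 H4] Hac.
apply/orientationP; split; last 2 first.
- by move=> r; rewrite surgery_layer //; exact: H3.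
- by move=> r; rewrite surgery_layer //; [exact: H4|rewrite eqSS neq_ltn ltn_ord orbT].
- move=> d v w /cup_adjP [m [lv [x [ml hm hx dx e]]]].
  suff H : vee nu (x.1.1, lv) (+) vee nu (x.1.2, lv) = ~~ d.
    by case: e => -[-> ->] //; rewrite addbC.
  apply: H1; rewrite -dx; apply: (layer_cup_adj ml).
  case: (eqVneq m l.+1) hx => [->|nm]; last by rewrite surgery_layer.
  by case/in_surgery_cups.
- move=> v w /ray_adjP [lv [lv' [r [e hr e']]]].
  suff H : vee nu (r.1, lv) = vee nu (r.1, lv') by case: e' => -[-> ->].
  case: (eqVneq (lv' : nat) l.+1) hr => [em|nm]; last first.
    by rewrite surgery_layer ?(ltnW (ltn_ord lv')) // => hr; apply: H2; apply: layer_ray_adj.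
  have elv' : lv' = hi by apply/val_inj.
  have elv : lv = lo by apply/val_inj => /=; move: e; rewrite em => -[].
  rewrite em surgery_rays !in_setU1 => /or3P [/eqP ->|/eqP ->|hr].
  + by rewrite elv elv'.
  + rewrite elv elv' /=; have := H1 _ _ _ site_cup_adj_lo; have := H1 _ _ _ site_cup_adj_hi.
    rewrite -[(j, lo)]/pb -[(j, hi)]/pd Hac.
    by case: (vee nu pc); case: (vee nu pb); case: (vee nu pd); case: (dot).
  + by apply: H2; apply: layer_ray_adj => //; rewrite em.
Qed.
End SurgeryAt.

(** * Orientations before and after a surgery *)
Lemma flip_comp (B : block) h (D : stacked B h) (o : orientation D) v (b : bool) :
  inP v.1 -> ~~ on_line D v ->
  exists mu : orientation D, forall u, inP u.1 ->
    vee (val mu) u = vee (val o) u (+) (b && same_comp D v u).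
Proof.
move=> vP nl; apply: (flip_orientation o) => [u /andP [_ vu]|u u' uu|u /andP [_ vu]].
- by rewrite -(same_comp_inP vu).
- by rewrite ![same_comp D v _]same_comp_sym (same_comp_eq v (connect1 uu)).
- by apply: contra nl => eu; apply/existsP; exists u; rewrite vu.
Qed.

Section Transfer.
Variables (B : block) (h : nat) (D D' : stacked B h) (s : surgery_site B h).
Hypothesis Hs : surgery_at D D' s.
Local Notation vertex := (vertex B h).
Local Notation i := s.1.1.2.
Local Notation j := s.1.2.
Local Notation dot := s.2.
Local Notation pa := (ilo s).
Local Notation pb := (jlo s).
Local Notation pc := (ihi s).
Local Notation pd := (jhi s).
Local Notation touched := (touched D s).
Local Notation gadj := (gadj D s).
Implicit Types (v w u : vertex).

Lemma same_a_b : same_comp D pa pb.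
Proof. by apply: connect1; exact: cup_adj_adj (site_cup_adj_lo Hs). Qed.
Lemma same_c_d : same_comp D pc pd.
Proof. by apply: connect1; exact: cup_adj_adj (site_cup_adj_hi Hs). Qed.
Lemma same_a_c' : same_comp D' pa pc.
Proof. by apply: connect1; exact: ray_adj_adj (site_ray_adj1 Hs). Qed.
Lemma same_b_d' : same_comp D' pb pd.
Proof. by apply: connect1; exact: ray_adj_adj (site_ray_adj2 Hs). Qed.

Lemma gadj_after v w : gadj v w -> adj D' v w.
Proof. by rewrite (adj_after Hs) /two_arcs => ->. Qed.

Lemma surgery_cups_sub m x : m <= h.+1 -> x \in cups (layer D' m) -> x \in cups (layer D m).
Proof.
move=> hm; case: (eqVneq m (s.1.1.1).+1) => [->|n]; last by rewrite (surgery_layer Hs).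
by case/(in_surgery_cups Hs).
Qed.

Lemma surgery_rays_sub m r : m <= h.+1 -> r \in rays (layer D m) -> r \in rays (layer D' m).
Proof.
move=> hm; case: (eqVneq m (s.1.1.1).+1) => [->|n]; last by rewrite (surgery_layer Hs).
by rewrite (surgery_rays Hs) !in_setU1 => ->; rewrite !orbT.
Qed.

Lemma gadj_kind v w : gadj v w ->
  (exists d, cup_adj D d v w /\ cup_adj D' d v w) \/ (ray_adj D v w /\ ray_adj D' v w).
Proof.
move=> vw; case: (eqVneq v.2 w.2) => e; [left|right].
  case: (adjP (gadj_after vw)) => [m lv x ml hm hx ex|lv lv' r e1 hr ex]; last first.
    by case: ex e => -[-> ->] /= e; move/eqP: e1; rewrite e (ltn_eqF (ltnSn _)).
  exists x.2; have c1 := layer_cup_adj ml hx.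
  have c2 := layer_cup_adj ml (surgery_cups_sub hm hx).
  have cs (E : stacked B h) d u u' : cup_adj E d u u' -> cup_adj E d u' u.
    rewrite /cup_adj eq_sym => /andP [/eqP -> ]; rewrite eqxx /= /joins.
    by rewrite ![((u.1, _, _) \in _) || _]orbC.
  by case: ex => -[-> ->]; split=> //; apply: cs.
case: (adjP (gadj_adj vw)) => [m lv x ml hm hx ex|lv lv' r e1 hr ex].
  by case: ex e => -[-> ->]; rewrite eqxx.
have rs (E : stacked B h) u u' : ray_adj E u u' -> ray_adj E u' u.
  by rewrite /ray_adj eq_sym => /andP [/eqP -> ]; rewrite eqxx /= orbC.
have r1 := layer_ray_adj e1 hr.
have r2 := layer_ray_adj e1 (surgery_rays_sub (ltnW (ltn_ord lv')) hr).
by case: ex => -[-> ->]; split=> //; apply: rs.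
Qed.

Lemma gadj_ratio (nu : orientation D) (nu' : orientation D') v w : gadj v w ->
  vee (val nu) v (+) vee (val nu') v = vee (val nu) w (+) vee (val nu') w.
Proof.
case/gadj_kind => [[d [h1 h2]]|[h1 h2]].
  have := orientation_cup nu h1; have := orientation_cup nu' h2.
  by do 4!case: (vee _ _); case: d {h1 h2}.
by rewrite (orientation_ray nu h1) (orientation_ray nu' h2).
Qed.

Lemma gconnect_ratio (nu : orientation D) (nu' : orientation D') v w : connect gadj v w ->
  vee (val nu) v (+) vee (val nu') v = vee (val nu) w (+) vee (val nu') w.
Proof.
apply: (closed_connect (a := fun v => vee (val nu) v (+) vee (val nu') v)) => x y.
exact: gadj_ratio.
Qed.

(** One of the two components is a circle, which can be reversed if the labels
at the new rays differ. *)
Lemma merge_orientation (nu : orientation D) : ~~ same_comp D pa pc -> same_comp D' pc pd ->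
  exists mu : orientation D, is_orientation D' (val mu).
Proof.
move=> ac cd; have aP : inP pa.1 := site_inP1 Hs; have cP : inP pc.1 := site_inP1 Hs.
suff [mu Hmu] : exists mu : orientation D, vee (val mu) pa = vee (val mu) pc.
  by exists mu; apply: (orientation_after Hs (valP mu)).
pose b := vee (val nu) pa (+) vee (val nu) pc.
case/orP: (merge_has_circle Hs ac cd) => nl; [have [mu Hmu] := flip_comp nu b aP nl|
  have [mu Hmu] := flip_comp nu b cP nl]; exists mu; rewrite !Hmu // same_comp_refl.
  by rewrite (negPf ac) andbF /b; do 2!case: (vee _ _).
by rewrite same_comp_sym (negPf ac) andbF /b; do 2!case: (vee _ _).
Qed.

(** The left and right corners lie on one component after the merge, so the
ratio of their labels is that of the orientation of both diagrams given by
[merge_orientation]. *)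
Lemma merge_before (nu : orientation D) (nu' : orientation D') : ~~ same_comp D pa pc -> same_comp D' pc pd ->
  is_orientation D (val nu').
Proof.
move=> ac cd; have [mu Hmu] := merge_orientation nu ac cd.
apply: (orientation_before Hs (valP nu')).
have ab : same_comp D' pa pb.
  apply: same_comp_trans same_a_c' _; apply: same_comp_trans cd _.
  by rewrite same_comp_sym same_b_d'.
have := vee_ratio nu' (exist (is_orientation D') _ Hmu : orientation D') ab.
have := orientation_cup mu (site_cup_adj_lo Hs); rewrite /=.
by do 4!case: (vee _ _).
Qed.

(** Reversing a circle that is split off gives an orientation that satisfies the
condition at the removed cup, hence orients D too.  Since the left corners lie
on one component of D, the ratio of their labels is then 1 in all orientations.
*)
Lemma split_after (nu' : orientation D') (nu : orientation D) : same_comp D pa pc -> ~~ same_comp D' pc pd ->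
  is_orientation D' (val nu).
Proof.
move=> ac cd; have cP : inP pc.1 := site_inP1 Hs; have dP : inP pd.1 := site_inP2 Hs.
have [mu' Hmu] : exists mu' : orientation D', vee (val mu') pc (+) vee (val mu') pd = ~~ dot.
  pose b := vee (val nu') pc (+) vee (val nu') pd (+) ~~ dot.
  case/orP: (split_has_circle Hs ac cd) => nl; [have [mu Hmu] := flip_comp nu' b cP nl|
    have [mu Hmu] := flip_comp nu' b dP nl]; exists mu; rewrite !Hmu // same_comp_refl.
    by rewrite (negPf cd) andbF /b; do 2!case: (vee _ _); case: (dot).
  by rewrite same_comp_sym (negPf cd) andbF /b; do 2!case: (vee _ _); case: (dot).
have r1 := orientation_ray mu' (site_ray_adj1 Hs).
have r2 := orientation_ray mu' (site_ray_adj2 Hs).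
have Hmu2 : is_orientation D (val mu').
  by apply: (orientation_before Hs (valP mu')); rewrite r1 r2.
apply: (orientation_after Hs (valP nu)).
have := vee_ratio nu (exist (is_orientation D) _ Hmu2 : orientation D) ac.
by rewrite /= r1; do 3!case: (vee _ _).
Qed.

(** In a reconnection the common part joins each corner to the boundary, where
labels are prescribed. *)
Lemma reconnect_ratio (nu : orientation D) (nu' : orientation D') x : ~~ same_comp D pa pc -> ~~ same_comp D' pc pd ->
  x \in [:: pa; pb; pc; pd] -> vee (val nu) x = vee (val nu') x.
Proof.
move=> ac cd hx; have /existsP [z /andP [xz ez]] := reconnect_corner_end Hs ac cd hx.
have := gconnect_ratio nu nu' xz.
rewrite (vee_end nu nu' (esym (surgery_lower Hs)) (esym (surgery_upper Hs)) ez) addbb.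
by do 2!case: (vee _ _).
Qed.

Lemma reconnect_after (nu' : orientation D') (nu : orientation D) : ~~ same_comp D pa pc -> ~~ same_comp D' pc pd ->
  is_orientation D' (val nu).
Proof.
move=> ac cd; have [ia ib ic id] := corner_in s.
apply: (orientation_after Hs (valP nu)).
by rewrite !(reconnect_ratio nu nu' ac cd) // (orientation_ray nu' (site_ray_adj1 Hs)).
Qed.

Lemma reconnect_before (nu : orientation D) (nu' : orientation D') : ~~ same_comp D pa pc -> ~~ same_comp D' pc pd ->
  is_orientation D (val nu').
Proof.
move=> ac cd; have [ia ib ic id] := corner_in s.
apply: (orientation_before Hs (valP nu')).
rewrite -!(reconnect_ratio nu nu' ac cd) //.
exact: orientation_cup (site_cup_adj_lo Hs).
Qed.

Lemma touched_comp v w : same_comp D v w -> touched v = touched w.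
Proof.
move=> vw; rewrite /touched ![same_comp D _ v]same_comp_sym ![same_comp D _ w]same_comp_sym.
by rewrite !(same_comp_eq _ vw).
Qed.

Lemma touched_comp' v w : same_comp D' v w -> touched v = touched w.
Proof.
move=> vw; rewrite !(touched_after Hs) ![same_comp D' _ v]same_comp_sym ![same_comp D' _ w]same_comp_sym.
by rewrite !(same_comp_eq _ vw).
Qed.

Lemma touched_c : touched pc.
Proof. by rewrite /touched same_comp_refl orbT. Qed.
Lemma touched_a : touched pa.
Proof. by rewrite /touched same_comp_refl. Qed.
Lemma touched_d : touched pd.
Proof. by rewrite -(touched_comp same_c_d) touched_c. Qed.
Lemma touched_b : touched pb.
Proof. by rewrite -(touched_comp same_a_b) touched_a. Qed.

Lemma on_line_untouched v : ~~ touched v -> on_line D v = on_line D' v.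
Proof.
move=> nt; apply: eq_existsb => z.
by rewrite (untouched_same Hs z nt); congr (_ && _); apply/esym/(line_end_surgery Hs).
Qed.

Lemma rightmost_untouched v : ~~ touched v -> rightmost D v =1 rightmost D' v.
Proof.
move=> nt u; rewrite /rightmost (untouched_same Hs u nt); congr (_ && _).
by apply: eq_forallb => x; rewrite (untouched_same Hs x nt).
Qed.

Lemma untouched_ratio (nu : orientation D) (nu' : orientation D') v w : ~~ touched v -> same_comp D v w ->
  vee (val nu) v (+) vee (val nu') v = vee (val nu) w (+) vee (val nu') w.
Proof.
move=> nt vw; pose f u := vee (val nu) u (+) vee (val nu') u.
have cl : closed (adj D) (fun u => ~~ touched u && (f u == f v)).
  move=> x y xy; rewrite /in_mem /= (touched_comp (connect1 xy)).
  case ty: (touched y) => //=; suff -> : f x = f y by [].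
  apply: gadj_ratio; move: (xy); rewrite (adj_before Hs) => /or3P [//| |].
    case/orP => /andP [_ /eqP ey]; by rewrite ey ?touched_a ?touched_b in ty.
  case/orP => /andP [_ /eqP ey]; by rewrite ey ?touched_c ?touched_d in ty.
have := closed_connect cl vw; rewrite /in_mem /= nt eqxx /= => /esym /andP [_ /eqP e].
exact: esym e.
Qed.

Lemma untouched_line (nu : orientation D) (nu' : orientation D') v : ~~ touched v -> on_line D v -> vee (val nu) v = vee (val nu') v.
Proof.
move=> nt /existsP [z /andP [vz ez]]; have := untouched_ratio nu nu' nt vz.
rewrite (vee_end nu nu' (esym (surgery_lower Hs)) (esym (surgery_upper Hs)) ez) addbb.
by do 2!case: (vee _ _).
Qed.

Lemma untouched_clockwise (nu : orientation D) (nu' : orientation D') v : inP v.1 -> ~~ touched v -> ~~ on_line D v ->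
  clockwise nu v (+) clockwise nu' v = vee (val nu) v (+) vee (val nu') v.
Proof.
move=> vP nt nl; have [w rw] := rightmost_ex D v.
rewrite (clockwise_rightmost nu vP nl rw) (clockwise_rightmost nu' vP _ (w := w)); last 2 first.
- by rewrite -on_line_untouched.
- by rewrite -rightmost_untouched.
by apply/esym/(untouched_ratio _ _ nt); case/andP: rw.
Qed.

Lemma label_notin (t t' : h.+1.-tuple (weight B)) v : ~~ inP v.1 -> label t v = label t' v.
Proof.
rewrite /label; case: v => k l /=.
move: (valP (tnth t l)) (valP (tnth t' l)) => /andP [/forallP /(_ k) + _] /andP [/forallP /(_ k) + _].
by rewrite /inP; case: (bdiag B k) => //= /eqP -> /eqP ->.
Qed.

Lemma clockwise_out E (nu : orientation E) v : ~~ (inP v.1 && ~~ on_line E v) ->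
  @clockwise B h E nu v = false.
Proof. by move=> H; apply: contraNF H => /clockwise_inP [-> ->]. Qed.

(** Untouched lines have the same labels in all orientations, so the condition
on labels is one on the directions of circles. *)
Lemma keeps_othersP (nu : orientation D) (nu' : orientation D') : keeps_others s nu nu' <->
  (forall v, ~~ touched v -> clockwise nu v = clockwise nu' v).
Proof.
split=> [/forallP H v nt|H].
  case vP: (inP v.1 && ~~ on_line D v); last first.
    rewrite !clockwise_out ?vP //; move: vP; rewrite -on_line_untouched // => ->.
    by [].
  have [v1 v2] := andP vP; have := untouched_clockwise nu nu' v1 nt v2.
  have := H v; rewrite orbA -/(touched v) (negPf nt) /= label_vee //.
  by do 2!case: (vee _ _); do 2!case: (clockwise _ _).
apply/forallP => v; rewrite orbA -/(touched v); case nt: (touched v) => //=.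
case vP: (inP v.1); last by rewrite (label_notin (val nu') (val nu)) ?vP.
rewrite label_vee //; case ol: (on_line D v).
  by rewrite (untouched_line nu nu') ?nt // addbb.
have := untouched_clockwise nu nu' vP (negbT nt) (negbT ol); rewrite H ?nt // addbb.
by do 2!case: (vee _ _).
Qed.
End Transfer.

(** * Words of clockwise circles *)
Import GRing.Theory.
Local Open Scope ring_scope.

Lemma surgery_site_unique (B : block) h (D D' : stacked B h) (s s' : surgery_site B h) :
  surgery_at D D' s -> surgery_at D D' s' -> s = s'.
Proof.
move=> H H'; have e := surgery_cups H; have e' := surgery_cups H'.
case: (eqVneq (s.1.1.1) (s'.1.1.1)) => [el|nl]; last first.
  have := surgery_layer H' (m := (s.1.1.1).+1); rewrite eqSS val_eqE nl => /(_ isT (leqW (ltn_ord _))) e2.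
  have := site_cup_in H; rewrite -e2 e in_setD1 eqxx.
  by [].
have c1 := site_cup_in H; have c2 := site_cup_in H'.
have : site_cup s = site_cup s'.
  apply/eqP; apply: contraT => n.
  have : site_cup s \in cups (layer D' (s'.1.1.1).+1) by rewrite e' in_setD1 n -el.
  by rewrite -el e in_setD1 eqxx.
rewrite /site_cup; case: (s) (s') el => [[[l i] j] d] [[[l' i'] j'] d'] /= -> [-> -> ->].
by [].
Qed.

Section Words.
Variables (R : realType) (B : block) (h : nat).
Local Notation C := R[i].
Local Notation vertex := (vertex B h).
Implicit Types (D : stacked B h) (u v : vertex) (w : seq vertex).

Definition vee_sign (t : h.+1.-tuple (weight B)) v : C := (-1) ^+ (~~ vee t v).

Lemma vee_sign_sq t v : vee_sign t v * vee_sign t v = 1.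
Proof. by rewrite /vee_sign; case: (vee t v); rewrite ?expr0 ?expr1 ?mulrNN mulr1. Qed.

Lemma vee_sign_ratio t t' u v : vee t u (+) vee t' u = vee t v (+) vee t' v ->
  vee_sign t u * vee_sign t' u = vee_sign t v * vee_sign t' v.
Proof.
by rewrite /vee_sign; do 4!case: (vee _ _) => //=; rewrite ?expr0 ?expr1 ?mulrNN ?mulr1 ?mul1r.
Qed.

Lemma sign_vsgn D (nu : orientation D) v : clockwise nu v -> sign R D v = vee_sign (val nu) v.
Proof. by move=> cv; rewrite /sign (sign_clockwise cv). Qed.

Definition separated D w := pairwise (fun u v => ~~ same_comp D u v) w.
Definition on_circles D w := all (fun v => inP v.1 && ~~ on_line D v) w.
Definition fits D (nu : orientation D) w := [forall u, clockwise nu u == has (same_comp D u) w].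

(** Repeated components and letters on lines give 0, so the letters behave like
commuting variables of square zero, with the sign of a letter depending on its
place on the circle. *)
Definition word D w : Dspace R D :=
  [ffun nu => if separated D w && fits nu w then \prod_(v <- w) vee_sign (val nu) v else 0].

Lemma fitsP D (nu : orientation D) w u : fits nu w -> clockwise nu u = has (same_comp D u) w.
Proof. by move=> /forallP /(_ u) /eqP. Qed.

Lemma fits_in D (nu : orientation D) w v : fits nu w -> v \in w -> clockwise nu v.
Proof.
by move=> f vw; rewrite (fitsP _ f); apply/hasP; exists v => //; exact: same_comp_refl.
Qed.

Lemma fits_on_circles D (nu : orientation D) w : fits nu w -> on_circles D w.
Proof. by move=> f; apply/allP => v /(fits_in f) /clockwise_inP [-> ->]. Qed.

(** Directions of circles can be prescribed by [orientation_ex]. *)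
Lemma fits_ex D (o : orientation D) w : on_circles D w -> exists mu : orientation D, fits mu w.
Proof.
move=> gw; have [mu Hmu] := orientation_ex (f := fun v => has (same_comp D v) w) o
  (fun u v uv => eq_has (fun x => same_comp_eq x uv) w).
exists mu; apply/forallP => u; apply/eqP.
case gu: (inP u.1 && ~~ on_line D u); first by case/andP: gu => u1 u2; rewrite Hmu.
rewrite clockwise_out ?gu //; apply/esym/negbTE/hasP => -[v vw uv].
by have := allP gw v vw; rewrite -(same_comp_inP uv) -(on_line_comp uv) gu.
Qed.

Lemma fits_unique D (mu nu : orientation D) w : fits mu w -> fits nu w -> mu = nu.
Proof. by move=> f g; apply: orientation_eq => v; rewrite (fitsP _ f) (fitsP _ g). Qed.

Lemma separated_in D w u v : separated D w -> u \in w -> v \in w -> same_comp D u v -> u = v.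
Proof.
rewrite /separated => sw uw vw uv; apply/eqP; apply: contraT => n.
have : index u w != index v w by apply: contra n => /eqP e; rewrite -(nth_index u uw) e (nth_index u vw).
have H x y : (index x w < index y w)%N -> y \in w -> ~~ same_comp D x y.
  move=> lt yw; have xw : x \in w by rewrite -index_mem (ltn_trans lt) // index_mem.
  have /(pairwiseP x) /(_ (index x w) (index y w)) := sw.
  by rewrite !inE !index_mem => /(_ xw yw lt); rewrite !nth_index.
rewrite neq_ltn => /orP [] lt.
  by have := H _ _ lt vw; rewrite uv.
by have := H _ _ lt uw; rewrite same_comp_sym uv.
Qed.

Lemma separated_sub D D' w : {in w &, forall u v, same_comp D' u v -> same_comp D u v} ->
  separated D w -> separated D' w.
Proof.
move=> H; rewrite /separated; elim: w H => //= u w IH H /andP [/allP h1 h2]; apply/andP; split.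
  apply/allP => v vw; apply: contra (h1 v vw); apply: H; rewrite inE ?eqxx ?vw ?orbT //.
by apply: IH => // x y xw yw; apply: H; rewrite inE ?xw ?yw orbT.
Qed.

Lemma separated_count D w v : separated D w -> count (same_comp D v) w = has (same_comp D v) w.
Proof.
rewrite /separated; elim: w => //= u w IH /andP [/allP h1 h2]; rewrite IH //.
case vu: (same_comp D v u) => //=; rewrite (_ : has _ _ = false) //.
apply/negbTE/hasP => -[x xw vx]; have := h1 x xw; rewrite -(same_comp_eq x vu) vx.
by [].
Qed.

Lemma prod_one (P : pred vertex) (F G : vertex -> C) k w : count P w = 1%N ->
  {in w, forall v, P v -> F v = k * G v} -> {in w, forall v, ~~ P v -> F v = G v} ->
  \prod_(v <- w) F v = k * \prod_(v <- w) G v.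
Proof.
elim: w => //= u w IH; rewrite !big_cons; case Pu: (P u) => /= cw H1 H2.
  rewrite H1 ?mem_head // mulrA; congr (_ * _); apply: eq_big_seq => v vw.
  apply: H2; first by rewrite inE vw orbT.
  apply/negP => Pv; have : has P w by apply/hasP; exists v.
  by rewrite has_count; case: (count P w) cw.
rewrite H2 ?mem_head ?Pu // IH ?mulrA 1?[G u * k]mulrC // => v vw.
  by apply: H1; rewrite inE vw orbT.
by apply: H2; rewrite inE vw orbT.
Qed.

Lemma word_zero D w : ~~ (separated D w && on_circles D w) -> word D w = 0.
Proof.
move=> n; apply/ffunP => nu; rewrite !ffunE; case: ifP => // /andP [s f].
by rewrite s (fits_on_circles f) in n.
Qed.

Section Surgery.
Variables (D D' : stacked B h) (s : surgery_site B h).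
Hypothesis Hs : surgery_at D D' s.
Local Notation i := s.1.1.2.
Local Notation j := s.1.2.
Local Notation dot := s.2.
Local Notation pa := (ilo s).
Local Notation pb := (jlo s).
Local Notation pc := (ihi s).
Local Notation pd := (jhi s).
Local Notation touched := (touched D s).

Lemma surg_coefE (nu : orientation D) (nu' : orientation D') :
  surg_coef R nu nu' = surg_coef_at R s nu nu'.
Proof.
rewrite /surg_coef; case: pickP => [s' H'|H]; last by have := H s; rewrite Hs.
by rewrite (surgery_site_unique H' Hs).
Qed.

Lemma surg_word w (mu : orientation D) (nu' : orientation D') : separated D w -> fits mu w ->
  surg R D D' (word D w) nu' = \prod_(v <- w) vee_sign (val mu) v * surg_coef_at R s mu nu'.
Proof.
move=> sw f; rewrite ffunE (bigD1 mu) //= big1 ?addr0 => [|nu n]; rewrite ffunE.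
  by rewrite sw f surg_coefE.
case: ifP => [/andP [_ g]|_]; last by rewrite mul0r.
by rewrite (fits_unique g f) eqxx in n.
Qed.

Lemma surg0 : surg R D D' 0 = 0.
Proof. by apply/ffunP => nu'; rewrite !ffunE big1 // => nu _; rewrite ffunE mul0r. Qed.

Lemma has_untouched u w : ~~ touched u -> has (same_comp D' u) w = has (same_comp D u) w.
Proof. by move=> nt; apply: eq_has => x; rewrite (untouched_same Hs x nt). Qed.

Lemma keeps_fits (mu : orientation D) (nu' : orientation D') w : fits mu w ->
  keeps_others s mu nu' <-> forall u, ~~ touched u -> clockwise nu' u = has (same_comp D' u) w.
Proof.
move=> f; rewrite (keeps_othersP Hs); split=> H u nt; have := H u nt;
by rewrite (fitsP _ f) (has_untouched _ nt).
Qed.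

Lemma fits_after (mu : orientation D) (nu' : orientation D') w w' : fits mu w ->
  (forall u, ~~ touched u -> has (same_comp D' u) w' = has (same_comp D' u) w) ->
  fits nu' w' = [&& keeps_others s mu nu', clockwise nu' pc == has (same_comp D' pc) w'
                  & clockwise nu' pd == has (same_comp D' pd) w'].
Proof.
move=> f H; apply/forallP/and3P => [g|[k /eqP gc /eqP gd] u].
  split=> //; apply/(keeps_fits nu' f) => u nt.
  by rewrite (eqP (g u)) H.
case tu: (touched u); last first.
  by apply/eqP; rewrite H ?tu //; apply: ((keeps_fits nu' f).1 k); rewrite tu.
move: tu; rewrite (touched_after Hs) => /orP [] cu.
  by rewrite -(clockwise_comp nu' cu) gc (eq_has (fun x => same_comp_eq x cu)).
by rewrite -(clockwise_comp nu' cu) gd (eq_has (fun x => same_comp_eq x cu)).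
Qed.

Lemma keeps_vsgn (mu : orientation D) (nu' : orientation D') w v : fits mu w ->
  keeps_others s mu nu' -> v \in w -> ~~ touched v -> vee_sign (val nu') v = vee_sign (val mu) v.
Proof.
move=> f k vw nt; have cv := fits_in f vw; have [vP nl] := clockwise_inP cv.
have := untouched_clockwise Hs mu nu' vP nt nl.
rewrite ((keeps_othersP Hs mu nu').1 k) // addbb /vee_sign.
by do 2!case: (vee _ _).
Qed.

Lemma word_keeps (mu : orientation D) (nu' : orientation D') w : fits mu w ->
  keeps_others s mu nu' -> ~~ has touched w ->
  \prod_(v <- w) vee_sign (val nu') v = \prod_(v <- w) vee_sign (val mu) v.
Proof.
move=> f k nt; apply: eq_big_seq => v vw; apply: (keeps_vsgn f k vw).
by apply: contra nt => tv; apply/hasP; exists v.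
Qed.

Lemma touched_has w : has touched w = has (same_comp D pa) w || has (same_comp D pc) w.
Proof. by rewrite -has_predU; apply: eq_has. Qed.

Lemma touched_has' w : has touched w = has (same_comp D' pc) w || has (same_comp D' pd) w.
Proof. by rewrite -has_predU; apply: eq_has => x; exact: touched_after. Qed.

(** The factor [sign_D sign_D'] is the ratio of the labels of a letter before
and after, which the two words contain as well.  If both components carry a
letter, the merged one carries two and the word is 0. *)
Lemma surg_merge w : orientation D -> ~~ same_comp D pa pc -> same_comp D' pc pd ->
  surg R D D' (word D w) = word D' w.
Proof.
move=> o ac cd.
have sub u v : same_comp D u v -> same_comp D' u v.
  move=> uv; case tu: (touched u); last by rewrite -(untouched_same Hs) ?tu.
  have tt x : touched x -> same_comp D' pc x.
    by rewrite (touched_after Hs) => /orP [//|]; exact: same_comp_trans.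
  apply: same_comp_trans (tt v _); last by rewrite -(touched_comp _ uv).
  by rewrite same_comp_sym tt.
have sep : separated D' w -> separated D w by apply: separated_sub => u v _ _; exact: sub.
have [/andP [sw gw]|bad] := boolP (separated D w && on_circles D w); last first.
  rewrite (word_zero bad) surg0 word_zero //; apply: contra bad => /andP [sw gw].
  rewrite sep //=; apply/allP => v vw; have /andP [-> nl] := allP gw v vw.
  apply: contra nl => /existsP [z /andP [vz ez]]; apply/existsP; exists z.
  by rewrite (sub _ _ vz) -/(line_end D' z) (line_end_surgery Hs).
have [mu f] := fits_ex o gw; apply/ffunP => nu'.
have io : is_orientation D (val nu') := merge_before Hs o nu' ac cd.
pose nu : orientation D := exist (is_orientation D) _ io.
rewrite (surg_word nu' sw f) /surg_coef_at /is_merge ac cd /= ffunE.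
have ea := fitsP pa f; have ec := fitsP pc f.
rewrite (fits_after nu' f) // -(clockwise_comp nu' cd).
have -> : has (same_comp D' pd) w = has (same_comp D' pc) w.
  by apply: eq_has => x; rewrite (same_comp_eq x cd).
have e1 : has (same_comp D' pc) w = clockwise mu pa || clockwise mu pc.
  rewrite ea ec -touched_has touched_has'.
  by rewrite (eq_has (fun x => same_comp_eq x cd) w) orbb.
rewrite e1 andbb.
case k: (keeps_others s mu nu'); last by rewrite andbF mul0r mulr0.
rewrite mul1r andTb /merge_coef.
have both : clockwise mu pa && clockwise mu pc -> separated D' w = false.
  rewrite ea ec => /andP [/hasP [u uw au] /hasP [v vw cv]]; apply/negP => sw'.
  have uv : same_comp D' u v.
    apply: (same_comp_trans (v := pc)).
      rewrite same_comp_sym; apply: same_comp_trans (sub _ _ au).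
      by rewrite same_comp_sym; exact: same_a_c' Hs.
    exact: sub.
  case/negP: ac; apply: same_comp_trans au _.
  by rewrite (separated_in sw' uw vw uv) same_comp_sym.
have nboth : ~~ (clockwise mu pa && clockwise mu pc) -> separated D' w.
  move=> nb; apply: separated_sub sw => u v uw vw uv'.
  case tu: (touched u); last by rewrite (untouched_same Hs) ?tu.
  have tv : touched v by rewrite -(touched_comp' Hs uv').
  move: tu tv => /orP [] hu /orP [] hv.
  - by apply: same_comp_trans hv; rewrite same_comp_sym.
  - case/negP: nb; rewrite ea ec; apply/andP; split; apply/hasP; [by exists u|by exists v].
  - case/negP: nb; rewrite ea ec; apply/andP; split; apply/hasP; [by exists v|by exists u].
  - by apply: same_comp_trans hv; rewrite same_comp_sym.
have cac : clockwise nu' pa = clockwise nu' pc := clockwise_comp nu' (same_a_c' Hs).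
have one p : clockwise mu p -> (forall x, touched x -> x \in w -> same_comp D p x) ->
    (forall x, same_comp D p x -> touched x) ->
    \prod_(v <- w) vee_sign (val nu') v = (vee_sign (val mu) p * vee_sign (val nu') p) * \prod_(v <- w) vee_sign (val mu) v.
  move=> cp tp pt; apply: (prod_one (P := same_comp D p)).
  - by rewrite separated_count // -(fitsP _ f) cp.
  - move=> v vw pv; rewrite (vee_sign_ratio (v := v)); last exact: (vee_ratio mu nu pv).
    by rewrite mulrAC vee_sign_sq mul1r.
  - by move=> v vw np; apply: (keeps_vsgn f k vw); apply: contra np => tv; apply: tp.
have ntouch : ~~ clockwise mu pa -> ~~ clockwise mu pc -> ~~ has touched w.
  by rewrite ea ec touched_has negb_or => -> ->.
case ca: (clockwise mu pa) both nboth ea e1; case cc: (clockwise mu pc) => both nboth ea e1 /=.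
- by rewrite both // mulr0.
- rewrite nboth //=; case cw: (clockwise nu' pc); rewrite ?mulr0 //= mulr1.
  rewrite (sign_vsgn ca) (sign_vsgn (nu := nu') (v := pa)) ?cac // (one pa) //; first by rewrite mulrC.
    move=> x tx xw; case/orP: tx => // cx; move: cc; rewrite ec => /negbT /hasPn /(_ x xw).
    by rewrite cx.
  by move=> x ax; rewrite /touched ax.
- rewrite nboth //=; case cw: (clockwise nu' pc); rewrite ?mulr0 //= mulr1.
  rewrite (sign_vsgn cc) (sign_vsgn cw) (one pc) //; first by rewrite mulrC.
    move=> x tx xw; case/orP: tx => // ax; move: ea => /esym /negbT /hasPn /(_ x xw).
    by rewrite ax.
  by move=> x cx; rewrite /touched cx orbT.
- rewrite nboth //=; case cw: (clockwise nu' pc); rewrite ?mulr0 //= mulr1.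
  by rewrite (word_keeps f k) // ntouch ?ca ?cc.
Qed.

Definition split_eps : C := if dot then 1 else -1.

(** If [w] has a letter on the component that is split, one summand is 0 because
of it, and in the other one both pieces carry a letter. *)
Definition split_word w : Dspace R D' :=
  (-1) ^+ pcount i *: (word D' (pd :: w) + split_eps *: word D' (pc :: w)).

Lemma split_wordE w nu' : split_word w nu' =
  (-1) ^+ pcount i * (word D' (pd :: w) nu' + split_eps * word D' (pc :: w) nu').
Proof. by rewrite /split_word !ffunE. Qed.

Lemma split_sub u v : same_comp D pa pc -> same_comp D' u v -> same_comp D u v.
Proof.
move=> ac uv; case tu: (touched u); last by rewrite (untouched_same Hs) ?tu.
have tt x : touched x -> same_comp D pc x.
  by case/orP => // ax; apply: same_comp_trans ax; rewrite same_comp_sym.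
apply: same_comp_trans (tt v _); last by rewrite -(touched_comp' Hs uv).
by rewrite same_comp_sym tt.
Qed.

(** Two letters on the component that is split, or one if that component is a
line, leave no circle for the added letter. *)
Lemma split_word_zero w : same_comp D pa pc -> ~~ same_comp D' pc pd ->
  ~~ (separated D w && on_circles D w) -> split_word w = 0.
Proof.
move=> ac cd bad; apply/ffunP => nu'.
suff H x y : same_comp D' x x -> (x == pd) && (y == pc) || (x == pc) && (y == pd) ->
    word D' (x :: w) nu' = 0.
  rewrite split_wordE.
  have -> : word D' (pd :: w) nu' = 0 by apply: (H pd pc); rewrite ?same_comp_refl ?eqxx.
  have -> : word D' (pc :: w) nu' = 0 by apply: (H pc pd); rewrite ?same_comp_refl ?eqxx ?orbT.
  by rewrite mulr0 addr0 mulr0 ffunE.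
move=> _ xy; rewrite ffunE; case: ifP => // /andP [sx f]; case/negP: bad.
have tx z : touched z -> same_comp D' x z || same_comp D' y z.
  by rewrite (touched_after Hs); case/orP: xy => /andP [/eqP -> /eqP ->] //; rewrite orbC.
have nx v : v \in w -> ~~ same_comp D' x v.
  by move: sx; rewrite /separated /= => /andP [/allP H _] /H.
have sw : separated D' w by move: sx; rewrite /separated /= => /andP [].
have cx := fits_in f (mem_head x w); have [_ nlx] := clockwise_inP cx.
apply/andP; split.
  apply: separated_sub sw => u v uw vw uv; case tu: (touched u); last first.
    by rewrite -(untouched_same Hs) ?tu.
  have tv : touched v by rewrite -(touched_comp s uv).
  have := tx u tu; have := tx v tv; rewrite (negPf (nx u uw)) (negPf (nx v vw)) /= => yv yu.
  by apply: same_comp_trans yv; rewrite same_comp_sym.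
apply/allP => v vw; have cv : clockwise nu' v by apply: (fits_in f); rewrite inE vw orbT.
have [vP nlv] := clockwise_inP cv; rewrite vP /=.
case tv: (touched v); last by rewrite (on_line_untouched Hs) ?tv.
have := tx v tv; rewrite (negPf (nx v vw)) /= => yv.
apply/existsP => -[z /andP [vz ez]].
have tz : touched z by rewrite -(touched_comp s vz).
have ez' : line_end D' z by rewrite (line_end_surgery Hs).
case/orP: (tx z tz) => hz.
  by case/negP: nlx; apply/existsP; exists z; rewrite hz.
case/negP: nlv; apply/existsP; exists z; rewrite -/(line_end D' z) ez' andbT.
by apply: same_comp_trans hz; rewrite same_comp_sym.
Qed.

Lemma surg_split w : orientation D -> same_comp D pa pc -> ~~ same_comp D' pc pd ->
  surg R D D' (word D w) = split_word w.
Proof.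
move=> o ac cd.
have [/andP [sw gw]|bad] := boolP (separated D w && on_circles D w); last first.
  by rewrite (word_zero bad) surg0 split_word_zero.
have [mu f] := fits_ex o gw; apply/ffunP => nu'.
pose mu' : orientation D' := exist (is_orientation D') _ (split_after Hs nu' mu ac cd).
rewrite (surg_word nu' sw f) /surg_coef_at /is_merge /is_split ac cd /= split_wordE !ffunE.
rewrite !big_cons.
have sw' : separated D' w.
  by apply: separated_sub sw => u v _ _; exact: split_sub.
have ec := fitsP pc f.
have tc : has touched w = has (same_comp D pc) w.
  apply: eq_has => x; rewrite /touched (same_comp_eq x ac) orbb.
  by [].
have nhas (x y : vertex) : touched x -> forall u, ~~ touched u -> has (same_comp D' u) (x :: w) = has (same_comp D' u) w.
  move=> tx u nu /=; case ux: (same_comp D' u x) => //.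
  by rewrite (touched_comp' Hs ux) tx in nu.
rewrite (fits_after nu' f (nhas pd pd (touched_d Hs))) (fits_after nu' f (nhas pc pd (touched_c D s))).
have -> : has (same_comp D' pc) (pd :: w) = has (same_comp D' pc) w by rewrite /= (negPf cd).
have -> : has (same_comp D' pd) (pd :: w) by rewrite /= same_comp_refl.
have -> : has (same_comp D' pc) (pc :: w) by rewrite /= same_comp_refl.
have -> : has (same_comp D' pd) (pc :: w) = has (same_comp D' pd) w.
  by rewrite /= same_comp_sym (negPf cd).
have sx x : separated D' (x :: w) = ~~ has (same_comp D' x) w.
  by rewrite /separated /= -/(separated D' w) sw' andbT -all_predC.
rewrite !sx.
case k: (keeps_others s mu nu'); last by rewrite !andbF mul0r !(mulr0, addr0).
rewrite mul1r !andTb /split_coef.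
have h2 : has (same_comp D pc) w = has (same_comp D' pc) w || has (same_comp D' pd) w.
  by rewrite -tc touched_has'.
have one p : has (same_comp D' p) w -> (forall x, touched x -> x \in w -> same_comp D' p x) ->
    (forall x, same_comp D' p x -> touched x) ->
    \prod_(v <- w) vee_sign (val nu') v = (vee_sign (val mu) p * vee_sign (val nu') p) * \prod_(v <- w) vee_sign (val mu) v.
  move=> cp tp pt; apply: (prod_one (P := same_comp D' p)).
  - by rewrite separated_count // cp.
  - move=> v vw pv; rewrite (vee_sign_ratio (v := v)); last exact: (vee_ratio mu' nu' pv).
    by rewrite mulrAC vee_sign_sq mul1r.
  - by move=> v vw np; apply: (keeps_vsgn f k vw); apply: contra np => tv; apply: tp.
have nboth : ~~ (has (same_comp D' pc) w && has (same_comp D' pd) w).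
  apply/negP => /andP [/hasP [u uw cu] /hasP [v vw dv]].
  have uv : same_comp D u v.
    apply: (same_comp_trans (v := pc)).
      by rewrite same_comp_sym; apply: split_sub.
    apply: same_comp_trans (same_c_d Hs) _; exact: split_sub.
  case/negP: (cd); apply: same_comp_trans cu _.
  by rewrite (separated_in sw uw vw uv) same_comp_sym.
have cdD : vee_sign (val mu) pc = split_eps * vee_sign (val mu) pd.
  have := orientation_cup mu (site_cup_adj_hi Hs); rewrite /vee_sign /split_eps.
  by do 2!case: (vee _ _); case: (dot) => //= _; rewrite ?expr0 ?expr1 ?mul1r ?mulr1 ?mulrN1 ?opprK.
rewrite ec h2; case hc: (has (same_comp D' pc) w) nboth h2; case hd: (has (same_comp D' pd) w) => //= _ h2.
- have mc : clockwise mu pc by rewrite ec h2.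
  rewrite mulr0 addr0; case cc: (clockwise nu' pc); case cc2: (clockwise nu' pd) => /=;
    rewrite ?mulr0 //.
  rewrite mulr1 (sign_vsgn mc) (sign_vsgn cc) (sign_vsgn cc2) (one pc) //; first by ring.
    move=> x; rewrite (touched_after Hs) => /orP [//|dx] xw.
    by move/negbT/hasPn: hd => /(_ x xw); rewrite dx.
  by move=> x; rewrite (touched_after Hs) => ->.
- have mc : clockwise mu pc by rewrite ec h2.
  rewrite add0r; case cc: (clockwise nu' pc); case cc2: (clockwise nu' pd) => /=;
    rewrite ?mulr0 //.
  rewrite mulr1 (sign_vsgn mc) (sign_vsgn cc) (sign_vsgn cc2) (one pd) ?cdD //; first by ring.
    move=> x; rewrite (touched_after Hs) => /orP [cx|//] xw.
    by move/negbT/hasPn: hc => /(_ x xw); rewrite cx.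
  by move=> x; rewrite (touched_after Hs) orbC => ->.
- rewrite (word_keeps f k) ?tc ?h2 //.
  case cc: (clockwise nu' pc); case cc2: (clockwise nu' pd) => /=;
    rewrite ?(sign_vsgn cc) ?(sign_vsgn cc2) ?mulr0 ?mulr1 ?addr0 ?add0r ?mulr0 //;
    rewrite /split_eps /=; ring.
Qed.

(** The condition under which a reconnection is not zero. *)
Definition both_propagating : bool := on_propagating_line D pa && on_propagating_line D pc.

Lemma corners_line x : ~~ same_comp D pa pc -> ~~ same_comp D' pc pd ->
  x \in [:: pa; pb; pc; pd] -> on_line D x /\ on_line D' x.
Proof.
move=> ac cd hx; have /existsP [z /andP [xz ez]] := reconnect_corner_end Hs ac cd hx.
split; apply/existsP; exists z; rewrite -/(line_end _ z) ?(line_end_surgery Hs) ez andbT.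
  by apply: connect_sub xz => u v /gadj_adj /connect1.
by apply: connect_sub xz => u v /(gadj_after Hs) /connect1.
Qed.

Lemma reconnect_true : ~~ same_comp D pa pc -> ~~ same_comp D' pc pd -> is_reconnect D D' s.
Proof.
move=> ac cd; have [ia ib ic id] := corner_in s.
rewrite /is_reconnect ac cd.
by have [-> _] := corners_line ac cd ia; have [-> ->] := corners_line ac cd ic;
   have [_ ->] := corners_line ac cd id.
Qed.

Lemma touched_line x : ~~ same_comp D pa pc -> ~~ same_comp D' pc pd ->
  touched x -> on_line D x /\ on_line D' x.
Proof.
move=> ac cd tx; have [ia ib ic id] := corner_in s.
have [la _] := corners_line ac cd ia; have [lc lc'] := corners_line ac cd ic.
have [_ ld'] := corners_line ac cd id.
split.
  by case/orP: tx => xt; rewrite -(on_line_comp xt).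
by move: tx; rewrite (touched_after Hs) => /orP [] xt; rewrite -(on_line_comp xt).
Qed.

(** A letter on one of the lines involved makes both words 0, and nothing else
changes. *)
Lemma surg_reconnect w : orientation D -> ~~ same_comp D pa pc -> ~~ same_comp D' pc pd ->
  surg R D D' (word D w) = (both_propagating%:R : C) *: word D' w.
Proof.
move=> o ac cd; apply/ffunP => nu'; rewrite !ffunE.
pose nu : orientation D := exist (is_orientation D) _ (reconnect_before Hs o nu' ac cd).
have coef mu : surg_coef R mu nu' = ((mu == nu) && both_propagating)%:R.
  rewrite surg_coefE /surg_coef_at /is_merge /is_split (negPf ac) (negPf cd) reconnect_true //=.
  rewrite /reconnect_coef; suff -> : (val nu' == val mu) = (mu == nu) by [].
  by rewrite eq_sym -val_eqE.
rewrite (bigD1 nu) //= big1 ?addr0 => [|mu n]; last by rewrite coef (negPf n) mulr0.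
rewrite coef eqxx andTb ffunE /GRing.scale /= [RHS]mulrC; congr (_ * _).
suff -> : separated D w && fits nu w = separated D' w && fits nu' w by [].
have nt (E : stacked B h) (mu : orientation E) : (forall x, touched x -> on_line E x) ->
    fits mu w -> {in w, forall x, ~~ touched x}.
  move=> H f x xw; apply/negP => /H lx.
  by have [_] := clockwise_inP (fits_in f xw); rewrite lx.
have ntD := nt D nu (fun x tx => (touched_line ac cd tx).1).
have ntD' := nt D' nu' (fun x tx => (touched_line ac cd tx).2).
have cu u : ~~ touched u -> clockwise nu u = clockwise nu' u.
  move=> tu; rewrite /clockwise (on_line_untouched Hs tu); congr (_ && _).
  by apply: eq_existsb => x; rewrite (rightmost_untouched Hs tu).
have sep E E' : {in w, forall x, ~~ touched x} -> (forall u v, ~~ touched u -> same_comp E' u v -> same_comp E u v) ->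
    separated E w -> separated E' w.
  by move=> H1 H2; apply: separated_sub => u v uw _; apply: H2; exact: H1.
have ff : (forall x, x \in w -> ~~ touched x) -> fits nu w = fits nu' w.
  move=> H; apply: eq_forallb => u; case tu: (touched u).
    have [l1 l2] := touched_line ac cd tu.
    rewrite !clockwise_out ?l1 ?l2 ?andbF //.
    have -> : has (same_comp D u) w = false.
      by apply/negbTE/hasPn => x /H; apply: contra => ux; rewrite -(touched_comp s ux).
    have -> // : has (same_comp D' u) w = false.
    by apply/negbTE/hasPn => x /H; apply: contra => ux; rewrite -(touched_comp' Hs ux).
  by rewrite cu ?tu // (has_untouched _ (negbT tu)).
apply/andP/andP => -[s1 f1]; split.
- by apply: sep (ntD f1) _ s1 => u v tu; rewrite (untouched_same Hs v tu).
- by rewrite -ff //; exact: ntD.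
- by apply: sep (ntD' f1) _ s1 => u v tu; rewrite (untouched_same Hs v tu).
- by rewrite ff //; exact: ntD'.
Qed.
End Surgery.
End Words.

(** * Linearity and the span of words *)
Section Linear.
Variables (R : realType) (B : block) (h : nat).
Implicit Types (D : stacked B h).

Lemma surgD D D' (x y : Dspace R D) : surg R D D' (x + y) = surg R D D' x + surg R D D' y.
Proof.
apply/ffunP => nu'; rewrite !ffunE -big_split; apply: eq_bigr => nu _.
by rewrite ffunE mulrDl.
Qed.

Lemma surgZ D D' (a : R[i]) (x : Dspace R D) : surg R D D' (a *: x) = a *: surg R D D' x.
Proof.
apply/ffunP => nu'; rewrite !ffunE /GRing.scale /= big_distrr; apply: eq_bigr => nu _.
by rewrite ffunE /GRing.scale /= mulrA.
Qed.

Lemma surg_big D D' (I : Type) (r : seq I) (f : I -> Dspace R D) :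
  surg R D D' (\sum_(k <- r) f k) = \sum_(k <- r) surg R D D' (f k).
Proof. by apply: (big_morph (surg R D D') (@surgD D D')); exact: surg0. Qed.

Definition clockwise_roots D (nu : orientation D) : seq (vertex B h) :=
  [seq v <- enum {: vertex B h} | clockwise nu v & fingraph.root (adj D) v == v].

Lemma clockwise_roots_fits D (nu : orientation D) : fits nu (clockwise_roots nu).
Proof.
apply/forallP => u; apply/eqP; apply/idP/hasP => [cu|[v]].
  exists (fingraph.root (adj D) u); last exact: connect_root.
  rewrite mem_filter mem_enum andbT -(clockwise_comp nu (connect_root (adj D) u)) cu.
  by rewrite -[_ == _]/(fingraph.roots (adj D) (fingraph.root (adj D) u)) roots_root //; exact: sym_connect_sym (@adj_sym _ _ D).
by rewrite mem_filter => /andP [/andP [cv _] _] uv; rewrite (clockwise_comp nu uv).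
Qed.

Lemma clockwise_roots_separated D (nu : orientation D) : separated D (clockwise_roots nu).
Proof.
have : uniq (clockwise_roots nu) by rewrite filter_uniq ?enum_uniq.
have : all (fun v => fingraph.root (adj D) v == v) (clockwise_roots nu).
  by apply/allP => v; rewrite mem_filter => /andP [/andP []].
rewrite /separated; elim: (clockwise_roots nu) => //= u w IH /andP [/eqP ru aw] /andP [nu' uw].
rewrite IH // andbT; apply/allP => v vw; apply: contra nu' => uv.
have := root_connect (sym_connect_sym (@adj_sym _ _ D)) u v.
by rewrite -[connect _ _ _]/(same_comp D u v) uv ru (eqP (allP aw v vw)) => /eqP ->.
Qed.

Lemma vee_sign_prod_sq t (w : seq (vertex B h)) :
  (\prod_(v <- w) vee_sign R t v) * (\prod_(v <- w) vee_sign R t v) = 1.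
Proof. by elim: w => [|v w IH]; rewrite ?big_nil ?mulr1 // !big_cons mulrACA IH vee_sign_sq mulr1. Qed.

(** Every basis vector is a word up to sign, with one letter for each clockwise
circle. *)
Lemma word_span D (x : Dspace R D) :
  x = \sum_(nu : orientation D)
        (x nu * \prod_(v <- clockwise_roots nu) vee_sign R (val nu) v) *: word R D (clockwise_roots nu).
Proof.
apply/ffunP => nu; rewrite sum_ffunE (bigD1 nu) //= [X in _ + X]big1 ?addr0 => [|mu n].
  rewrite !ffunE clockwise_roots_separated clockwise_roots_fits andTb.
  set p := \prod_(v <- _) _; change (x nu = x nu * p * p).
  by rewrite -mulrA vee_sign_prod_sq mulr1.
rewrite !ffunE /GRing.scale /=; case: ifP => [/andP [_ f]|_]; last by rewrite mulr0.
by move: n; rewrite (fits_unique f (clockwise_roots_fits mu)) eqxx.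
Qed.
End Linear.

Section Letters.
Variables (R : realType) (B : block) (h : nat) (F : stacked B h).
Implicit Types (u v : vertex B h) (w : seq (vertex B h)).

Lemma word_letter (nu : orientation F) u v w : same_comp F u v ->
  vee_sign R (val nu) u * word R F (u :: w) nu = vee_sign R (val nu) v * word R F (v :: w) nu.
Proof.
move=> uv; rewrite !ffunE.
have e : (fun x => same_comp F u x) =1 (fun x => same_comp F v x).
  by move=> x; exact: same_comp_eq uv.
have -> : separated F (u :: w) = separated F (v :: w).
  by rewrite /separated /=; congr (_ && _); apply: eq_all => x; rewrite e.
have -> : fits nu (u :: w) = fits nu (v :: w).
  by apply: eq_forallb => x /=; rewrite ![same_comp F x _]same_comp_sym e.
by case: ifP => _; rewrite ?mulr0 // !big_cons !mulrA !vee_sign_sq.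
Qed.

(** The sign makes the result independent of the place of [v] on its component,
see [signed_word_comp]. *)
Definition signed_word (y : h.+1.-tuple (weight B)) v w : Dspace R F := vee_sign R y v *: word R F (v :: w).

Lemma signed_wordE y v w nu : signed_word y v w nu = vee_sign R y v * word R F (v :: w) nu.
Proof. by rewrite /signed_word ffunE. Qed.

Lemma signed_word_comp (y : orientation F) u v w : same_comp F u v -> signed_word (val y) u w = signed_word (val y) v w.
Proof.
move=> uv; apply/ffunP => nu; rewrite !signed_wordE.
have H := word_letter nu w uv.
have E : vee_sign R (val y) u * vee_sign R (val nu) u = vee_sign R (val y) v * vee_sign R (val nu) v.
  by apply: vee_sign_ratio; exact: vee_ratio.
have e1 x : word R F (x :: w) nu = vee_sign R (val nu) x * (vee_sign R (val nu) x * word R F (x :: w) nu).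
  by rewrite mulrA vee_sign_sq mul1r.
by rewrite (e1 u) (e1 v) !mulrA -(mulrA _ _ (word _ _ _ _)) H E -!mulrA.
Qed.

Lemma word_line v w : on_line F v -> word R F (v :: w) = 0.
Proof.
move=> lv; apply: word_zero; rewrite negb_and; apply/orP; right.
by rewrite /on_circles /= lv andbF.
Qed.

Lemma signed_word_line y v w : on_line F v -> signed_word y v w = 0.
Proof. by move=> lv; rewrite /signed_word word_line // scaler0. Qed.

Lemma word_swap u v w : word R F (u :: v :: w) = word R F (v :: u :: w).
Proof.
apply/ffunP => nu; rewrite !ffunE.
have -> : separated F (u :: v :: w) = separated F (v :: u :: w).
  rewrite /separated /= same_comp_sym; case: (same_comp F v u) => //=.
  by case: (all _ w); case: (all _ w).
have -> : fits nu (u :: v :: w) = fits nu (v :: u :: w).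
  by apply: eq_forallb => x /=; rewrite orbCA.
by case: ifP => // _; rewrite !big_cons mulrCA.
Qed.
End Letters.

(** * The number of components *)
Section Count.
Variables (B : block) (h : nat).
Implicit Types (D : stacked B h) (u v : vertex B h).

Definition comp_of D v := [set u | same_comp D v u].
Definition ncomp D := #|[set comp_of D v | v : vertex B h]|.

Lemma comp_of_eq D u v : (comp_of D u == comp_of D v) = same_comp D u v.
Proof.
apply/eqP/idP => [e|uv].
  have vv : v \in comp_of D v by rewrite inE same_comp_refl.
  by move: vv; rewrite -e inE.
by apply/setP => x; rewrite !inE (same_comp_eq x uv).
Qed.

Lemma ncomp_two D x y (T : pred (vertex B h)) :
  (forall u, T u = same_comp D x u || same_comp D y u) ->
  ncomp D = (#|[set comp_of D v | v in [set v | ~~ T v]]| + (~~ same_comp D x y).+1)%N.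
Proof.
move=> HT; rewrite /ncomp.
have -> : [set comp_of D v | v : vertex B h] =
    [set comp_of D v | v in [set v | ~~ T v]] :|: [set comp_of D x; comp_of D y].
  apply/setP => c; rewrite !inE; apply/imsetP/or3P => [[v _ ->]|].
    case Tv: (T v); last by apply: Or31; apply/imsetP; exists v; rewrite // inE Tv.
    by move: Tv; rewrite HT !(comp_of_eq D v) => /orP [] h1; [apply: Or32|apply: Or33]; rewrite same_comp_sym.
  by case=> [/imsetP [v _ ->]|/eqP ->|/eqP ->]; eexists.
rewrite cardsU cards2 comp_of_eq.
suff -> : [set comp_of D v | v in [set v | ~~ T v]] :&: [set comp_of D x; comp_of D y] = set0.
  by rewrite cards0 subn0.
apply/setP => c; rewrite !inE; apply/negbTE/negP => /andP [/imsetP [v]].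
by rewrite inE HT negb_or => /andP [n1 n2] ->; rewrite !comp_of_eq ![same_comp D v _]same_comp_sym (negPf n1) (negPf n2).
Qed.

(** A merge lowers the number of components by 1, a split raises it by 1 and a
reconnection keeps it. *)
Lemma ncomp_surgery D D' s : surgery_at D D' s ->
  (ncomp D + ~~ same_comp D' (ihi s) (jhi s) = ncomp D' + ~~ same_comp D (ilo s) (ihi s))%N.
Proof.
move=> Hs; rewrite (@ncomp_two D (ilo s) (ihi s) (touched D s)) //.
rewrite (@ncomp_two D' (ihi s) (jhi s) (touched D s)); last exact: touched_after.
have -> : [set comp_of D v | v in [set v | ~~ touched D s v]] = [set comp_of D' v | v in [set v | ~~ touched D s v]].
  apply: eq_in_imset => v; rewrite inE => nt; apply/setP => u.
  by rewrite !inE (untouched_same Hs).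
by rewrite -!addnA; congr (_ + _)%N; rewrite !addSn addnC.
Qed.
End Count.

Section OneSurgery.
Variables (B : block) (h : nat) (X Y : stacked B h) (s : surgery_site B h).
Hypothesis Hs : surgery_at X Y s.
Local Notation pa := (ilo s).
Local Notation pb := (jlo s).
Local Notation pc := (ihi s).
Local Notation pd := (jhi s).
Local Notation i := s.1.1.2.
Implicit Types (u v z : vertex B h).

Definition merges := ~~ same_comp X pa pc && same_comp Y pc pd.
Definition splits := same_comp X pa pc && ~~ same_comp Y pc pd.
Definition reconnects := ~~ same_comp X pa pc && ~~ same_comp Y pc pd.

Lemma split_pair u v : same_comp X u v -> ~~ same_comp Y u v ->
  same_comp Y pc u && same_comp Y pd v || same_comp Y pd u && same_comp Y pc v.
Proof.
move=> uv nuv; have tu : touched X s u.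
  by apply: contraR nuv => nt; rewrite -(untouched_same Hs).
have tv : touched X s v by rewrite -(touched_comp s uv).
have bad z : same_comp Y z u -> same_comp Y z v -> False.
  by move=> zu zv; case/negP: nuv; apply: same_comp_trans zv; rewrite same_comp_sym.
move: tu tv; rewrite !(touched_after Hs) => /orP [] hu /orP [] hv.
- by case: (bad pc).
- by rewrite hu hv.
- by rewrite hu hv orbT.
- by case: (bad pd).
Qed.

Lemma merge_pair u v : ~~ same_comp X u v -> same_comp Y u v ->
  same_comp X pa u && same_comp X pc v || same_comp X pc u && same_comp X pa v.
Proof.
move=> nuv uv; have tu : touched X s u.
  by apply: contraR nuv => nt; rewrite (untouched_same Hs).
have tv : touched X s v by rewrite -(touched_comp' Hs uv).
have bad z : same_comp X z u -> same_comp X z v -> False.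
  by move=> zu zv; case/negP: nuv; apply: same_comp_trans zv; rewrite same_comp_sym.
move: tu tv => /orP [] hu /orP [] hv.
- by case: (bad pa).
- by rewrite hu hv.
- by rewrite hu hv orbT.
- by case: (bad pc).
Qed.

Lemma merged_touched u v : same_comp Y pc pd -> touched X s u -> touched X s v -> same_comp Y u v.
Proof.
move=> cd; have H z : touched X s z -> same_comp Y pc z.
  by rewrite (touched_after Hs) => /orP [//|]; exact: same_comp_trans.
by move=> /H cu /H; apply: same_comp_trans; rewrite same_comp_sym.
Qed.

Lemma prop_comp (E : stacked B h) u v : same_comp E u v ->
  on_propagating_line E u = on_propagating_line E v.
Proof.
move=> uv; rewrite /on_propagating_line; congr (_ && _); apply: eq_existsb => z;
by rewrite (same_comp_eq z uv).
Qed.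

Lemma prop_line (E : stacked B h) u : on_propagating_line E u -> on_line E u.
Proof.
case/andP => /existsP [z /andP [uz bz]] _; apply/existsP; exists z.
by rewrite uz bz.
Qed.

Lemma prop_ends v : (forall z, line_end X z -> same_comp Y v z = same_comp X v z) ->
  on_propagating_line Y v = on_propagating_line X v.
Proof.
move=> H; rewrite /on_propagating_line; congr (_ && _); apply: eq_existsb => z.
  rewrite (bottom_end_surgery Hs); case bz: (bottom_end X z); rewrite ?andbF // H //.
  by rewrite /line_end bz.
rewrite (top_end_surgery Hs); case bz: (top_end X z); rewrite ?andbF // H //.
by rewrite /line_end bz orbT.
Qed.

Lemma untouched_prop v : ~~ touched X s v -> on_propagating_line Y v = on_propagating_line X v.
Proof. by move=> nt; apply: prop_ends => z _; rewrite (untouched_same Hs). Qed.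

Lemma on_line_end (E : stacked B h) u z : line_end E z -> same_comp E u z -> on_line E u.
Proof. by move=> ez uz; apply/existsP; exists z; rewrite uz. Qed.

(** At most one of the two components is a line, and the result has its ends. *)
Lemma merge_prop v : merges -> on_line X v -> on_propagating_line Y v = on_propagating_line X v.
Proof.
case/andP => ac cd lv; case tv: (touched X s v); last by rewrite untouched_prop ?tv.
apply: prop_ends => z ez; have lz : on_line X z by apply: on_line_end ez (same_comp_refl X z).
apply/idP/idP => vz.
  have tz : touched X s z by rewrite -(touched_comp' Hs vz).
  move: tv tz => /orP [] hv /orP [] hz.
  - by apply: same_comp_trans hz; rewrite same_comp_sym.
  - by have := merge_has_circle Hs ac cd; rewrite (on_line_comp hv) (on_line_comp hz) lv lz.
  - by have := merge_has_circle Hs ac cd; rewrite (on_line_comp hv) (on_line_comp hz) lv lz.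
  - by apply: same_comp_trans hz; rewrite same_comp_sym.
by apply: merged_touched => //; rewrite -(touched_comp s vz).
Qed.

(** At most one of the two pieces is a line, and it has the ends of the old
line. *)
Lemma split_prop v : splits -> on_line Y v -> on_propagating_line Y v = on_propagating_line X v.
Proof.
case/andP => ac cd lv; case tv: (touched X s v); last by rewrite untouched_prop ?tv.
apply: prop_ends => z ez; have ez' : line_end Y z by rewrite (line_end_surgery Hs).
have lz : on_line Y z by apply: on_line_end ez' (same_comp_refl Y z).
apply/idP/idP => vz; first exact: (split_sub Hs).
have tz : touched X s z by rewrite -(touched_comp s vz).
move: tv tz; rewrite !(touched_after Hs) => /orP [] hv /orP [] hz.
- by apply: same_comp_trans hz; rewrite same_comp_sym.
- by have := split_has_circle Hs ac cd; rewrite (on_line_comp hv) (on_line_comp hz) lv lz.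
- by have := split_has_circle Hs ac cd; rewrite (on_line_comp hv) (on_line_comp hz) lv lz.
- by apply: same_comp_trans hz; rewrite same_comp_sym.
Qed.

Lemma reconnect_line v : reconnects -> on_line X v -> on_line Y v.
Proof.
case/andP => ac cd lv; case tv: (touched X s v); first by have [] := touched_line Hs ac cd tv.
by rewrite -(on_line_untouched Hs) ?tv.
Qed.

Lemma split_line v : same_comp X pa pc -> touched X s v -> on_line X v -> on_line Y pc || on_line Y pd.
Proof.
move=> ac tv /existsP [z /andP [vz ez]].
have tz : touched X s z by rewrite -(touched_comp s vz).
have ez' : line_end Y z by rewrite (line_end_surgery Hs).
by move: tz; rewrite (touched_after Hs) => /orP [] hz; rewrite (on_line_end ez' hz) ?orbT.
Qed.

Lemma right_parity_end (E : stacked B h) (S : pred (vertex B h)) m (lv : 'I_h.+1) r (S2 : pred (pos B)) :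
  (forall v, S v -> inP v.1) -> und_closed E S -> in_layer m lv -> (m <= h.+1)%N ->
  r \in rays (layer E m) -> {subset S2 <= @inP B} ->
  (forall r', r' \in rays (layer E m) -> S (r'.1, lv) = S2 r'.1) ->
  (forall k, S2 k -> has_ray (layer E m) k) ->
  right_parity (fun k => S (k, lv)) r.1 = right_parity S2 r.1.
Proof.
move=> SP Sc ml hm hr S2P HS H2; have Ha := layer_cup_diagram E hm.
apply: (right_parity_ray Ha (S1 := fun k => S (k, lv)) (S2 := S2) _ S2P hr) => //.
- by move=> x /SP.
- move=> x hx lx; have dx : x.2 = false.
    by apply/negbTE/negP => dx; have := dotted_cup_ray Ha hx hr dx; rewrite leqNgt lx.
  have -> : S (x.1.1, lv) = S (x.1.2, lv).
    by apply: Sc; have := layer_cup_adj ml hx; rewrite dx => ->.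
  have xj : arc_joins (layer E m) x.1.1 x.1.2 by apply/arc_joinsP; exists x; rewrite ?eqxx.
  rewrite addbb; case e1: (S2 x.1.1).
    by case: (arc_joins_ray Ha xj (H2 _ e1)).
  case e2: (S2 x.1.2) => //; rewrite arc_joins_sym in xj.
  by case: (arc_joins_ray Ha xj (H2 _ e2)).
- by move=> r' hr' _; exact: HS.
Qed.

(** To the right of the ray at a line end there are undotted cups, whose ends
are both in S or both outside, and rays at line ends, which are not in S. *)
Lemma right_val_line_end (E : stacked B h) (S : pred (vertex B h)) z :
  (forall v, S v -> inP v.1) -> und_closed E S -> (forall v, S v -> ~~ line_end E v) ->
  line_end E z -> right_val S z = false.
Proof.
move=> SP Sc Se ez; have Sz : S z = false by apply/negbTE/negP => /Se; rewrite ez.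
rewrite /right_val Sz addbF; move: ez; rewrite /line_end.
case: z Sz => k l /= Sz /orP [] /andP [/= /eqP el /has_rayP [r hr <-]].
  have -> : l = ord0 by apply/val_inj.
  rewrite (right_parity_end (E := E) (m := 0) (S2 := pred0) SP Sc) //; first by rewrite /right_parity big1.
  move=> r' hr'; apply/negbTE/negP => /Se; rewrite /line_end /bottom_end eqxx /=.
  by have -> : has_ray (layer E 0) r'.1 by apply/has_rayP; exists r'.
have -> : l = ord_max by apply/val_inj.
rewrite (right_parity_end (E := E) (m := h.+1) (S2 := pred0) SP Sc) //; first by rewrite /right_parity big1.
  by rewrite /in_layer eqxx orbT.
move=> r' hr'; apply/negbTE/negP => /Se; rewrite /line_end /top_end eqxx /=.
by have -> : has_ray (layer E h.+1) r'.1 by [apply/has_rayP; exists r']; rewrite orbT.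
Qed.

(** As in [right_val_line_end], but the ray at [r] counts. *)
Lemma right_val_bottom (E : stacked B h) (S : pred (vertex B h)) z r :
  (forall v, S v -> inP v.1) -> und_closed E S ->
  bottom_end E z -> bottom_end E r -> S r -> (forall v, S v -> bottom_end E v -> v = r) ->
  right_val S z = (z.1 < r.1)%N (+) (S z && ~~ odd (pcount z.1)).
Proof.
move=> SP Sc bz br Sr Hr; rewrite /right_val; congr (_ (+) _).
have l0 v : bottom_end E v -> v.2 = ord0.
  by case/andP => /eqP e _; apply/val_inj.
rewrite (l0 z bz); have rP : inP r.1 := SP r Sr.
have hrr : has_ray (layer E 0) r.1 by case/andP: br.
case/andP: bz => _ /has_rayP [q hq <-].
rewrite (right_parity_end (E := E) (m := 0) (S2 := pred1 r.1) SP Sc) //.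
- rewrite /right_parity; case: (ltnP q.1 r.1) => lt.
    rewrite (bigD1 r.1) //= eqxx xor0 // => x /andP [_ n]; exact: negbTE.
  by rewrite xor0 // => x lx /=; apply/negbTE; apply: contraTneq lx => ->; rewrite -leqNgt.
- by move=> x /eqP ->.
- move=> q' hq' /=; apply/idP/eqP => [Sq|e].
    have b' : bottom_end E (q'.1, ord0) by rewrite /bottom_end eqxx; apply/has_rayP; exists q'.
    by rewrite -(Hr _ Sq b').
  by rewrite e -(l0 r br) -surjective_pairing.
- by move=> x /eqP ->.
Qed.

Lemma bottom_unique (E : stacked B h) u v t : bottom_end E u -> bottom_end E v -> top_end E t ->
  same_comp E u v -> same_comp E u t -> u = v.
Proof.
have iso x y : bottom_end E x -> top_end E x -> same_comp E x y -> x = y.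
  move=> bx tx; have e1 : adj E =2 (fun x y => low_adj E x y || up_adj E x y) by move=> ? ?; rewrite adjE.
  rewrite /same_comp (eq_connect e1); apply: path_end_isolated => w.
    exact: bottom_end_low.
  exact: top_end_up.
move=> bu bv tt uv ut; apply/eqP; apply: contraT => n.
case: (eqVneq u t) => [e|nut]; first by rewrite -(iso u v) ?eqxx // e in n.
case: (eqVneq v t) => [e|nvt].
  by move: n; rewrite (iso v u) ?eqxx // ?e // -?e same_comp_sym.
have lb x : bottom_end E x -> line_end E x by move=> bx; rewrite /line_end bx.
have lt x : top_end E x -> line_end E x by move=> bx; rewrite /line_end bx orbT.
by case: (line_two_ends (lb u bu) (lb v bv) (lt t tt) n nut nvt uv ut).
Qed.

(** Let b1 and b2 be the bottom ends of the two lines.  If a line after the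
surgery still propagated, b1 and b2 would be on different lines after it as
well.  For the line through b1, the right counts at b1 and b2 only depend on the
positions of these two, so their sum would be the same before and after; but by
[right_val_cups] and [right_val_rays] it is p(i) before and p(i) + 1 after. *)
Lemma reconnect_not_prop v : reconnects -> on_propagating_line X pa -> on_propagating_line X pc ->
  touched X s v -> ~~ on_propagating_line Y v.
Proof.
case/andP => ac cd /andP [/existsP [b1 /andP [ab1 bb1]] /existsP [t1 /andP [at1 tt1]]].
case/andP => /existsP [b2 /andP [cb2 bb2]] /existsP [t2 /andP [ct2 tt2]] tv.
apply/negP => /andP [/existsP [r /andP [vr br]] /existsP [t /andP [vt tt]]].
rewrite (bottom_end_surgery Hs) in br; rewrite (top_end_surgery Hs) in tt.
have only z : touched X s z -> bottom_end X z -> z = b1 \/ z = b2.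
  move=> tz bz; case/orP: tz => hz; [left|right].
    apply: (bottom_unique (E := X) (t := t1)) => //.
      by apply: same_comp_trans ab1; rewrite same_comp_sym.
    by apply: same_comp_trans at1; rewrite same_comp_sym.
  apply: (bottom_unique (E := X) (t := t2)) => //.
    by apply: same_comp_trans cb2; rewrite same_comp_sym.
  by apply: same_comp_trans ct2; rewrite same_comp_sym.
have tb1 : touched X s b1 by rewrite /touched ab1.
have tb2 : touched X s b2 by rewrite /touched cb2 orbT.
have nb : b1 != b2.
  apply: contraNneq ac => e; rewrite e in ab1; apply: same_comp_trans ab1 _.
  by rewrite same_comp_sym.
have bY z : bottom_end X z -> bottom_end Y z by rewrite (bottom_end_surgery Hs).
have tY z : top_end X z -> top_end Y z by rewrite (top_end_surgery Hs).
have nY : ~~ same_comp Y b1 b2.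
  apply/negP => b12; have tr : touched X s r by rewrite -(touched_comp' Hs vr).
  have vb1 : same_comp Y v b1.
    case: (only r tr br) => e; rewrite e in vr => //.
    by apply: same_comp_trans vr _; rewrite same_comp_sym.
  case/eqP: nb; apply: (bottom_unique (bY _ bb1) (bY _ bb2) (tY _ tt) b12).
  by apply: same_comp_trans vt; rewrite same_comp_sym.
pose S := same_comp Y b1; pose S' := same_comp X pa.
have b1P : inP b1.1 by apply: (@line_end_inP _ _ X); rewrite /line_end bb1.
have SP u : S u -> inP u.1 by move=> hu; rewrite -(same_comp_inP hu).
have SP' u : S' u -> inP u.1 by move=> hu; rewrite -(same_comp_inP hu) (site_inP1 Hs).
have Sc : und_closed Y S := @und_closed_comp _ _ Y b1.
have Sc' : und_closed X S' := @und_closed_comp _ _ X pa.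
have uS u : S u -> bottom_end Y u -> u = b1.
  move=> hu; rewrite (bottom_end_surgery Hs) => bu.
  have tu : touched X s u by rewrite -(touched_comp' Hs hu).
  by case: (only u tu bu) => // e; move: hu; rewrite /S e (negPf nY).
have uS' u : S' u -> bottom_end X u -> u = b1.
  move=> hu bu; have tu : touched X s u by rewrite /touched -/(S' u) hu.
  case: (only u tu bu) => // e; case/negP: ac; apply: same_comp_trans hu _.
  by rewrite e same_comp_sym.
have Sb1 : S b1 by exact: same_comp_refl.
have Sb2 : S b2 = false by apply/negbTE.
have Sb2' : S' b2 = false.
  by apply/negbTE; apply: contra ac => h1; apply: same_comp_trans h1 _; rewrite same_comp_sym.
have eX := right_val_cups Hs SP' Sc'.
have eY := right_val_rays Hs SP Sc.
have sab : same_comp X pa pb := same_a_b Hs.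
have scd : same_comp X pc pd := same_c_d Hs.
have rb : right_val S' pb = right_val S' b1.
  by apply: (right_val_comp SP' Sc'); apply: same_comp_trans ab1; rewrite same_comp_sym.
have rd : right_val S' pd = right_val S' b2.
  by apply: (right_val_comp SP' Sc'); apply: same_comp_trans cb2; rewrite same_comp_sym.
have Spb : S' pb := sab.
have Spd : S' pd = false.
  by apply/negbTE; apply: contra ac => h1; apply: same_comp_trans h1 _; rewrite same_comp_sym.
rewrite rb rd Spb Spd (right_val_bottom SP' Sc' bb1 bb1 ab1 uS') in eX.
rewrite (right_val_bottom SP' Sc' bb2 bb1 ab1 uS') Sb2' [S' b1]ab1 ltnn /= addbF in eX.
have [h1 h2] : (right_val S b1 (+) right_val S b2 = right_val S pc (+) right_val S pd) /\ S pc (+) S pd.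
  have RC := right_val_comp SP Sc.
  move: tb1 tb2; rewrite !(touched_after Hs) => /orP [] k1 /orP [] k2.
  - by case/negP: nY; apply: same_comp_trans k2; rewrite same_comp_sym.
  - rewrite -(RC _ _ k1) -(RC _ _ k2); split=> //; rewrite /S same_comp_sym k1.
    apply: contra nY => k3; apply: same_comp_trans k3 k2.
  - rewrite -(RC _ _ k1) -(RC _ _ k2) addbC; split=> //; rewrite /S [same_comp _ b1 pd]same_comp_sym k1 addbT.
    apply: contra nY => k3; apply: same_comp_trans k3 k2.
  - by case/negP: nY; apply: same_comp_trans k2; rewrite same_comp_sym.
rewrite -h1 h2 (right_val_bottom SP Sc (bY _ bb1) (bY _ bb1) Sb1 uS) in eY.
rewrite (right_val_bottom SP Sc (bY _ bb2) (bY _ bb1) Sb1 uS) Sb1 Sb2 ltnn /= addbF eX in eY.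
by move: eY; case: (odd _).
Qed.
End OneSurgery.

(** * Squares of surgeries *)
Section Sites.
Variables (B : block) (h : nat).
Implicit Types (X Y : stacked B h) (s t : surgery_site B h).

Definition has_site X s := site_cup s \in cups (layer X (s.1.1.1).+1).

Lemma site_eq s t : s.1.1.1 = t.1.1.1 -> site_cup s = site_cup t -> s = t.
Proof. by case: s t => [[[l i] j] d] [[[l' i'] j'] d'] /= -> [-> -> ->]. Qed.

Lemma has_site_surgery X Y s t : surgery_at X Y s -> has_site Y t = has_site X t && (t != s).
Proof.
move=> H; rewrite /has_site; case: (eqVneq t.1.1.1 s.1.1.1) => [e|n].
  rewrite e (surgery_cups H) in_setD1 andbC; congr (_ && ~~ _); apply/eqP/eqP => [|-> //].
  exact: site_eq.
rewrite (surgery_layer H) //; last exact: leqW (ltn_ord _).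
have -> : t != s by apply: contraNneq n => ->.
by rewrite andbT.
Qed.

Lemma surgery_at_fun X Y Y' s : surgery_at X Y s -> surgery_at X Y' s -> Y = Y'.
Proof.
move=> H H'; have em : middle Y = middle Y'.
  apply: eq_from_tnth => m; apply: val_inj; rewrite -!layer_middle.
  case: (eqVneq m s.1.1.1) => [->|n]; last first.
    by rewrite (surgery_layer H) ?(surgery_layer H') // ?eqSS // leqW.
  have e1 := surgery_cups H; have e2 := surgery_rays H.
  rewrite -(surgery_cups H') in e1; rewrite -(surgery_rays H') in e2.
  by rewrite [LHS]surjective_pairing [RHS]surjective_pairing; congr (_, _).
have := surgery_lower H; have := surgery_upper H.
rewrite -(surgery_lower H') -(surgery_upper H').
by case: Y Y' em {H H'} => [? ? ?] [? ? ?] /= -> -> ->.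
Qed.
End Sites.

Section Square.
Variables (B : block) (h : nat).
Implicit Types (D E F : stacked B h) (s t : surgery_site B h).

Definition square D E1 E2 F s t :=
  [/\ surgery_at D E1 s, surgery_at D E2 t, surgery_at E1 F t & surgery_at E2 F s].

Lemma square_sym D E1 E2 F s t : square D E1 E2 F s t -> square D E2 E1 F t s.
Proof. by case. Qed.

(** The cups of F are those of D without the two sites of either side.  So both
sides remove the same two cups, in the same order or in opposite orders. *)
Lemma square_sites D E1 E2 F : surgery D E1 -> surgery D E2 -> surgery E1 F -> surgery E2 F ->
  E1 = E2 \/ exists s t, square D E1 E2 F s t.
Proof.
move=> /existsP [s Hs] /existsP [t Ht] /existsP [t' Ht'] /existsP [s' Hs'].
case: (eqVneq s t) => [e|n]; first by left; apply: (surgery_at_fun Hs); rewrite e.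
have sD : has_site D s by exact: site_cup_in Hs.
have tD : has_site D t by exact: site_cup_in Ht.
have H u : has_site D u && (u != s) && (u != t') = has_site D u && (u != t) && (u != s').
  by rewrite -(has_site_surgery u Hs) -(has_site_surgery u Ht')
     -(has_site_surgery u Ht) -(has_site_surgery u Hs').
right; exists s, t; split=> //.
  by have := H t; rewrite tD eqxx [t == s]eq_sym n /= => /negbFE /eqP ->.
by have := H s; rewrite sD eqxx n /= => /esym /negbFE /eqP ->.
Qed.
End Square.

Section Squares.
Variables (B : block) (h : nat) (D E1 E2 F : stacked B h) (s t : surgery_site B h).
Hypothesis sq : square D E1 E2 F s t.
Let Hs : surgery_at D E1 s. Proof. by case: sq. Qed.
Let Ht : surgery_at D E2 t. Proof. by case: sq. Qed.
Let Ht1 : surgery_at E1 F t. Proof. by case: sq. Qed.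
Let Hs2 : surgery_at E2 F s. Proof. by case: sq. Qed.

(** An orientation of F can be carried back over a final merge and further back
unless the first step is a split; if the last step is not a merge, an
orientation of D that fits E1 can be carried to F. *)
Lemma common_orientation_side (o : orientation D) (o1 : orientation E1) (nu' : orientation F) :
  ~~ (splits D E1 s && merges E1 F t) -> exists y, is_orientation D y && is_orientation F y.
Proof.
move=> n; have K1 := not_same_twice Hs; have K2 := not_same_twice Ht1.
have after (y : orientation D) : is_orientation E1 (val y) -> ~~ merges E1 F t -> is_orientation F (val y).
  move=> y1; rewrite /merges; pose y' : orientation E1 := exist (is_orientation E1) _ y1 => m.
  have cd : ~~ same_comp F (ihi t) (jhi t).
    move: m; case ac: (same_comp E1 (ilo t) (ihi t)) => //; by rewrite K2.
  case: (boolP (same_comp E1 (ilo t) (ihi t))) => ac; first exact: (split_after Ht1 nu' y').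
  exact: (reconnect_after Ht1 nu' y').
case m2: (merges E1 F t).
  case/andP: (m2) => ac cd; have i1 := merge_before Ht1 o1 nu' ac cd.
  pose n1 : orientation E1 := exist (is_orientation E1) _ i1.
  exists (val nu'); rewrite (valP nu') andbT; rewrite m2 andbT /splits in n.
  case: (boolP (same_comp D (ilo s) (ihi s))) n K1 => ac1 //= n K1.
    by rewrite K1 in n.
  case: (boolP (same_comp E1 (ihi s) (jhi s))) => cd1; first exact: (merge_before Hs o n1).
  exact: (reconnect_before Hs o n1).
case: (boolP (same_comp D (ilo s) (ihi s))) => ac1.
  exists (val o); rewrite (valP o); apply: after; rewrite ?m2 //.
  exact: (split_after Hs o1 o ac1 (K1 ac1)).
case: (boolP (same_comp E1 (ihi s) (jhi s))) => cd1.
  have [y y1] := merge_orientation Hs o ac1 cd1.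
  by exists (val y); rewrite (valP y); apply: after; rewrite ?m2.
exists (val o); rewrite (valP o); apply: after; rewrite ?m2 //.
exact: (reconnect_after Hs o1 o).
Qed.

(** The condition at the cup of t, which is missing in F, holds because of D. *)
Lemma common_orientation_between y : is_orientation D y -> is_orientation F y -> is_orientation E1 y.
Proof.
move=> yD yF; apply: (orientation_before Ht1 yF).
exact: (orientation_cup (exist (is_orientation D) _ yD : orientation D)) (site_cup_adj_lo Ht).
Qed.
End Squares.

(** * The hues of two splits *)
Section Strands.
Variables (B : block) (h : nat).
Local Notation vertex := (vertex B h).
Implicit Types (E : stacked B h) (x u v : vertex) (y : h.+1.-tuple (weight B)) (b : bool).

(** Taking only one hue on a component makes the set closed under undotted arcs.
*)
Definition strand E y x b : pred vertex := fun v => same_comp E x v && (hue y v == b).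

Definition strand_val E y x b v := right_val (strand E y x b) v.

Lemma strand_inP E y x b : inP x.1 -> forall v, strand E y x b v -> inP v.1.
Proof. by move=> xP v /andP [xv _]; rewrite -(same_comp_inP xv). Qed.

Lemma strand_closed E (y : orientation E) x b : und_closed E (strand E (val y) x b).
Proof. exact: und_closed_hue (@und_closed_comp _ _ E x). Qed.

Lemma strand_val_comp E (y : orientation E) x b u v : inP x.1 -> same_comp E u v ->
  strand_val E (val y) x b u = strand_val E (val y) x b v.
Proof. by move=> xP; apply: right_val_comp; [exact: strand_inP|exact: strand_closed]. Qed.

Lemma strand_val_pair E (y : orientation E) x b u v u' v' : inP x.1 ->
  same_comp E u u' && same_comp E v v' || same_comp E v u' && same_comp E u v' ->
  strand_val E (val y) x b u (+) strand_val E (val y) x b v =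
  strand_val E (val y) x b u' (+) strand_val E (val y) x b v'.
Proof.
move=> xP /orP [] /andP [e1 e2]; last rewrite addbC;
by rewrite (strand_val_comp y b xP e1) (strand_val_comp y b xP e2).
Qed.

Lemma strand_val_line E (y : orientation E) x b v : inP x.1 -> ~~ on_line E x -> on_line E v ->
  strand_val E (val y) x b v = false.
Proof.
move=> xP nx /existsP [z /andP [vz ez]]; rewrite (strand_val_comp y b xP vz).
apply: (right_val_line_end (strand_inP xP) (@strand_closed E y x b) _ ez) => u /andP [xu _].
by apply: contra nx => eu; exact: on_line_end eu xu.
Qed.
(** One piece is a circle and the other a line, on which the value is 0. *)
Lemma strand_val_circle E (u : surgery_site B h) (y : orientation E) x x' b :
  inP x.1 -> ~~ on_line E x -> same_comp E x x' -> x' \in [:: ihi u; jhi u] ->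
  on_line E (ihi u) = ~~ on_line E (jhi u) ->
  strand_val E (val y) x b (ihi u) (+) strand_val E (val y) x b (jhi u) = strand_val E (val y) x b x.
Proof.
move=> xP nx xx' + le; have nx' : ~~ on_line E x' by rewrite -(on_line_comp xx').
rewrite (strand_val_comp y b xP xx') !inE => /orP [] /eqP e; rewrite -e in le *.
  by rewrite (negPf nx') in le; rewrite (strand_val_line y b xP nx (negbFE (esym le))) addbF.
by rewrite nx' in le; rewrite (strand_val_line y b xP nx le).
Qed.
End Strands.

Section OneSurgery.
Variables (B : block) (h : nat) (X Y : stacked B h) (s : surgery_site B h).
Hypothesis Hs : surgery_at X Y s.
Variable y : h.+1.-tuple (weight B).
Hypotheses (yX : is_orientation X y) (yY : is_orientation Y y).
Let oX : orientation X := exist (is_orientation X) y yX.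
Let oY : orientation Y := exist (is_orientation Y) y yY.

Lemma hue_jlo_jhi : hue y (jlo s) = hue y (jhi s).
Proof. exact: (hue_ray oY) (site_ray_adj2 Hs). Qed.

Lemma hue_ihi_jhi : ~~ odd (pcount s.1.1.2) -> hue y (ihi s) = hue y (jhi s).
Proof.
move=> p; have := hue_cup oX (site_cup_adj_hi Hs) => /=.
have -> : s.2 = false by apply: contraNF p => /(site_dotted Hs).
by do 2!case: (hue _ _).
Qed.

Lemma strand_val_cups x b : ~~ same_comp X (ilo s) (ihi s) -> touched X s x ->
  strand_val X y x b (ilo s) (+) strand_val X y x b (ihi s) =
  (hue y (jhi s) == b) && odd (pcount s.1.1.2).
Proof.
move=> ac tx; have xP : inP x.1.
  by case/orP: tx => h1; rewrite -(same_comp_inP h1) (site_inP1 Hs).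
rewrite (strand_val_comp oX b xP (same_a_b Hs)) (strand_val_comp oX b xP (same_c_d Hs)).
rewrite [LHS](right_val_cups Hs (strand_inP xP) (@strand_closed _ _ X oX x b)).
have e : same_comp X x (jlo s) (+) same_comp X x (jhi s).
  rewrite ![same_comp X x _]same_comp_sym -(same_comp_eq x (same_a_b Hs)) -(same_comp_eq x (same_c_d Hs)).
  case/orP: tx => xz; rewrite xz.
    suff -> : same_comp X (ihi s) x = false by [].
    apply: contraNF ac => xz'; apply: same_comp_trans xz _; by rewrite same_comp_sym.
  suff -> : same_comp X (ilo s) x = false by [].
  apply: contraNF ac => xz'; apply: same_comp_trans xz' _; by rewrite same_comp_sym.
rewrite /strand /= hue_jlo_jhi; move: e.
by do 2!case: (same_comp _ _ _) => //=; rewrite ?addbF.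
Qed.

Lemma strand_val_rays x b : ~~ same_comp Y (ihi s) (jhi s) -> touched X s x ->
  strand_val Y y x b (ihi s) (+) strand_val Y y x b (jhi s) =
  (hue y (jhi s) == b) && ~~ odd (pcount s.1.1.2).
Proof.
move=> cd tx; rewrite (touched_after Hs) in tx; have xP : inP x.1.
  by case/orP: tx => h1; rewrite -(same_comp_inP h1) ?(site_inP1 Hs) ?(site_inP2 Hs).
rewrite [LHS](right_val_rays Hs (strand_inP xP) (@strand_closed _ _ Y oY x b)).
case p: (odd _); first by rewrite !andbF.
have e : same_comp Y x (ihi s) (+) same_comp Y x (jhi s).
  rewrite ![same_comp Y x _]same_comp_sym.
  case/orP: tx => xz; rewrite xz.
    suff -> : same_comp Y (jhi s) x = false by [].
    apply: contraNF cd => xz'; apply: same_comp_trans xz _; by rewrite same_comp_sym.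
  suff -> : same_comp Y (ihi s) x = false by [].
  apply: contraNF cd => xz'; apply: same_comp_trans xz' _; by rewrite same_comp_sym.
rewrite /strand /= (hue_ihi_jhi (negbT p)); move: e.
by do 2!case: (same_comp _ _ _) => //=; rewrite ?addbF.
Qed.
End OneSurgery.

Section Signs.
Variables (B : block) (h : nat) (D E1 E2 F : stacked B h) (s t : surgery_site B h).
Hypothesis sq : square D E1 E2 F s t.
Let Hs : surgery_at D E1 s. Proof. by case: sq. Qed.
Let Ht : surgery_at D E2 t. Proof. by case: sq. Qed.
Let Ht1 : surgery_at E1 F t. Proof. by case: sq. Qed.
Let Hs2 : surgery_at E2 F s. Proof. by case: sq. Qed.
Variable y : h.+1.-tuple (weight B).
Hypotheses (yD : is_orientation D y) (yF : is_orientation F y).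
Let y1 : is_orientation E1 y := common_orientation_between sq yD yF.
Let y2 : is_orientation E2 y := common_orientation_between (square_sym sq) yD yF.
Let oD : orientation D := exist (is_orientation D) y yD.
Let o1 : orientation E1 := exist (is_orientation E1) y y1.
Let o2 : orientation E2 := exist (is_orientation E2) y y2.
Let oF : orientation F := exist (is_orientation F) y yF.
Local Notation p u := (odd (pcount u.1.1.2)).

(** The two components of E1 that s has created are the two that t merges, so
the sum of the right counts on them can be evaluated at the rays of s and at the
cup of t. *)
Lemma hue_split_merge : ~~ same_comp E1 (ihi s) (jhi s) -> merges E1 F t -> same_comp F (ihi s) (jhi s) ->
  forall b, (hue y (jhi s) == b) && ~~ p s = (hue y (jhi t) == b) && p t.
Proof.
move=> cd /andP [ac _] cd' b; have pr := merge_pair Ht1 cd cd'.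
have dP : inP (jhi s).1 := site_inP2 Hs.
have ts : touched E1 t (jhi s).
  by case/orP: pr => /andP [e1 e2]; rewrite /touched ?e1 ?e2 ?orbT.
rewrite -(strand_val_rays Hs yD y1 b cd (touched_d Hs)) -(strand_val_cups Ht1 y1 yF b ac ts).
exact/esym/(strand_val_pair o1).
Qed.

(** Both cups connect the same two components of D, so the sum of the right
counts on them can be evaluated at both. *)
Lemma hue_before : ~~ same_comp D (ilo s) (ihi s) -> ~~ same_comp D (ilo t) (ihi t) ->
  same_comp E1 (ilo t) (ihi t) ->
  forall b, (hue y (jhi s) == b) && p s = (hue y (jhi t) == b) && p t.
Proof.
move=> acs act act' b; have pr := merge_pair Hs act act'.
have dP : inP (jhi s).1 := site_inP2 Hs.
have tt : touched D t (jhi s).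
  rewrite -(touched_comp t (same_c_d Hs)) /touched ![same_comp D _ (ihi s)]same_comp_sym.
  by case/orP: pr => /andP [e1 e2]; rewrite ?e1 ?e2 ?orbT.
rewrite -(strand_val_cups Hs yD y1 b acs (touched_d Hs)) -(strand_val_cups Ht yD y2 b act tt).
exact: (strand_val_pair oD).
Qed.

(** The pieces that s and t create are the same two components of F. *)
Lemma hue_after : same_comp E1 (ihi s) (jhi s) -> ~~ same_comp F (ihi s) (jhi s) ->
  ~~ same_comp F (ihi t) (jhi t) ->
  forall b, (hue y (jhi s) == b) && ~~ p s = (hue y (jhi t) == b) && ~~ p t.
Proof.
move=> cd cd' cdt b; have pr := split_pair Ht1 cd cd'.
have dP : inP (jhi s).1 := site_inP2 Hs.
have tt : touched E1 t (jhi s).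
  by rewrite (touched_after Ht1); case/orP: pr => /andP [e1 e2]; rewrite ?e1 ?e2 ?orbT.
rewrite -(strand_val_rays Hs2 y2 yF b cd' (touched_d Hs2)) -(strand_val_rays Ht1 y1 yF b cdt tt).
exact/esym/(strand_val_pair oF).
Qed.

(** A circle of F that contains a corner of s was part of a line in E1, since
reconnections leave lines; hence t created it. *)
Lemma reconnect_split_one x : reconnects D E1 s ->
  x \in [:: ihi s; jhi s] -> ~~ on_line F x ->
  exists2 x', x' \in [:: ihi t; jhi t] & same_comp F x x'.
Proof.
move=> /andP [ac cd] xi nx; have lx : on_line E1 x.
  apply: (touched_line Hs ac cd _).2; move: xi.
  by rewrite !inE => /orP [] /eqP ->; [exact: touched_c|exact: touched_d Hs].
have : touched E1 t x by apply: contraR nx => nt; rewrite -(on_line_untouched Ht1 nt).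
rewrite (touched_after Ht1) => /orP [] e; [exists (ihi t)|exists (jhi t)];
by rewrite ?inE ?eqxx ?orbT // same_comp_sym.
Qed.

(** In E2 the component of s is a line, since reconnections leave lines, so one
of its two pieces is a line and one is a circle. *)
Lemma line_split_circle : reconnects D E1 s -> splits E2 F s -> reconnects D E2 t ->
  on_line F (ihi s) = ~~ on_line F (jhi s).
Proof.
move=> /andP [ac cd] sp r; case/andP: (sp) => ac2 cd2.
have lc : on_line E2 (ihi s).
  by apply: (reconnect_line Ht r); have [] := touched_line Hs ac cd (touched_c D s).
have := split_line Hs2 ac2 (touched_c E2 s) lc; have := split_has_circle Hs2 ac2 cd2.
by do 2!case: (on_line _ _).
Qed.
End Signs.

Section LineSplit.
Variables (B : block) (h : nat) (D E1 E2 F : stacked B h) (s t : surgery_site B h).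
Hypothesis sq : square D E1 E2 F s t.
Let Hs : surgery_at D E1 s. Proof. by case: sq. Qed.
Let Ht : surgery_at D E2 t. Proof. by case: sq. Qed.
Let Ht1 : surgery_at E1 F t. Proof. by case: sq. Qed.
Let Hs2 : surgery_at E2 F s. Proof. by case: sq. Qed.
Hypotheses (rs : reconnects D E1 s) (st : splits E1 F t).
Hypotheses (rt : reconnects D E2 t) (ss : splits E2 F s).

Variable y : h.+1.-tuple (weight B).
Hypotheses (yD : is_orientation D y) (yF : is_orientation F y).
Let y1 : is_orientation E1 y := common_orientation_between sq yD yF.
Let y2 : is_orientation E2 y := common_orientation_between (square_sym sq) yD yF.
Let oF : orientation F := exist (is_orientation F) y yF.
Local Notation p u := (odd (pcount u.1.1.2)).

(** As in [hue_after], although only one of the two pieces is the same for s and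
t, namely the circle; the lines contribute 0. *)
Lemma hue_after_lines b :
  (hue y (jhi s) == b) && ~~ p s = (hue y (jhi t) == b) && ~~ p t.
Proof.
have [acs cds] := andP ss; have [act cdt] := andP st.
have ls := line_split_circle sq rs ss rt.
have lt := line_split_circle (square_sym sq) rt st rs.
have [x xi nx] : exists2 x, x \in [:: ihi s; jhi s] & ~~ on_line F x.
  case/orP: (split_has_circle Hs2 acs cds) => nl; [exists (ihi s)|exists (jhi s)] => //;
  by rewrite !inE eqxx ?orbT.
have xP : inP x.1.
  by move: xi; rewrite !inE => /orP [] /eqP ->; [exact: (site_inP1 Hs)|exact: (site_inP2 Hs)].
have [x' xi' xx'] := reconnect_split_one sq rs xi nx.
have nx' : ~~ on_line F x' by rewrite -(on_line_comp xx').
have x'P : inP x'.1 by rewrite -(same_comp_inP xx').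
have tx : touched E2 s x.
  by rewrite (touched_after Hs2); move: xi; rewrite !inE => /orP [] /eqP ->; rewrite same_comp_refl ?orbT.
have tx' : touched E1 t x.
  by rewrite (touched_after Ht1); move: xi'; rewrite !inE => /orP [] /eqP e; rewrite e in xx';
     rewrite ![same_comp F _ x]same_comp_sym xx' ?orbT.
rewrite -(strand_val_rays Hs2 y2 yF b cds tx) -(strand_val_rays Ht1 y1 yF b cdt tx').
rewrite (strand_val_circle oF b xP nx (same_comp_refl F x) xi ls).
exact/esym/(strand_val_circle oF b xP nx xx' xi' lt).
Qed.
End LineSplit.

(** According to the parities, one of the two families of equations is not
trivial. *)
Lemma same_hue (u v p q : bool) :
  (forall b, (u == b) && p = (v == b) && q) -> (forall b, (u == b) && ~~ p = (v == b) && ~~ q) ->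
  u = v.
Proof.
move=> H K; move: (H true) (H false) (K true) (K false); clear.
by case: u; case: v; case: p; case: q.
Qed.

Section Words.
Variables (R : realType) (B : block) (h : nat).
Implicit Types (X Y F : stacked B h) (s t : surgery_site B h) (y : h.+1.-tuple (weight B)).

(** By the condition at the removed cup, [split_eps] is the ratio of the labels
at i and j. *)
Lemma split_word_signed X Y F s y w : surgery_at X Y s -> is_orientation X y ->
  split_word R F s w = (-1) ^+ hue y (jhi s) *: (signed_word R F y (jhi s) w + signed_word R F y (ihi s) w).
Proof.
move=> Hs yX; pose oX : orientation X := exist (is_orientation X) y yX.
have e := orientation_cup oX (site_cup_adj_hi Hs); rewrite /= in e.
rewrite /split_word /signed_word !scalerDr !scalerA.
have eq2 (V : lmodType R[i]) (a b a' b' : R[i]) (u v : V) : a = a' -> b = b' -> a *: u + b *: v = a' *: u + b' *: v.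
  by move=> -> ->.
apply: eq2.
  rewrite /hue /vee_sign (site_pcount Hs) -signr_odd.
  by case: (odd _); case: (vee _ _); rewrite ?expr0 ?expr1 ?mulrNN ?mulr1 ?mul1r.
rewrite /hue /vee_sign (site_pcount Hs) -signr_odd /split_eps; move: e.
by case: (odd _); case: (vee _ _); case: (vee _ _); case: (s.2) => //= _; rewrite ?expr0 ?expr1 ?mulrNN ?mulr1 ?mul1r.
Qed.

Lemma signed_word_pair F (y : orientation F) u v u' v' w :
  same_comp F u u' && same_comp F v v' || same_comp F v u' && same_comp F u v' ->
  signed_word R F (val y) v w + signed_word R F (val y) u w = signed_word R F (val y) v' w + signed_word R F (val y) u' w.
Proof.
case/orP => /andP [e1 e2]; rewrite (signed_word_comp R y w e1) (signed_word_comp R y w e2); last exact: addrC.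
by [].
Qed.
End Words.

(** * Words added by two splits *)
Section SplitWords.
Variables (R : realType) (B : block) (h : nat) (D E1 E2 F : stacked B h) (s t : surgery_site B h).
Hypothesis sq : square D E1 E2 F s t.
Let Hs : surgery_at D E1 s. Proof. by case: sq. Qed.
Let Ht : surgery_at D E2 t. Proof. by case: sq. Qed.
Let Ht1 : surgery_at E1 F t. Proof. by case: sq. Qed.
Let Hs2 : surgery_at E2 F s. Proof. by case: sq. Qed.
Variable y : h.+1.-tuple (weight B).
Hypotheses (yD : is_orientation D y) (yF : is_orientation F y).
Let oF : orientation F := exist (is_orientation F) y yF.

(** All corners lie on one component of F, so all signed words coincide. *)
Lemma split_words_merged w : splits D E1 s -> merges E1 F t -> splits D E2 t -> merges E2 F s ->
  split_word R F s w = split_word R F t w.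
Proof.
move=> /andP [acs cds] mt /andP [act cdt] ms.
have [_ cds'] := andP ms; have [_ cdt'] := andP mt.
have e : hue y (jhi s) = hue y (jhi t).
  have H := hue_split_merge sq yD yF cds mt cds'.
  have K := hue_split_merge (square_sym sq) yD yF cdt ms cdt'.
  apply: (@same_hue _ _ (odd (pcount s.1.1.2)) (~~ odd (pcount t.1.1.2))) => b.
    by rewrite -K.
  by rewrite negbK H.
rewrite (split_word_signed R F w Hs yD) (split_word_signed R F w Ht yD) e.
apply: (congr1 (fun z => (-1) ^+ hue y (jhi t) *: z)).
have pr := merge_pair Ht1 cds cds'.
have ts : touched E1 t (jhi s).
  by case/orP: pr => /andP [e1 e2]; rewrite /touched ?e1 ?e2 ?orbT.
have st := merged_touched Ht1 cdt' ts (touched_d Ht1).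
apply: (signed_word_pair R oF); rewrite st andbT.
apply/orP; left; apply: same_comp_trans cds' _; apply: same_comp_trans st _.
by rewrite same_comp_sym.
Qed.

(** The two components of F that carry an added letter are the same for s and t.
*)
Lemma split_words_after w : merges D E1 s -> splits E1 F t -> merges D E2 t -> splits E2 F s ->
  split_word R F s w = split_word R F t w.
Proof.
move=> /andP [acs cds] /andP [act' cdt'] /andP [act cdt] /andP [acs' cds'].
have e : hue y (jhi s) = hue y (jhi t).
  exact: same_hue (hue_before sq yD yF acs act act') (hue_after sq yD yF cds cds' cdt').
rewrite (split_word_signed R F w Hs yD) (split_word_signed R F w Ht yD) e.
apply: (congr1 (fun z => (-1) ^+ hue y (jhi t) *: z)).
by apply: esym; apply: (signed_word_pair R oF); exact: (split_pair Ht1 cds cds').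
Qed.

(** Only the circle among the two pieces contributes, and it is the same for s
and t. *)
Lemma split_words_reconnected w : reconnects D E1 s -> splits E1 F t -> reconnects D E2 t -> splits E2 F s ->
  split_word R F s w = split_word R F t w.
Proof.
move=> rs st rt ss; have [acs cds] := andP rs; have [act cdt] := andP rt.
have [act' cdt'] := andP st; have [acs' cds'] := andP ss.
have e : hue y (jhi s) = hue y (jhi t).
  exact: same_hue (hue_before sq yD yF acs act act') (hue_after_lines sq rs st rt ss yD yF).
rewrite (split_word_signed R F w Hs yD) (split_word_signed R F w Ht yD) e.
apply: (congr1 (fun z => (-1) ^+ hue y (jhi t) *: z)).
have ls := line_split_circle sq rs ss rt.
have lt := line_split_circle (square_sym sq) rt st rs.
have one u x x' : x' \in [:: ihi u; jhi u] -> ~~ on_line F x -> same_comp F x x' ->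
    on_line F (ihi u) = ~~ on_line F (jhi u) ->
    signed_word R F y (jhi u) w + signed_word R F y (ihi u) w = signed_word R F y x w.
  move=> + nx xx' le; have nx' : ~~ on_line F x' by rewrite -(on_line_comp xx').
  rewrite (signed_word_comp R oF w xx') !inE => /orP [] /eqP ex; rewrite -ex in le *.
    by rewrite (negPf nx') in le; rewrite (signed_word_line R y w (negbFE (esym le))) add0r.
  by rewrite nx' in le; rewrite (signed_word_line R y w le) addr0.
have [x xi nx] : exists2 x, x \in [:: ihi s; jhi s] & ~~ on_line F x.
  case/orP: (split_has_circle Hs2 acs' cds') => nl; [exists (ihi s)|exists (jhi s)] => //;
  by rewrite !inE eqxx ?orbT.
have [x' xi' xx'] := reconnect_split_one sq rs xi nx.
by rewrite (one s x x xi nx (same_comp_refl F x) ls) (one t x x' xi' nx xx' lt).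
Qed.
End SplitWords.

(** * Propagating lines in a square *)
Section Flags.
Variables (B : block) (h : nat) (D E1 E2 F : stacked B h) (s t : surgery_site B h).
Hypothesis sq : square D E1 E2 F s t.
Let Hs : surgery_at D E1 s. Proof. by case: sq. Qed.
Let Ht : surgery_at D E2 t. Proof. by case: sq. Qed.
Let Ht1 : surgery_at E1 F t. Proof. by case: sq. Qed.
Let Hs2 : surgery_at E2 F s. Proof. by case: sq. Qed.

Lemma corner_lines X Y u : @surgery_at B h X Y u -> reconnects X Y u ->
  [/\ on_line X (ilo u), on_line X (ihi u), on_line Y (ihi u) & on_line Y (jhi u)].
Proof.
move=> H /andP [ac cd]; have [l1 _] := touched_line H ac cd (touched_a X u).
have [l2 l3] := touched_line H ac cd (touched_c X u).
by have [_ l4] := touched_line H ac cd (touched_d H).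
Qed.

(** One of the pieces that s creates in E1 is a circle, and the reconnection at
t keeps it a circle; but reconnecting at s in E2 leaves lines. *)
Lemma no_split_reconnect : splits D E1 s -> reconnects E1 F t -> ~~ reconnects E2 F s.
Proof.
move=> /andP [ac cd] /andP [act cdt]; apply/negP => r; have [_ _ lc ld] := corner_lines Hs2 r.
have bad x : on_line F x -> on_line E1 x.
  move=> lx; case tx: (touched E1 t x); last by rewrite (on_line_untouched Ht1) ?tx.
  by have [] := touched_line Ht1 act cdt tx.
by have := split_has_circle Hs ac cd; rewrite !bad.
Qed.

(** A merge involves a circle, but the corners of s stay on lines. *)
Lemma no_reconnect_merge : reconnects D E1 s -> reconnects D E2 t -> ~~ merges E2 F s.
Proof.
move=> rs rt; apply/negP => /andP [ac cd]; have [la lc _ _] := corner_lines Hs rs.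
by have := merge_has_circle Hs2 ac cd; rewrite !(reconnect_line Ht rt).
Qed.

Lemma both_propagating_merge : merges D E1 s -> reconnects D E2 t -> both_propagating E1 t = both_propagating D t.
Proof.
move=> m r; have [la lc _ _] := corner_lines Ht r.
by rewrite /both_propagating !(merge_prop Hs m).
Qed.

Lemma both_propagating_split : splits D E1 s -> reconnects E1 F t -> both_propagating E1 t = both_propagating D t.
Proof.
move=> m r; have [la lc _ _] := corner_lines Ht1 r.
by rewrite /both_propagating !(split_prop Hs m).
Qed.

Lemma both_propagating_line : reconnects D E1 s -> splits E1 F t -> ~~ same_comp D (ilo t) (ihi t) -> both_propagating D s = both_propagating D t.
Proof.
move=> r /andP [act _] n; case/orP: (merge_pair Hs n act) => /andP [e1 e2].
  by rewrite /both_propagating (prop_comp e1) (prop_comp e2).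
by rewrite /both_propagating (prop_comp e1) (prop_comp e2) andbC.
Qed.

(** After the reconnection at s no line involved in it propagates any more. *)
Lemma propagating_untouched : reconnects D E1 s -> both_propagating D s -> both_propagating E1 t ->
  [/\ ~~ touched D s (ilo t), ~~ touched D s (ihi t) & both_propagating D t].
Proof.
move=> r /andP [pa pc] /andP [qa qc].
have na : ~~ touched D s (ilo t).
  by apply: contraL qa => ta; exact: (reconnect_not_prop Hs r pa pc ta).
have nc : ~~ touched D s (ihi t).
  by apply: contraL qc => tc; exact: (reconnect_not_prop Hs r pa pc tc).
by rewrite /both_propagating -!(untouched_prop Hs) // qa qc.
Qed.

Lemma propagating_swap : reconnects D E1 s -> both_propagating D s -> both_propagating E1 t -> both_propagating D t && both_propagating E2 s.
Proof.
move=> r fs ft; have [na nc fD] := propagating_untouched r fs ft; rewrite fD /=.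
have nt x : touched D s x -> ~~ touched D t x.
  move=> tx; apply/negP => /orP [] e; rewrite -(touched_comp s e) in tx.
    by rewrite tx in na.
  by rewrite tx in nc.
rewrite /both_propagating !(untouched_prop Ht) ?nt ?touched_a ?touched_c //.
Qed.

Lemma propagating_reconnect_merge : reconnects D E1 s -> merges D E2 t -> both_propagating D s && both_propagating E1 t = false.
Proof.
move=> r /andP [ac cd]; apply/negP => /andP [fs ft].
have [_ _ /andP [/prop_line la /prop_line lc]] := propagating_untouched r fs ft.
by have := merge_has_circle Ht ac cd; rewrite la lc.
Qed.

Lemma propagating_reconnect_split : reconnects D E1 s -> reconnects E1 F t -> splits D E2 t ->
  both_propagating D s && both_propagating E1 t = false.
Proof.
move=> r /andP [n _] /andP [ac _]; apply/negP => /andP [fs ft].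
have [na _ _] := propagating_untouched r fs ft.
by rewrite -(untouched_same Hs _ na) ac in n.
Qed.
End Flags.

(** * Two successive surgeries *)
Section FlagMerges.
Variables (B : block) (h : nat) (D E1 E2 F : stacked B h) (s t : surgery_site B h).
Hypothesis sq : square D E1 E2 F s t.
Let Hs : surgery_at D E1 s. Proof. by case: sq. Qed.
Let Ht : surgery_at D E2 t. Proof. by case: sq. Qed.
Let Ht1 : surgery_at E1 F t. Proof. by case: sq. Qed.
Let Hs2 : surgery_at E2 F s. Proof. by case: sq. Qed.

(** The corner of t on a circle of D lies on a line of E1, so this circle is
merged at s with the line of a corner of s.  The other corner of t then lies on
a line that s does not involve. *)
Lemma propagating_line_partner : merges D E1 s -> reconnects E1 F t -> merges D E2 t ->
  exists v', [/\ v' \in [:: ilo t; ihi t], on_line D v' & forall u', u' \in [:: ilo s; ihi s] -> on_line D u' ->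
    both_propagating E1 t = on_propagating_line D u' && on_propagating_line D v'].
Proof.
move=> ms r /andP [act cdt]; have [la lc _ _] := corner_lines Ht1 r.
have [n _] := andP r; have [_ cds] := andP ms.
have [v [v' [/andP [vi nv] lv lv' nvv' ef]]] : exists v v', [/\ (v' \in [:: ilo t; ihi t]) && ~~ on_line D v, on_line E1 v, on_line E1 v',
    ~~ same_comp E1 v v' & both_propagating E1 t = on_propagating_line E1 v && on_propagating_line E1 v'].
  case/orP: (merge_has_circle Ht act cdt) => nl.
    by exists (ilo t), (ihi t); split=> //; rewrite !inE eqxx orbT.
  by exists (ihi t), (ilo t); split=> //; [rewrite !inE eqxx|rewrite same_comp_sym|rewrite /both_propagating andbC].
have tv : touched D s v.
  by apply: contraR nv => ntv; rewrite (on_line_untouched Hs).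
have nv' : ~~ touched D s v'.
  by apply: contra nvv' => tv'; exact: (merged_touched Hs).
exists v'; split=> //; first by rewrite (on_line_untouched Hs).
move=> u' ui lu; have tu : touched D s u'.
  by move: ui; rewrite !inE => /orP [] /eqP ->; [exact: touched_a|exact: touched_c].
rewrite ef (untouched_prop Hs nv'); congr (_ && _).
by rewrite (prop_comp (merged_touched Hs cds tv tu)) (merge_prop Hs ms lu).
Qed.
End FlagMerges.

Section Square.
Variables (R : realType) (B : block) (h : nat).
Implicit Types (D E F : stacked B h) (s t : surgery_site B h).

(** By [propagating_line_partner], each side reconnects the same two lines of D,
one through a corner of s and one through a corner of t. *)
Lemma propagating_merges D E1 E2 F s t : square D E1 E2 F s t ->
  merges D E1 s -> reconnects E1 F t -> merges D E2 t -> reconnects E2 F s -> both_propagating E1 t = both_propagating E2 s.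
Proof.
move=> sq ms rt mt rs; have sq' := square_sym sq.
have [v' [vi lv Hv]] := propagating_line_partner sq ms rt mt.
have [u' [ui lu Hu]] := propagating_line_partner sq' mt rs ms.
by rewrite (Hv u' ui lu) (Hu v' vi lv) andbC.
Qed.

Variant step_kind D E s : Prop :=
  | StepMerge of merges D E s & ncomp D = (ncomp E).+1
  | StepSplit of splits D E s & ncomp E = (ncomp D).+1
  | StepReconnect of reconnects D E s & ncomp D = ncomp E.

Lemma step_kindP D E s : surgery_at D E s -> step_kind D E s.
Proof.
move=> Hs; have := ncomp_surgery Hs; have := not_same_twice Hs.
case ac: (same_comp D _ _); case cd: (same_comp E _ _) => //=.
- by move=> /(_ isT).
- by move=> _; rewrite addn0 addn1 => e; apply: StepSplit; rewrite /splits ?ac ?cd.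
- by move=> _; rewrite addn0 addn1 => e; apply: StepMerge; rewrite /merges ?ac ?cd.
- by move=> _ /addIn e; apply: StepReconnect; rewrite /reconnects ?ac ?cd.
Qed.

Variant two_steps D E F s t w : Dspace R F -> Prop :=
  | MergeMerge of merges D E s & merges E F t & ncomp D = (ncomp F).+2 : two_steps D E s t w (word R F w)
  | MergeSplit of merges D E s & splits E F t & ncomp D = ncomp F : two_steps D E s t w (split_word R F t w)
  | MergeReconnect of merges D E s & reconnects E F t & ncomp D = (ncomp F).+1 :
      two_steps D E s t w ((both_propagating E t)%:R *: word R F w)
  | SplitMerge of splits D E s & merges E F t & ncomp D = ncomp F : two_steps D E s t w (split_word R F s w)
  | SplitSplit of splits D E s & splits E F t & ncomp F = (ncomp D).+2 : two_steps D E s t w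
      ((-1) ^+ pcount s.1.1.2 *: (split_word R F t (jhi s :: w) + split_eps R s *: split_word R F t (ihi s :: w)))
  | SplitReconnect of splits D E s & reconnects E F t & ncomp F = (ncomp D).+1 :
      two_steps D E s t w ((both_propagating E t)%:R *: split_word R F s w)
  | ReconnectMerge of reconnects D E s & merges E F t & ncomp D = (ncomp F).+1 :
      two_steps D E s t w ((both_propagating D s)%:R *: word R F w)
  | ReconnectSplit of reconnects D E s & splits E F t & ncomp F = (ncomp D).+1 :
      two_steps D E s t w ((both_propagating D s)%:R *: split_word R F t w)
  | ReconnectReconnect of reconnects D E s & reconnects E F t & ncomp D = ncomp F :
      two_steps D E s t w ((both_propagating D s && both_propagating E t)%:R *: word R F w).

Lemma two_stepsP D E F s t w : orientation D -> orientation E -> surgery_at D E s -> surgery_at E F t ->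
  two_steps D E s t w (surg R E F (surg R D E (word R D w))).
Proof.
move=> o o1 Hs Ht.
have [/andP [ac cd] n1|/andP [ac cd] n1|/andP [ac cd] n1] := step_kindP Hs.
- rewrite (surg_merge R Hs w o ac cd); have m : merges D E s by rewrite /merges ac.
  have [k n2|k n2|k n2] := step_kindP Ht; have [act cdt] := andP k.
  + by rewrite (surg_merge R Ht w o1 act cdt); apply: MergeMerge => //; rewrite n1 n2.
  + by rewrite (surg_split R Ht w o1 act cdt); apply: MergeSplit => //; rewrite n1 n2.
  + by rewrite (surg_reconnect R Ht w o1 act cdt); apply: MergeReconnect => //; rewrite n1 n2.
- rewrite (surg_split R Hs w o ac cd); have m : splits D E s by rewrite /splits ac.
  rewrite surgZ surgD surgZ.
  have sc (a b : R[i]) (x : Dspace R F) : a *: (b *: x) = b *: (a *: x).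
    by rewrite !scalerA mulrC.
  have [k n2|k n2|k n2] := step_kindP Ht; have [act cdt] := andP k.
  + rewrite !(surg_merge R Ht _ o1 act cdt); apply: SplitMerge => //.
    by rewrite n1 in n2; case: n2.
  + by rewrite !(surg_split R Ht _ o1 act cdt); apply: SplitSplit => //; rewrite n2 n1.
  + rewrite !(surg_reconnect R Ht _ o1 act cdt) (sc (split_eps R s)) -scalerDr sc.
    by apply: SplitReconnect => //; rewrite -n2.
- rewrite (surg_reconnect R Hs w o ac cd) surgZ; have m : reconnects D E s by rewrite /reconnects ac.
  have [k n2|k n2|k n2] := step_kindP Ht; have [act cdt] := andP k.
  + by rewrite (surg_merge R Ht w o1 act cdt); apply: ReconnectMerge => //; rewrite n1.
  + by rewrite (surg_split R Ht w o1 act cdt); apply: ReconnectSplit => //; rewrite n1.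
  + rewrite (surg_reconnect R Ht w o1 act cdt) scalerA -natrM mulnb.
    by apply: ReconnectReconnect => //; rewrite n1.
Qed.
End Square.

(** * Commutation of surgeries *)
Section Final.
Variables (R : realType) (B : block) (h : nat).
Implicit Types (D E F : stacked B h) (s t : surgery_site B h).

Lemma split_word_on_lines F s w : on_line F (ihi s) -> on_line F (jhi s) -> split_word R F s w = 0.
Proof. by move=> lc ld; rewrite /split_word !word_line // scaler0 addr0 scaler0. Qed.

Lemma scale_exchange (V : lmodType R[i]) (a b e f : R[i]) (x y z u : V) :
  a *: (b *: (x + f *: y) + e *: (b *: (z + f *: u))) =
  b *: (a *: (x + e *: z) + f *: (a *: (y + e *: u))).
Proof.
rewrite !scalerDr !scalerA [LHS]addrACA.
by congr (_ *: _ + _ *: _ + (_ *: _ + _ *: _)); ring.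
Qed.

Lemma split_word_swap F s t w :
  (-1) ^+ pcount s.1.1.2 *: (split_word R F t (jhi s :: w) + split_eps R s *: split_word R F t (ihi s :: w)) =
  (-1) ^+ pcount t.1.1.2 *: (split_word R F s (jhi t :: w) + split_eps R t *: split_word R F s (ihi t :: w)).
Proof.
rewrite /split_word (word_swap R F (jhi t) (jhi s)).
rewrite (word_swap R F (ihi t) (jhi s)).
rewrite (word_swap R F (jhi t) (ihi s)) (word_swap R F (ihi t) (ihi s)).
exact: scale_exchange.
Qed.

(** An orientation of F violates the condition at the removed cup if E is not
orientable; the two summands of [split_word] then cancel. *)
Lemma split_word_nonorientable E F s w (nu' : orientation F) : (orientation E -> False) ->
  surgery_at E F s -> same_comp F (ihi s) (jhi s) -> split_word R F s w nu' = 0.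
Proof.
move=> no Hs cd; rewrite split_wordE.
have H := word_letter R nu' w cd.
have V : vee (val nu') (ihi s) (+) vee (val nu') (jhi s) = s.2.
  apply/eqP; rewrite -(negbK (_ == _)) -addNb; apply/negP => /negPf e.
  case: no; exists (val nu'); apply: (orientation_before Hs (valP nu')).
  rewrite (orientation_ray nu' (site_ray_adj1 Hs)) (orientation_ray nu' (site_ray_adj2 Hs)).
  by move: e; case: (vee _ _); case: (vee _ _); case: (s.2).
move: H V; rewrite /vee_sign /split_eps.
case: (vee _ _); case: (vee _ _); case: (s.2) => //=; rewrite ?expr0 ?expr1 ?mul1r ?mulN1r => H _.
- by rewrite H addrN mulr0.
- by rewrite H addrN mulr0.
- by rewrite -H addNr mulr0.
- by rewrite (oppr_inj H) addrN mulr0.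
Qed.

(** By [common_orientation_side] the side through E1 splits and merges again.
By the number of components, and since merges preserve orientability, the other
side splits and merges as well or reconnects twice. *)
Lemma square_word_half_oriented D E1 E2 F s t w (nu' : orientation F) : square D E1 E2 F s t ->
  orientation D -> orientation E1 -> (orientation E2 -> False) ->
  surg R E1 F (surg R D E1 (word R D w)) nu' = 0.
Proof.
move=> sq o o1 no2; have [Hs Ht Ht1 Hs2] := sq; have sq' := square_sym sq.
have sm : splits D E1 s && merges E1 F t.
  apply: contraT => n; have [y /andP [yD yF]] := common_orientation_side sq o o1 nu' n.
  by case: no2; exists y; exact: (common_orientation_between sq' yD yF).
have [ss mt] := andP sm.
case: (two_stepsP R w o o1 Hs Ht1); try by move=> k1 k2 _; move: ss mt k1 k2; rewrite /splits /merges /reconnects; do 4!case: (same_comp _ _ _).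
move=> _ _ n; have [m n1|k n1|k n1] := step_kindP Ht.
- have [act cdt] := andP m; have [y y2] := merge_orientation Ht o act cdt.
  by case: no2; exists (val y).
- have [/andP [_ cd] n2|k' n2|k' n2] := step_kindP Hs2.
  + exact: (split_word_nonorientable _ _ no2 Hs2 cd).
  + by exfalso; move: n n1 n2; clear; lia.
  + by exfalso; move: n n1 n2; clear; lia.
- have [m n2|k' n2|k' n2] := step_kindP Hs2.
  + by exfalso; move: n n1 n2; clear; lia.
  + by exfalso; move: n n1 n2; clear; lia.
  + have [_ _ lc ld] := corner_lines Hs2 k'.
    by rewrite split_word_on_lines // ffunE.
Qed.

(** The numbers of components leave nineteen combinations of types, two of which
do not occur.  The factors 0 or 1 that come from reconnections are matched by
the lemmas on propagating lines, and words added at different sites by the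
comparison of hues. *)
Lemma square_word_oriented D E1 E2 F s t w (nu' : orientation F) : square D E1 E2 F s t ->
  orientation D -> orientation E1 -> orientation E2 ->
  surg R E1 F (surg R D E1 (word R D w)) = surg R E2 F (surg R D E2 (word R D w)).
Proof.
move=> sq o o1 o2; have [Hs Ht Ht1 Hs2] := sq; have sq' := square_sym sq.
have [y [yD yF]] : exists y, is_orientation D y /\ is_orientation F y.
  case: (boolP (splits D E1 s && merges E1 F t)) => n; last first.
    by have [y /andP [yD yF]] := common_orientation_side sq o o1 nu' n; exists y.
  case: (boolP (splits D E2 t && merges E2 F s)) => n'; last first.
    by have [y /andP [yD yF]] := common_orientation_side sq' o o2 nu' n'; exists y.
  (* An orientation of F fits E1 and E2 before the final merges, and the
     condition at the cup of s that D adds to E1 can be read off in E2. *)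
  case/andP: n n' => _ /andP [ac cd] /andP [_ /andP [ac' cd']].
  exists (val nu'); split; last exact: valP.
  have i1 := merge_before Ht1 o1 nu' ac cd; have i2 := merge_before Hs2 o2 nu' ac' cd'.
  apply: (orientation_before Hs i1).
  exact: (orientation_cup (exist (is_orientation E2) _ i2 : orientation E2)) (site_cup_adj_lo Hs2).
case: (two_stepsP R w o o1 Hs Ht1) => k1 k2 n; case: (two_stepsP R w o o2 Ht Hs2) => l1 l2 m;
  try by exfalso; move: n m; clear; lia.
- by [].
- exact/esym/(split_words_after R sq yD yF w k1 k2 l1 l2).
- by [].
- have [_ _ lc ld] := corner_lines Ht l1.
  by rewrite (propagating_reconnect_merge sq' l1 k1) scale0r split_word_on_lines // (reconnect_line Hs2 l2).
- by rewrite (propagating_merges sq k1 k2 l1 l2).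
- by rewrite (both_propagating_merge sq k1 l1).
- by [].
- exact: (split_words_merged R sq yD yF).
- have [_ _ lc ld] := corner_lines Hs2 l2.
  by rewrite (propagating_reconnect_split sq' l1 l2 k1) scale0r split_word_on_lines.
- exact: split_word_swap.
- by case/negP: (no_split_reconnect sq k1 k2).
- by rewrite (both_propagating_split sq k1 k2).
- by rewrite (both_propagating_merge sq' l1 k1).
- by case/negP: (no_reconnect_merge sq k1 l1).
- by rewrite (both_propagating_split sq' l1 l2).
- have [act _] := andP l1; rewrite (both_propagating_line sq k1 k2 act).
  by rewrite (split_words_reconnected R sq yD yF w k1 k2 l1 l2).
- have [_ _ lc ld] := corner_lines Hs k1.
  by rewrite (propagating_reconnect_merge sq k1 l1) scale0r split_word_on_lines // (reconnect_line Ht1 k2).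
- have [_ _ lc ld] := corner_lines Ht1 k2.
  by rewrite (propagating_reconnect_split sq k1 k2 l1) scale0r split_word_on_lines.
- suff -> : both_propagating D s && both_propagating E1 t = both_propagating D t && both_propagating E2 s by [].
  by apply/idP/idP => /andP [f g]; [exact: (propagating_swap sq)|exact: (propagating_swap sq')].
Qed.

Lemma square_word D E1 E2 F s t w : square D E1 E2 F s t -> orientation D ->
  surg R E1 F (surg R D E1 (word R D w)) = surg R E2 F (surg R D E2 (word R D w)).
Proof.
move=> sq o; have sq' := square_sym sq; apply/ffunP => nu'.
have ex E : orientation E + (orientation E -> False).
  by case: (pickP (fun _ : orientation E => true)) => [x _|no]; [left|right=> x; have := no x].
have zero E (x : Dspace R E) : (orientation E -> False) -> surg R E F x nu' = 0.
  by move=> no; rewrite ffunE big1 // => mu; case: (no mu).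
case: (ex E1) (ex E2) => [o1|n1] [o2|n2].
- by rewrite (square_word_oriented w nu' sq o o1 o2).
- by rewrite (zero E2) // (square_word_half_oriented w nu' sq o o1 n2).
- by rewrite (zero E1) // (square_word_half_oriented w nu' sq' o o2 n1).
- by rewrite !zero.
Qed.
End Final.

Theorem theorem5p34 (R : realType) (B : block) (h : nat) (lam mu : weight B)
    (a b1 b2 c : h.-tuple (cup_diagram B)) :
  let D := Stacked lam a mu in
  let E1 := Stacked lam b1 mu in
  let E2 := Stacked lam b2 mu in
  let F := Stacked lam c mu in
  surgery D E1 -> surgery D E2 -> surgery E1 F -> surgery E2 F ->
  surg R E1 F \o surg R D E1 =1 surg R E2 F \o surg R D E2.
Proof.
move=> D E1 E2 F HE1 HE2 HF1 HF2 x; rewrite /=.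
have [-> //|[s [t sq]]] := square_sites HE1 HE2 HF1 HF2.
rewrite (word_span x) !surg_big; apply: eq_bigr => nu _.
by rewrite !surgZ (square_word R _ sq nu).
Qed.
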